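(* Let $X$ be a complex manifold and let $(E,h) \to X$ be a Griffiths semipositive Hermitian holomorphic vector bundle of rank $3$. Then the following pointwise inequalities of $(3,3)$-forms hold on $X$: \[ c_1(E,h)^{\wedge 3} \ \ge\ c_1(E,h)\wedge c_2(E,h)\ \ge\ c_3(E,h). \] In addition, if $X$ is compact and $3$-dimensional, the following chain of inequalities between Chern numbers holds: \[ \int_X c_1(E)^3 \ \ge\ \int_X c_1(E)\,c_2(E)\ \ge\ \int_X c_3(E). \]
   Context: For a Hermitian holomorphic vector bundle $(E,h)$ of rank $r$ over a complex manifold $X$, let $\Theta(E,h) \in \mathcal{A}^{1,1}(X,\operatorname{End}(E))$ be its Chern curvature tensor. The Chern forms are $c_k(E,h) = \operatorname{tr}_{\operatorname{End}(\Lambda^k E)}\left( \Lambda^k \frac{i}{2\pi}\Theta(E,h)\right)$ for $0 \le k \le r$; $c_k(E,h)$ represents the Chern class $c_k(E)$. $(E,h)$ is called Griffiths semipositive if for every $x\in X$, $v\in E_x$, $\tau\in T_{X,x}$ one has $\langle\Theta(E,h)_x\cdot v,v\rangle_h(\tau,\bar\tau)\ge 0$. Positivity of forms: let $V$ be a complex vector space of dimension $n$ with basis $(e_1,\dots,e_n)$ and dual basis $(e_1^\vee,\dots,e_n^\vee)$. A form $\nu\in\Lambda^{n,n}V^\vee$ is a positive volume form if $\nu = t\, i e_1^\vee\wedge\overline{e}_1^\vee\wedge\dots\wedge i e_n^\vee\wedge\overline{e}_n^\vee$ for some real $t\ge 0$ (independent of the basis). A real form $u$ of bidegree $(p,p)$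 on $V$ is called positive if, with $q=n-p$, for every decomposable $\beta=\beta_1\wedge\dots\wedge\beta_q$ with $\beta_1,\dots,\beta_q\in V^\vee$, the form $u\wedge i^{q^2}\beta\wedge\bar\beta$ is a positive volume form. A real $(p,p)$-form on $X$ is positive if it is positive on $V=T_{X,x}$ for every $x\in X$. For real $(p,p)$-forms $u,v$ on $X$, $u\ge v$ means that $u-v$ is positive in this (weak, non-strict) sense. *)

(* Defs.v *)
From HB Require Import structures.
From mathcomp Require Import all_boot all_order all_fingroup all_algebra.
From mathcomp Require Import all_classical all_reals all_analysis.
From mathcomp Require Import complex.

Set Implicit Arguments.
Unset Strict Implicit.
Unset Printing Implicit Defensive.

Import Order.TTheory GRing.Theory Num.Theory.
Import numFieldNormedType.Exports.
Local Open Scope ring_scope.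
Local Open Scope complex_scope.

(* The complex numbers over R, typed as a numClosedFieldType so that the       *)
(* topology and norm of a numFieldType are inferred on C R and 'rV[C R]_n.     *)
Definition C (R : realType) : numClosedFieldType := R[i].

Definition Cof (R : realType) (t : R) : C R := t%:C.

Section Calculus.
Variables (R : realType) (n : nat).
Implicit Types (f : 'rV[C R]_n -> C R) (v z : 'rV[C R]_n) (U : set 'rV[C R]_n).

(* C^n is regarded as a real vector space: v is a real direction, and a        *)
(* complex-valued f is differentiated through its real and imaginary parts.    *)
Definition re_line f z v : R -> R := fun t => complex.Re (f (z + Cof t *: v)).
Definition im_line f z v : R -> R := fun t => complex.Im (f (z + Cof t *: v)).

Definition rderivable f v z : Prop :=
  derivable (re_line f z v) 0 1 /\ derivable (im_line f z v) 0 1.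

Definition rderive f v z : C R :=
  Complex (derive1 (re_line f z v) 0) (derive1 (im_line f z v) 0).

Fixpoint Ck (k : nat) U f : Prop :=
  (forall z, U z -> {for z, continuous f}) /\
  if k is k'.+1 then
    forall v, (forall z, U z -> rderivable f v z) /\ Ck k' U (rderive f v)
  else True.

Definition smooth_on U f : Prop := forall k, Ck k U f.

Definition basis_vec (j : 'I_n) : 'rV[C R]_n := delta_mx 0 j.

Definition dz_deriv (j : 'I_n) f z : C R :=
  2^-1 * (rderive f (basis_vec j) z - 'i * rderive f ('i *: basis_vec j) z).
Definition dzbar_deriv (j : 'I_n) f z : C R :=
  2^-1 * (rderive f (basis_vec j) z + 'i * rderive f ('i *: basis_vec j) z).

Definition holomorphic_on U f : Prop :=
  smooth_on U f /\ forall z j, U z -> dzbar_deriv j f z = 0.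

End Calculus.

(* Basis covectors are indexed by 'I_(n + n): lshift j is dz_j and rshift j is *)
(* dzbar_j.  The coefficient of u at S is that of the product of the covectors *)
(* of S in increasing order.                                                   *)
Definition extform (R : realType) (n : nat) :=
  {ffun {set 'I_(n + n)} -> (C R)^o}.

Section ExteriorAlgebra.
Variables (R : realType) (n : nat).
Implicit Types (u v : extform R n) (S T A B : {set 'I_(n + n)}).

Definition inversions A B : nat :=
  #|[set p : 'I_(n + n) * 'I_(n + n) |
      [&& p.1 \in A, p.2 \in B & (p.2 < p.1)%N]]%SET|.

Definition wedge u v : extform R n :=
  [ffun S : {set 'I_(n + n)} => \sum_(A : {set 'I_(n + n)} | A \subset S)
     (-1) ^+ inversions A (S :\: A) * u A * v (S :\: A)].

Definition scalar_form (c : C R) : extform R n :=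
  [ffun S : {set 'I_(n + n)} => if S == finset.set0 then c else 0].

Definition covector (i : 'I_(n + n)) : extform R n :=
  [ffun S : {set 'I_(n + n)} => (S == [set i]%SET)%:R].

Definition dz (j : 'I_n) : extform R n := covector (lshift n j).
Definition dzbar (j : 'I_n) : extform R n := covector (rshift n j).

Definition hol_degree S : nat := #|[set j : 'I_n | lshift n j \in S]%SET|.
Definition antihol_degree S : nat := #|[set j : 'I_n | rshift n j \in S]%SET|.

Definition has_bidegree (p q : nat) u : Prop :=
  forall S, u S != 0 -> hol_degree S = p /\ antihol_degree S = q.

Definition swap_index (i : 'I_(n + n)) : 'I_(n + n) :=
  match fintype.split i with
  | inl j => rshift n j
  | inr j => lshift n j
  end.

(* conj (dz_I /\ dzbar_J) = dzbar_I /\ dz_J = (-1)^(|I||J|) dz_J /\ dzbar_I    *)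
Definition conj_form u : extform R n :=
  [ffun S : {set 'I_(n + n)} =>
     (-1) ^+ (hol_degree S * antihol_degree S)%N *
     Num.conj (u [set swap_index i | i in S]%SET)].

Definition real_form u : Prop := conj_form u = u.

Definition wedge_seq (q : nat) (beta : 'I_q -> extform R n) : extform R n :=
  \big[wedge/scalar_form 1]_(j < q) beta j.

Definition positive_volume (nu : extform R n) : Prop :=
  exists2 t : R, 0 <= t &
    nu = Cof t *: wedge_seq (fun j : 'I_n => 'i *: wedge (dz j) (dzbar j)).

(* The rows of b are the coordinates of beta_1, .., beta_q in the dual basis.  *)
(* If p > n, then the only form of bidegree (p, p) is 0.                       *)
Definition positive_form (p : nat) u : Prop :=
  [/\ has_bidegree p p u, real_form u &
    forall b : 'M[C R]_(n - p, n),
      let beta := wedge_seq (fun j => \sum_l b j l *: dz l) in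
      positive_volume
        (wedge u ('i ^+ ((n - p) ^ 2)%N *: wedge beta (conj_form beta)))].

Definition eval2 u (xi eta : 'rV[C R]_(n + n)) : C R :=
  \sum_(a : 'I_(n + n)) \sum_(b : 'I_(n + n) | (a < b)%N)
    u [set a; b]%SET * (xi 0 a * eta 0 b - xi 0 b * eta 0 a).

(* The value of the 2-form u at (tau, conj tau), for tau of type (1, 0)        *)
Definition eval_conj u (tau : 'rV[C R]_n) : C R :=
  eval2 u (row_mx tau 0) (row_mx 0 (map_mx Num.conj tau)).

(* The density of a form of top degree with respect to Lebesgue measure:       *)
(* dx /\ dy = (i/2) dz /\ dzbar for each coordinate z = x + iy.                *)
Definition density (u : extform R n) : C R :=
  u [set: 'I_(n + n)]%SET /
  wedge_seq (fun j : 'I_n => ('i / 2) *: wedge (dz j) (dzbar j))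
    [set: 'I_(n + n)]%SET.

(* Differential forms on C^n are functions valued in [extform R n].            *)
Definition del (u : 'rV[C R]_n -> extform R n) (z : 'rV[C R]_n) : extform R n :=
  \sum_j wedge (dz j)
    [ffun S : {set 'I_(n + n)} => dz_deriv j (fun w => u w S) z].
Definition delbar (u : 'rV[C R]_n -> extform R n) (z : 'rV[C R]_n) :
    extform R n :=
  \sum_j wedge (dzbar j)
    [ffun S : {set 'I_(n + n)} => dzbar_deriv j (fun w => u w S) z].

End ExteriorAlgebra.

(* Matrices over the commutative algebra of even forms.  Lambda^k A is the     *)
(* matrix of k x k minors, in the basis e_I of Lambda^k indexed by the         *)
(* increasing maps I from {1..k} to {1..r}.                                    *)
Section ExteriorPower.
Variables (R : realType) (n r k : nat).

Definition increasing_maps : {set {ffun 'I_k -> 'I_r}} :=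
  [set I : {ffun 'I_k -> 'I_r} |
    [forall s, [forall t, ((s : 'I_k) < (t : 'I_k))%N ==> (I s < I t)%N]]]%SET.

Definition ext_power (A : 'M[extform R n]_r) :
    'M[extform R n]_(#|increasing_maps|) :=
  \matrix_(p, q) \sum_(sigma : 'S_k)
    (-1) ^+ sigma *:
    wedge_seq (fun s => A ((enum_val p : {ffun 'I_k -> 'I_r}) s)
                          ((enum_val q : {ffun 'I_k -> 'I_r}) (sigma s))).

End ExteriorPower.

Local Open Scope classical_set_scope.

Record chart (R : realType) (n : nat) (X : topologicalType) := Chart {
  chart_dom : set X;
  chart_map : X -> 'rV[C R]_n;
  chart_inv : 'rV[C R]_n -> X;
  chart_dom_open : open chart_dom;
  chart_cod_open : open (chart_map @` chart_dom);
  chart_mapK : forall x, chart_dom x -> chart_inv (chart_map x) = x;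
  chart_map_continuous : {within chart_dom, continuous chart_map};
  chart_inv_continuous :
    {within chart_map @` chart_dom, continuous chart_inv} }.

Record complex_manifold (R : realType) (n : nat) := ComplexManifold {
  cm_space :> topologicalType;
  cm_hausdorff : hausdorff_space cm_space;
  cm_second_countable : @second_countable cm_space;
  cm_index : Type;
  cm_chart : cm_index -> chart R n cm_space;
  cm_cover : forall x, exists i, chart_dom (cm_chart i) x;
  cm_transition : forall i j m,
    holomorphic_on
      (chart_map (cm_chart i) @`
        (chart_dom (cm_chart i) `&` chart_dom (cm_chart j)))
      (fun z => chart_map (cm_chart j) (chart_inv (cm_chart i) z) 0 m) }.

Section FunctionsOnManifold.
Variables (R : realType) (n : nat) (X : complex_manifold R n).

Definition manifold_smooth_on (W : set X) (f : X -> C R) : Prop :=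
  forall i : cm_index X,
    smooth_on (chart_map (cm_chart i) @` (chart_dom (cm_chart i) `&` W))
      (fun z => f (chart_inv (cm_chart i) z)).

Definition manifold_holomorphic_on (W : set X) (f : X -> C R) : Prop :=
  forall i : cm_index X,
    holomorphic_on (chart_map (cm_chart i) @` (chart_dom (cm_chart i) `&` W))
      (fun z => f (chart_inv (cm_chart i) z)).

End FunctionsOnManifold.

(* The holomorphic structure is given by local frames that cover X and have    *)
(* holomorphic transition matrices.                                            *)
Record hol_bundle (R : realType) (n : nat) (X : complex_manifold R n)
    (r : nat) := HolBundle {
  fibre :> X -> vectType (C R);
  frame_index : Type;
  frame_dom : frame_index -> set X;
  frame : forall (a : frame_index) (x : X), r.-tuple (fibre x);
  frame_dom_open : forall a, open (frame_dom a);
  frame_cover : forall x, exists a, frame_dom a x;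
  frame_basis : forall a x, frame_dom a x -> basis_of fullv (frame a x);
  frame_transition : forall a b (j k : 'I_r),
    manifold_holomorphic_on (frame_dom a `&` frame_dom b)
      (fun x => coord (frame a x) k (tnth (frame b x) j)) }.

(* h x u v is C-linear in u and conjugate-linear in v.                         *)
Record hermitian_metric (R : realType) (n : nat) (X : complex_manifold R n)
    (r : nat) (E : hol_bundle X r) := HermitianMetric {
  metric :> forall x : X, {dot (E x) for (@Num.conj (C R))};
  metric_smooth : forall (a : frame_index E) (j k : 'I_r),
    manifold_smooth_on (frame_dom a)
      (fun x => metric x (tnth (frame a x) j) (tnth (frame a x) k)) }.

Section ChernForms.
Variables (R : realType) (n : nat) (X : complex_manifold R n).
Variables (r : nat) (E : hol_bundle X r) (h : hermitian_metric E).

(* A differential form on X is given by its expressions at x in the            *)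
(* coordinates of each chart i around x.  The forms below are moreover         *)
(* computed from a local frame a of E around x; pointwise properties of these  *)
(* expressions are required for all i and a.                                   *)
Definition local_forms := cm_index X -> frame_index E -> X -> extform R n.

Definition local_dom (i : cm_index X) (a : frame_index E) : set X :=
  chart_dom (cm_chart i) `&` frame_dom a.

Definition gram (i : cm_index X) (a : frame_index E) (z : 'rV[C R]_n) :
    'M[C R]_r :=
  let x := chart_inv (cm_chart i) z in
  \matrix_(j, k) h x (tnth (frame a x) j) (tnth (frame a x) k).

(* The Chern connection D e_j = sum_l theta_jl e_l.  Type (1,0) and            *)
(* compatibility with h mean del h_jk = sum_l theta_jl h_lk, that is,          *)
(* theta = (del H) H^-1.                                                       *)
Definition connection (i : cm_index X) (a : frame_index E) (j l : 'I_r)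
    (z : 'rV[C R]_n) : extform R n :=
  \sum_m invmx (gram i a z) m l *:
    del (fun w => scalar_form n (gram i a w j m)) z.

(* Theta e_j = sum_l Theta_jl e_l.  As (del H) H^-1 satisfies                  *)
(* del theta = theta /\ theta, D^2 has matrix Theta = delbar theta.            *)
Definition curvature (i : cm_index X) (a : frame_index E) (x : X) :
    'M[extform R n]_r :=
  \matrix_(j, l) delbar (connection i a j l) (chart_map (cm_chart i) x).

Definition chern_form (k : nat) : local_forms := fun i a x =>
  \tr (ext_power k
         (map_mx (fun u : extform R n => ('i / Cof (2 * pi)) *: u)
                 (curvature i a x))).

Definition curvature_pairing (i : cm_index X) (a : frame_index E) (x : X)
    (v : E x) : extform R n :=
  \sum_j \sum_l
    (coord (frame a x) j v * h x (tnth (frame a x) l) v) *: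
    (curvature i a x j l : extform R n).

Definition griffiths_semipositive : Prop :=
  forall i a x, local_dom i a x -> forall (v : E x) (tau : 'rV[C R]_n),
    0 <= eval_conj (curvature_pairing i a v) tau.

Definition wedge_forms (u v : local_forms) : local_forms := fun i a x =>
  wedge (u i a x) (v i a x).

Definition form_ge (p : nat) (u v : local_forms) : Prop :=
  forall i a x, local_dom i a x -> positive_form p (u i a x - v i a x).

End ChernForms.

(* The integral over C^n = R^(2n), as an iterated Lebesgue integral            *)
Fixpoint real_integral (R : realType) (n : nat) : ('rV[C R]_n -> R) -> R :=
  match n return ('rV[C R]_n -> R) -> R with
  | 0 => fun f => f 0
  | m.+1 => fun f =>
      \int[lebesgue_measure]_(x in [set: R])
      \int[lebesgue_measure]_(y in [set: R])
        real_integral (fun w : 'rV[C R]_m =>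
          f (row_mx (const_mx (Complex x y : C R)) w : 'rV[C R]_(1 + m)))
  end.

Definition complex_integral (R : realType) (n : nat) (f : 'rV[C R]_n -> C R) :
    C R :=
  Complex (real_integral (fun z => complex.Re (f z)))
          (real_integral (fun z => complex.Im (f z))).

Section Integration.
Variables (R : realType) (n : nat) (X : complex_manifold R n).
Variables (r : nat) (E : hol_bundle X r).

(* A finite partition of unity on X whose s-th function is supported in the    *)
(* domain of the chart pu_chart s and of the frame pu_frame s                  *)
Record partition_of_unity := PartitionOfUnity {
  pu_size : nat;
  pu_fun : 'I_pu_size -> X -> R;
  pu_chart : 'I_pu_size -> cm_index X;
  pu_frame : 'I_pu_size -> frame_index E;
  pu_continuous : forall s, continuous (pu_fun s);
  pu_ge0 : forall s x, 0 <= pu_fun s x;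
  pu_sum : forall x, \sum_s pu_fun s x = 1;
  pu_support : forall s,
    closure [set x | pu_fun s x != 0] `<=`
    local_dom (pu_chart s) (pu_frame s) }.

(* f \_ D is f on D and point = 0 elsewhere.  For products of Chern forms, the  *)
(* integral is the Chern number of E: c_k(E, h) represents c_k(E).             *)
Definition integral_form (P : partition_of_unity) (u : local_forms E) : C R :=
  \sum_(s < pu_size P)
    let i := pu_chart s in
    let a := pu_frame s in
    complex_integral
      ((fun z => let x := chart_inv (cm_chart i) z in
                 Cof (pu_fun s x) * density (u i a x))
       \_ (chart_map (cm_chart i) @` local_dom i a)).

End Integration.

(* Main.v *)
Require Import Defs.
From HB Require Import structures.
From mathcomp Require Import all_boot all_order all_fingroup all_algebra.
From mathcomp Require Import all_classical all_reals all_analysis.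
From mathcomp Require Import complex ring lra zify.

(* Let Theta be the curvature at a point in an orthonormal frame, multiplied   *)
(* by i/(2 pi).  Griffiths semipositivity says that Theta(v, v) is a           *)
(* nonnegative (1, 1)-form for every v, and such forms are sums of products    *)
(* i a /\ conj a.  The form c_1^2 - c_2 is a positive multiple of the mean of  *)
(* Theta(v, v)^2 over the unit vectors v, and c_1 c_2 - c_3 is a positive      *)
(* multiple of the mean of c_1(Theta_W) c_2(Theta_W) over the planes W, where  *)
(* Theta_W is the compression of Theta to W.  Both functions have degree       *)
(* (2, 2), in v and in the normal vector of W, so that the means are finite    *)
(* sums over a complex projective 2-design.  As                                *)
(* c_1^3 - c_1 c_2 = c_1 (c_1^2 - c_2), the first inequality follows.  The     *)
(* second one reduces to c_2 >= 0 for a curvature of rank 2 on a complex       *)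
(* surface: after diagonalization of Theta_11, this is the inequality of       *)
(* arithmetic and geometric means combined with                                *)
(* |Theta_12|^2 <= Theta_11 Theta_22.                                          *)
(* For the Chern numbers, the densities of the differences are nonnegative,    *)
(* and the local integrands are bounded with bounded support, because the      *)
(* curvature is continuous and the partition of unity has compact supports.    *)

Set Implicit Arguments.
Unset Strict Implicit.
Unset Printing Implicit Defensive.

Import Order.TTheory GRing.Theory Num.Theory.
Import numFieldNormedType.Exports.
Local Open Scope ring_scope.

(** * Exterior algebra *)

(** Even forms make up a commutative algebra, [evenform]. In it [chern_formE] writes the Chern forms
    as sums of principal minors of a 3 x 3 matrix of (1, 1)-forms, and [chern_orthonormal] passes to
    an orthonormal frame, where this matrix is Hermitian. The forms c_1^2 - c_2 and c_1 c_2 - c_3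
    are the Schur polynomials s_(2) and s_(2,1) of the curvature; [chern_segre] and [chern_schur21]
    expand them (the first one times c_1) over the lines of a projective 2-design.

    To test weak positivity is to multiply by factors [cross b b] until the top degree is reached. A
    nonnegative (1, 1)-form is a sum of such factors ([form11_psd]), and n of them multiply to a
    nonnegative multiple of the volume ([prod_cross_volume]); this settles the first inequality. The
    terms of the second one are a nonnegative (1, 1)-form times Theta(e, e) Theta(f, f) - Theta(e,
    f) Theta(f, e). The factors of the (1, 1)-form join the test covectors, which then cut out a
    complex surface when they are independent ([form11_pair_det]). There the coefficient is a
    difference of mixed discriminants, nonnegative by [polar_det_ge0].

    For the Chern numbers, [positive_form_density] turns positivity into an inequality of densities.
    The integrands are bounded with bounded support ([local_integrand_boxed]), so that the iterated
    integrals are finite and monotone ([real_integral_monotone]). *)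

Section Inversions.
Variable n : nat.
Implicit Types A B S : {set 'I_(n + n)}.

Lemma inversionsE A B :
  inversions A B = (\sum_(a in A) \sum_(b in B) (b < a))%N.
Proof.
rewrite /inversions -sum1_card pair_big_dep /= big_mkcond [RHS]big_mkcond /=.
apply: eq_bigr => -[a b] _ /=; rewrite inE /=.
by case: (a \in A); case: (b \in B) => //=; case: ltnP.
Qed.

Lemma big_disjointU (F : 'I_(n + n) -> nat) A B : [disjoint A & B] ->
  (\sum_(i in A :|: B) F i = \sum_(i in A) F i + \sum_(i in B) F i)%N.
Proof.
by move=> dAB; rewrite -bigU //; apply: eq_bigl => i; rewrite !inE.
Qed.

Lemma inversionsUl A B S : [disjoint A & B] ->
  inversions (A :|: B) S = (inversions A S + inversions B S)%N.
Proof. by move=> dAB; rewrite !inversionsE big_disjointU. Qed.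

Lemma inversionsUr A B S : [disjoint A & B] ->
  inversions S (A :|: B) = (inversions S A + inversions S B)%N.
Proof.
move=> dAB; rewrite !inversionsE -big_split /=; apply: eq_bigr => a _.
by rewrite big_disjointU.
Qed.

Lemma inversions_eq0 A B : (forall a b, a \in A -> b \in B -> (a <= b)%N) ->
  inversions A B = 0%N.
Proof.
move=> leAB; rewrite inversionsE big1 // => a aA; rewrite big1 // => b bB.
by rewrite ltnNge leAB.
Qed.

Lemma hol_degreeE A : hol_degree A = (\sum_(j < n) (lshift n j \in A))%N.
Proof.
by rewrite /hol_degree -sum1_card big_mkcond; apply: eq_bigr => j _;
  rewrite inE; case: ifP.
Qed.

Lemma antihol_degreeE A : antihol_degree A = (\sum_(j < n) (rshift n j \in
  A))%N.
Proof.
by rewrite /antihol_degree -sum1_card big_mkcond; apply: eq_bigr => j _;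
  rewrite inE; case: ifP.
Qed.

Lemma hol_degreeU A B : [disjoint A & B] ->
  hol_degree (A :|: B) = (hol_degree A + hol_degree B)%N.
Proof.
move=> dAB; rewrite !hol_degreeE -big_split; apply: eq_bigr => j _ /=.
by rewrite inE; case: (boolP (_ \in A)) => [/(disjointFr dAB) ->|].
Qed.

Lemma antihol_degreeU A B : [disjoint A & B] ->
  antihol_degree (A :|: B) = (antihol_degree A + antihol_degree B)%N.
Proof.
move=> dAB; rewrite !antihol_degreeE -big_split; apply: eq_bigr => j _ /=.
by rewrite inE; case: (boolP (_ \in A)) => [/(disjointFr dAB) ->|].
Qed.

Lemma card_degree A : #|A| = (hol_degree A + antihol_degree A)%N.
Proof.
by rewrite hol_degreeE antihol_degreeE -sum1_card big_mkcond big_split_ord.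
Qed.

Lemma disjointDr A S : [disjoint A & S :\: A].
Proof. by rewrite -finset.setI_eq0; apply/eqP/finset.setP => x; rewrite !inE;
  case: (x \in A). Qed.

End Inversions.

Section Exterior.
Variables (R : realType) (n : nat).

(* A copy of [extform], which already carries the pointwise product of functions. *)
Definition exterior : Type := extform R n.
HB.instance Definition _ := GRing.Lmodule.copy exterior (extform R n).

Implicit Types u v w : extform R n.

(** Both sides sum over the ordered partitions of S into B, C and D. The signs agree because
    [inversions] is additive in each argument on disjoint unions. *)
Lemma wedgeA : associative (@wedge R n).
Proof.
move=> u v w; apply/ffunP => S; rewrite !ffunE.
under eq_bigr => A _ do rewrite ffunE mulr_sumr.
under [RHS]eq_bigr => A _ do rewrite ffunE mulr_sumr mulr_suml.
rewrite [RHS](exchange_big_dep (fun B : {set _} => B \subset S)) /=; last first.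
  by move=> A B AS BA; apply: fintype.subset_trans BA AS.
apply: eq_bigr => B BS.
rewrite [RHS](reindex_onto (fun C => B :|: C) (fun A => A :\: B)) /=;
  last first.
  move=> A /andP[AS BA].
  by apply/finset.setP => x; rewrite !inE; case: (boolP (x \in B)) =>
    // /(fintype.subsetP BA) ->.
apply: eq_big => [C|C CSB].
  rewrite finset.subUset BS finset.subsetUl finset.subsetD /= andbT.
  case: (C \subset S) => //=; rewrite -finset.setI_eq0.
  apply/eqP/eqP => [CB0|e].
    by apply/finset.setP=> x; move/finset.setP/(_ x): CB0; rewrite !inE;
      case: (x \in B); case: (x \in C).
  by apply/finset.setP=> x; rewrite -e !inE; case: (x \in B); rewrite ?andbF.
have dBC : [disjoint B & C].
  by move: CSB; rewrite finset.subsetD disjoint_sym => /andP[].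
have CS : C \subset S by move: CSB; rewrite finset.subsetD => /andP[].
set D := S :\: B :\: C.
have -> : S :\: (B :|: C) = D by rewrite /D finset.setDDl.
have -> : (B :|: C) :\: B = C.
  apply/finset.setP=> x; rewrite !inE; case: (boolP (x \in B)) =>
    //= /(disjointFr dBC) //.
have -> : S :\: B = C :|: D.
  apply/finset.setP=> x; rewrite !inE; case: (boolP (x \in C)) => //= xC.
  by rewrite (fintype.subsetP CS) // (disjointFl dBC).
have dCD : [disjoint C & D] by exact: disjointDr.
rewrite inversionsUr // inversionsUl // !exprD.
ring.
Qed.


Lemma inversions0l (A : {set 'I_(n + n)}) : inversions finset.set0 A = 0%N.
Proof. by rewrite inversions_eq0 // => a b; rewrite inE. Qed.

Lemma inversions0r (A : {set 'I_(n + n)}) : inversions A finset.set0 = 0%N.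
Proof. by rewrite inversions_eq0 // => a b _; rewrite inE. Qed.

Lemma wedge1l : left_id (scalar_form n 1) (@wedge R n).
Proof.
move=> u; apply/ffunP => S; rewrite ffunE (bigD1 finset.set0) ?finset.sub0set
  //=.
rewrite big1 => [|A /andP[_ /negPf A0]]; last by rewrite ffunE A0 mulr0 mul0r.
by rewrite ffunE eqxx finset.setD0 inversions0l !mul1r addr0.
Qed.

Lemma wedge1r : right_id (scalar_form n 1) (@wedge R n).
Proof.
move=> u; apply/ffunP => S; rewrite ffunE (bigD1 S) ?subxx //=.
rewrite big1 => [|A /andP[AS AnS]].
  by rewrite ffunE finset.setDv eqxx inversions0r mul1r mulr1 addr0.
rewrite ffunE ifN ?mulr0 // finset.setD_eq0.
by apply: contra AnS => SA; rewrite finset.eqEsubset AS.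
Qed.

Lemma wedgeDl : left_distributive (@wedge R n) +%R.
Proof.
move=> u v w; apply/ffunP => S; rewrite !ffunE -big_split /=.
by apply: eq_bigr => A _; rewrite ffunE mulrDr mulrDl.
Qed.

Lemma wedgeDr : right_distributive (@wedge R n) +%R.
Proof.
move=> u v w; apply/ffunP => S; rewrite !ffunE -big_split /=.
by apply: eq_bigr => A _; rewrite ffunE mulrDr.
Qed.

Lemma scalar_form1_neq0 : scalar_form n (1 : C R) != 0.
Proof.
by apply/eqP => /ffunP/(_ finset.set0)/eqP; rewrite !ffunE eqxx oner_eq0.
Qed.

HB.instance Definition _ := GRing.Zmodule_isNzRing.Build exterior
  wedgeA wedge1l wedge1r wedgeDl wedgeDr scalar_form1_neq0.

Fact wedgeZl (a : C R) (u v : exterior) : a *: (u * v) = (a *: u) * v.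
Proof.
apply/ffunP => S; rewrite !ffunE scaler_sumr; apply: eq_bigr => A _.
by rewrite ffunE /GRing.scale /=; ring.
Qed.
HB.instance Definition _ := GRing.Lmodule_isLalgebra.Build (C R) exterior
  wedgeZl.

Fact wedgeZr (a : C R) (u v : exterior) : a *: (u * v) = u * (a *: v).
Proof.
apply/ffunP => S; rewrite !ffunE scaler_sumr; apply: eq_bigr => A _.
by rewrite ffunE /GRing.scale /=; ring.
Qed.
HB.instance Definition _ := GRing.Lalgebra_isAlgebra.Build (C R) exterior
  wedgeZr.

End Exterior.

Section Grading.
Variables (R : realType) (n : nat).
Implicit Types (u v : exterior R n) (S A B : {set 'I_(n + n)}).

Definition has_parity (p : bool) u := forall S, u S != 0 -> odd #|S| = p.

Lemma wedge_eq0 u v S :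
  (forall A, A \subset S -> u A != 0 -> v (S :\: A) != 0 -> False) ->
  (u * v) S = 0.
Proof.
move=> h; rewrite ffunE big1 // => A AS.
have [->|uA] := eqVneq (u A) 0; first by rewrite mulr0 mul0r.
have [->|vA] := eqVneq (v (S :\: A)) 0; first by rewrite mulr0.
by case: (h A).
Qed.

Lemma wedge_neq0 u v S : (u * v) S != 0 ->
  exists A, [/\ A \subset S, u A != 0 & v (S :\: A) != 0].
Proof.
move=> h; have [//|nA] := pselect (exists A, [/\ A \subset S,
  u A != 0 & v (S :\: A) != 0]).
case/eqP: h; apply: wedge_eq0 => A AS uA vA; apply: nA; by exists A.
Qed.

Lemma setU_setD A S : A \subset S -> A :|: (S :\: A) = S.
Proof.
move=> AS; apply/finset.setP => x; rewrite !inE; case: (boolP (x \in A)) => //=.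
by move/(fintype.subsetP AS) => ->.
Qed.

Lemma has_parityM p q u v :
  has_parity p u -> has_parity q v -> has_parity (p (+) q) (u * v).
Proof.
move=> hu hv S /wedge_neq0[A [AS /hu <- /hv <-]].
rewrite -oddD !card_degree -{1 2}(setU_setD AS).
by rewrite hol_degreeU ?antihol_degreeU ?disjointDr // addnACA.
Qed.

Lemma has_bidegreeM p q p' q' u v :
  has_bidegree p q u -> has_bidegree p' q' v ->
  has_bidegree (p + p') (q + q') (u * v).
Proof.
move=> hu hv S /wedge_neq0[A [AS /hu[<- <-] /hv[<- <-]]].
by rewrite -{1 3}(setU_setD AS) hol_degreeU ?antihol_degreeU ?disjointDr.
Qed.

Lemma has_bidegree0 p q : has_bidegree p q (0 : exterior R n).
Proof. by move=> S; rewrite ffunE eqxx. Qed.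

Lemma has_bidegreeD p q u v :
  has_bidegree p q u -> has_bidegree p q v -> has_bidegree p q (u + v).
Proof.
move=> hu hv S; rewrite ffunE; have [u0|/hu//] := eqVneq (u S) 0.
by rewrite u0 add0r => /hv.
Qed.

Lemma has_bidegreeZ p q (a : C R) u : has_bidegree p q u ->
  has_bidegree p q (a *: u).
Proof. by move=> hu S; rewrite ffunE /GRing.scale /= mulf_eq0 negb_or =>
  /andP[_ /hu]. Qed.

Lemma has_bidegreeN p q u : has_bidegree p q u -> has_bidegree p q (- u).
Proof. by move=> hu; rewrite -scaleN1r; apply: has_bidegreeZ. Qed.

Lemma has_bidegree_sum p q (I : Type) (r : seq I) (P : pred I) (F : I ->
  exterior R n) :
  (forall i, P i -> has_bidegree p q (F i)) ->
  has_bidegree p q (\sum_(i <- r | P i) F i).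
Proof.
by move=> hF; elim/big_ind : _ => //; [exact: has_bidegree0|exact:
  has_bidegreeD].
Qed.

Lemma has_bidegree1 : has_bidegree 0 0 (1 : exterior R n).
Proof.
move=> S; rewrite ffunE; case: ifP => [/eqP -> _|_ /eqP //].
by rewrite hol_degreeE antihol_degreeE !big1 // => j _; rewrite inE.
Qed.

Lemma has_bidegree_parity p q u : has_bidegree p q u ->
  has_parity (odd (p + q)) u.
Proof. by move=> hu S /hu[<- <-]; rewrite card_degree. Qed.

(** A pair of distinct indices is inverted in exactly one of its two orders. *)
Lemma inversionsC A B : [disjoint A & B] ->
  (inversions A B + inversions B A = #|A| * #|B|)%N.
Proof.
move=> dAB; rewrite !inversionsE [X in (_ + X)%N]exchange_big /= -big_split /=.
rewrite -sum1_card big_distrl /=; apply: eq_bigr => a aA.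
rewrite -big_split /= mul1n -sum1_card; apply: eq_bigr => b bB.
have : a != b :> nat.
  by apply: contraTneq bB => /val_inj <-; rewrite (disjointFr dAB).
by case: ltngtP.
Qed.

(** Replacing the summation index A by its complement in S exchanges the factors; by [inversionsC],
    the sign changes by the parity of the product of the degrees. *)
Lemma wedgeC p q u v : has_parity p u -> has_parity q v ->
  u * v = (-1) ^+ (p && q) *: (v * u).
Proof.
move=> hu hv; apply/ffunP => S; rewrite !ffunE scaler_sumr.
rewrite (reindex_onto (fun A => S :\: A) (fun A => S :\: A)) /=; last first.
  by move=> A AS; rewrite finset.setDDr finset.setDv finset.set0U;
    apply/finset.setIidPr.
apply: eq_big => [A|A AS].
  rewrite finset.subsetDl /=; apply/eqP/idP => [<-|AS];
    first exact: finset.subsetDl.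
  by rewrite finset.setDDr finset.setDv finset.set0U; apply/finset.setIidPr.
have {}AS : A \subset S by case/andP: AS => _ /eqP <-; exact: finset.subsetDl.
rewrite finset.setDDr finset.setDv finset.set0U (finset.setIidPr AS).
have [->|uA] := eqVneq (u (S :\: A)) 0; first by rewrite !(mulr0, mul0r,
  scaler0).
have [->|vA] := eqVneq (v A) 0; first by rewrite !(mulr0, mul0r, scaler0).
rewrite /GRing.scale /= -(hu _ uA) -(hv _ vA) -oddM signr_odd.
rewrite -(inversionsC (A := S :\: A)) 1?disjoint_sym ?disjointDr //.
have e k : (-1) ^+ k * (-1) ^+ k = 1 :> C R by rewrite -expr2 sqrr_sign.
rewrite exprD; set s := (-1) ^+ inversions A _.
transitivity ((s * s) * (-1) ^+ inversions (S :\: A) A * u (S :\: A) * v A);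
  last by ring.
by rewrite e mul1r.
Qed.

End Grading.

Section Conjugation.
Variables (R : realType) (n : nat).
Implicit Types (u v : exterior R n) (S A B : {set 'I_(n + n)}).

Definition swap_set S : {set 'I_(n + n)} := [set swap_index i | i in S]%SET.

Lemma swap_index_l (j : 'I_n) : swap_index (lshift n j) = rshift n j.
Proof. by rewrite /swap_index (unsplitK (inl j)). Qed.

Lemma swap_index_r (j : 'I_n) : swap_index (rshift n j) = lshift n j.
Proof. by rewrite /swap_index (unsplitK (inr j)). Qed.

Lemma swap_indexK : involutive (@swap_index n).
Proof.
by move=> i; rewrite -(splitK i); case: (fintype.split i) => j /=;
  rewrite !(swap_index_l, swap_index_r).
Qed.

Lemma mem_swap_set i S : (i \in swap_set S) = (swap_index i \in S).
Proof.
by rewrite -{1}(swap_indexK i) mem_imset //; exact: inv_inj swap_indexK.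
Qed.

Lemma swap_setK : involutive swap_set.
Proof. by move=> S; apply/finset.setP => i; rewrite !mem_swap_set swap_indexK.
  Qed.

Lemma swap_setD A B : swap_set (A :\: B) = swap_set A :\: swap_set B.
Proof. by apply/finset.setP => i; rewrite !(inE, mem_swap_set). Qed.

Lemma swap_setS A B : (swap_set A \subset swap_set B) = (A \subset B).
Proof.
apply/fintype.subsetP/fintype.subsetP => h i.
  by have := h (swap_index i); rewrite !mem_swap_set swap_indexK.
by rewrite !mem_swap_set; apply: h.
Qed.

Lemma hol_degree_swap S : hol_degree (swap_set S) = antihol_degree S.
Proof.
rewrite hol_degreeE antihol_degreeE; apply: eq_bigr => j _.
by rewrite mem_swap_set swap_index_l.
Qed.

Lemma antihol_degree_swap S : antihol_degree (swap_set S) = hol_degree S.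
Proof. by rewrite -hol_degree_swap swap_setK. Qed.

Let invh A B := (\sum_(j < n) \sum_(k < n)
  (lshift n j \in A) * ((lshift n k \in B) * (k < j)))%N.
Let inva A B := (\sum_(j < n) \sum_(k < n)
  (rshift n j \in A) * ((rshift n k \in B) * (k < j)))%N.

(** All indices of dz precede those of dzbar: a pair from dzbar to dz is always an inversion, a pair
    from dz to dzbar never is. *)
Let inversions_split A B :
  inversions A B = (invh A B + inva A B + antihol_degree A * hol_degree B)%N.
Proof.
have E : inversions A B = (\sum_a \sum_b (a \in A) * ((b \in B) * (b < a)))%N.
  rewrite inversionsE big_mkcond; apply: eq_bigr => a _.
  case: (a \in A); last by rewrite big1.
  rewrite big_mkcond; apply: eq_bigr => b _.
  by case: (b \in B); rewrite ?mul1n ?mul0n.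
rewrite E big_split_ord /=; under eq_bigr => j _ do rewrite big_split_ord /=.
rewrite big_split /= [X in (_ + X + _)%N]big1 ?addn0; last first.
  move=> j _; rewrite big1 // => k _.
  by rewrite ltnNge ltnW ?muln0 // (leq_trans (ltn_ord j)) // leq_addr.
rewrite -addnA; congr addn.
under eq_bigr => j _ do rewrite big_split_ord /=.
rewrite big_split /= addnC; congr addn.
  by apply: eq_bigr => j _; apply: eq_bigr => k _; rewrite ltn_add2l.
rewrite antihol_degreeE hol_degreeE big_distrl /=; apply: eq_bigr => j _.
rewrite big_distrr /=; apply: eq_bigr => k _.
by rewrite (leq_trans (ltn_ord k)) ?leq_addr ?muln1.
Qed.

(** [conj_form] typed on the ring [exterior], so that it can be declared a ring morphism. *)
Definition conjW (u : exterior R n) : exterior R n := conj_form u.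

Lemma conj_formM u v : conjW (u * v) = conjW u * conjW v.
Proof.
apply/ffunP => S; rewrite !ffunE rmorph_sum /= mulr_sumr.
rewrite -/(swap_set S) (reindex_inj (inv_inj swap_setK)) /=.
apply: eq_big => [A|A]; first exact: swap_setS.
rewrite swap_setS => AS; rewrite !ffunE -!/(swap_set _) -swap_setD !rmorphM /=
  rmorphXn rmorphN rmorph1.
set B := S :\: A; have dAB : [disjoint A & B] by exact: disjointDr.
rewrite -{1 2}(setU_setD AS) -/B hol_degreeU // antihol_degreeU //.
set x := Num.conj _; set y := Num.conj _.
have -> : (-1) ^+ ((hol_degree A + hol_degree B) * (antihol_degree A +
  antihol_degree B)) *
   ((-1) ^+ inversions (swap_set A) (swap_set B) * x * y) =
   (-1) ^+ ((hol_degree A + hol_degree B) * (antihol_degree A + antihol_degree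
     B) + inversions (swap_set A) (swap_set B)) * (x * y) by rewrite exprD;
     ring.
have -> : (-1) ^+ inversions A B * ((-1) ^+ (hol_degree A * antihol_degree A) *
  x) *
  ((-1) ^+ (hol_degree B * antihol_degree B) * y) = 
  (-1) ^+ (inversions A B + hol_degree A * antihol_degree A + hol_degree B *
    antihol_degree B) * (x * y) by rewrite !exprD; ring.
(* [swap_set] exchanges the inversions within dz and those within dzbar, so that only products of
   degrees remain to be compared modulo 2. *)
congr (_ * _); rewrite !inversions_split antihol_degree_swap hol_degree_swap.
have -> : invh (swap_set A) (swap_set B) = inva A B.
  by apply: eq_bigr => j _; apply: eq_bigr => k _;
    rewrite !mem_swap_set !swap_index_l.
have -> : inva (swap_set A) (swap_set B) = invh A B.
  by apply: eq_bigr => j _; apply: eq_bigr => k _;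
    rewrite !mem_swap_set !swap_index_r.
rewrite -signr_odd -[RHS]signr_odd; congr (_ ^+ nat_of_bool _).
rewrite !(oddD, oddM).
do !case: (odd _) => //.
Qed.

Lemma conj_formD u v : conjW (u + v) = conjW u + conjW v.
Proof. by apply/ffunP => S; rewrite !ffunE rmorphD mulrDr. Qed.

Lemma conj_formZ (a : C R) u : conjW (a *: u) = Num.conj a *: conjW u.
Proof. by apply/ffunP => S; rewrite !ffunE /GRing.scale /= rmorphM /=;
  ring. Qed.

Lemma conj_form1 : conjW 1 = 1.
Proof.
apply/ffunP => S; rewrite !ffunE -/(swap_set S).
have -> : (swap_set S == finset.set0) = (S == finset.set0).
  apply/eqP/eqP => [h|->]; last by rewrite /swap_set imset0.
  by rewrite -(swap_setK S) h /swap_set imset0.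
case: eqP => [->|_]; last by rewrite rmorph0 mulr0.
by rewrite rmorph1 hol_degreeE big1 ?expr0 ?mul1r // => j _; rewrite inE.
Qed.

Fact conjW_zmod : zmod_morphism conjW.
Proof.
move=> u v; rewrite conj_formD; congr (_ + _).
by rewrite -scaleN1r conj_formZ rmorphN rmorph1 scaleN1r.
Qed.
HB.instance Definition _ := GRing.isZmodMorphism.Build (exterior R n) (exterior
  R n) conjW conjW_zmod.
Fact conjW_monoid : monoid_morphism conjW.
Proof. by split; [exact: conj_form1|exact: conj_formM]. Qed.
HB.instance Definition _ := GRing.isMonoidMorphism.Build (exterior R n)
  (exterior R n) conjW conjW_monoid.

Lemma conj_dz (j : 'I_n) : conj_form (dz R j) = dzbar R j.
Proof.
apply/ffunP => S; rewrite !ffunE -/(swap_set S).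
have -> : (swap_set S == [set lshift n j]%SET) = (S == [set rshift n j]%SET).
  rewrite (can2_eq swap_setK swap_setK) /swap_set imset_set1 swap_index_l.
  by [].
case: eqP => [->|_]; last by rewrite rmorph0 mulr0.
rewrite rmorph1 mulr1 hol_degreeE big1 // => k _.
by rewrite inE eq_lrshift.
Qed.

Lemma has_bidegree_dz (j : 'I_n) : has_bidegree 1 0 (dz R j).
Proof.
move=> S; rewrite ffunE; case: (S =P _) => [-> _|_ /eqP //].
rewrite hol_degreeE antihol_degreeE (bigD1 j) //= !big1 => [|k _|k];
  rewrite !inE ?eqxx //.
  by rewrite eq_rlshift.
by rewrite (inj_eq (@lshift_inj _ _)) => /negPf ->.
Qed.

Lemma has_bidegree_conj p q u : has_bidegree p q u ->
  has_bidegree q p (conj_form u).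
Proof.
move=> hu S; rewrite ffunE -/(swap_set S) mulf_eq0 conjC_eq0 negb_or =>
  /andP[_ /hu].
by rewrite hol_degree_swap antihol_degree_swap => -[-> ->].
Qed.

End Conjugation.

Section EvenForms.
Variables (R : realType) (n : nat).
Implicit Types (u v : exterior R n).

Definition even_form : {pred exterior R n} :=
  fun u => [forall S, (u S != 0) ==> ~~ odd #|S|].

Lemma even_formP u : reflect (has_parity false u) (u \in even_form).
Proof.
apply: (iffP forallP) => h S; last by apply/implyP => /h ->.
by move=> uS; apply/negbTE; exact: implyP (h S) uS.
Qed.

Fact even_form_subalg : subalg_closed even_form.
Proof.
split=> [|a u v /even_formP hu /even_formP hv|u v /even_formP hu /even_formP
  hv].
- exact/even_formP/(has_bidegree_parity (@has_bidegree1 _ _)).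
- apply/even_formP => S; rewrite !ffunE; have [u0|/hu//] := eqVneq (u S) 0.
  by rewrite u0 scaler0 add0r => /hv.
- exact/even_formP/(has_parityM hu hv).
Qed.

HB.instance Definition _ := GRing.isSubalgClosed.Build (C R) (exterior R n)
  even_form even_form_subalg.

(** Even forms commute, which makes determinants, traces and [ring] available for matrices of
    curvature forms. *)
Record evenform := Evenform { evenval :> exterior R n;
  _ : evenval \in even_form }.
HB.instance Definition _ := [isSub for evenval].
HB.instance Definition _ := [Choice of evenform by <:].
HB.instance Definition _ := [SubChoice_isSubAlgebra of evenform by <:].

Fact evenform_mulC : commutative (@GRing.mul evenform).
Proof.
move=> u v; apply: val_inj; rewrite !rmorphM /=.
by rewrite (wedgeC (even_formP _ (valP u)) (even_formP _ (valP v))) scale1r.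
Qed.
HB.instance Definition _ := GRing.PzRing_hasCommutativeMul.Build evenform
  evenform_mulC.




Fact evenval_zmod : zmod_morphism evenval.
Proof. by move=> u v; exact: (rmorphB (val : evenform -> exterior R n)). Qed.
HB.instance Definition _ := GRing.isZmodMorphism.Build evenform (exterior R n)
  evenval evenval_zmod.
Fact evenval_monoid : monoid_morphism evenval.
Proof. by split=> // u v; exact: (rmorphM (val : evenform ->
  exterior R n)). Qed.
HB.instance Definition _ := GRing.isMonoidMorphism.Build evenform (exterior R
  n) evenval evenval_monoid.
Fact evenval_scalable : scalable evenval.
Proof. by []. Qed.
HB.instance Definition _ := GRing.isScalable.Build (C R) evenform (exterior R
  n) *:%R evenval evenval_scalable.

Lemma conjW_even u : u \in even_form -> conjW u \in even_form.
Proof.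
move=> /even_formP hu; apply/even_formP => S; rewrite ffunE mulf_eq0 conjC_eq0
  negb_or.
move=> /andP[_ /hu]; rewrite card_imset //; exact: inv_inj (@swap_indexK n).
Qed.

Definition econj (u : evenform) : evenform := Evenform (conjW_even (valP u)).

Lemma econjE (u : evenform) : evenval (econj u) = conjW (evenval u).
Proof. by []. Qed.

Lemma evenval_inj : injective evenval. Proof. exact: val_inj. Qed.

Fact econj_zmod : zmod_morphism econj.
Proof. by move=> u v; apply: evenval_inj; rewrite !(econjE, rmorphB). Qed.
HB.instance Definition _ := GRing.isZmodMorphism.Build evenform evenform econj
  econj_zmod.
Fact econj_monoid : monoid_morphism econj.
Proof.
by split=> [|u v]; apply: evenval_inj; rewrite !(econjE, rmorphM, rmorph1).
Qed.
HB.instance Definition _ := GRing.isMonoidMorphism.Build evenform evenform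
  econj econj_monoid.

Lemma econjZ (a : C R) (u : evenform) : econj (a *: u) = Num.conj a *: econj u.
Proof. by apply: evenval_inj; exact: conj_formZ. Qed.
End EvenForms.

Section Volume.
Variables (R : realType) (n : nat).
Local Notation W := (exterior R n).
Local Notation K := (evenform R n).
Implicit Types (a b : 'rV[C R]_n) (S A B : {set 'I_(n + n)}).

Definition lin a : W := \sum_l a 0 l *: (dz R l : W).

Lemma lin_is_linear : linear lin.
Proof.
move=> c a b; rewrite /lin scaler_sumr -big_split; apply: eq_bigr => l _ /=.
by rewrite !mxE scalerDl scalerA.
Qed.
HB.instance Definition _ := GRing.isLinear.Build (C R) 'rV[C R]_n W *:%R lin
  lin_is_linear.

Lemma has_bidegree_lin a : has_bidegree 1 0 (lin a).
Proof. by apply: has_bidegree_sum => l _; apply: has_bidegreeZ;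
  exact: has_bidegree_dz. Qed.

Lemma has_bidegree_conj_lin a : has_bidegree 0 1 (conjW (lin a)).
Proof. exact/has_bidegree_conj/has_bidegree_lin. Qed.

Fact cross_even a b : 'i *: (lin a * conjW (lin b)) \in @even_form R n.
Proof.
apply/even_formP/(@has_bidegree_parity _ _ 1 1)/has_bidegreeZ.
exact: (has_bidegreeM (@has_bidegree_lin a) (@has_bidegree_conj_lin b)).
Qed.
(** The factor i makes [cross b a] the conjugate of [cross a b], and [cross a a] a nonnegative (1,
    1)-form. *)
Definition cross a b : K := Evenform (cross_even a b).

Lemma evenval_cross a b : evenval (cross a b) = 'i *: (lin a * conjW (lin b)).
Proof. by []. Qed.

Lemma has_bidegree_cross a b : has_bidegree 1 1 (evenval (cross a b)).
Proof.
apply/has_bidegreeZ.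
exact: (has_bidegreeM (@has_bidegree_lin a) (@has_bidegree_conj_lin b)).
Qed.

Lemma has_bidegree_prod_lin (s : seq 'rV[C R]_n) :
  has_bidegree (size s) 0 (\prod_(a <- s) lin a).
Proof.
elim: s => [|a s ih]; first by rewrite big_nil; exact: has_bidegree1.
by rewrite big_cons; exact: (has_bidegreeM (@has_bidegree_lin a) ih).
Qed.

(** Moving conj a across the k remaining (1, 0)-forms costs (-1)^k = i^(2k), and k^2 + 2k + 1 = (k +
    1)^2. This explains the power of i in the test forms of weak positivity. *)
Lemma prod_cross (s : seq 'rV[C R]_n) :
  evenval (\prod_(a <- s) cross a a) =
  'i ^+ (size s ^ 2) *: ((\prod_(a <- s) lin a) * conjW (\prod_(a <- s) lin a)).
Proof.
elim: s => [|a s ih].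
  by rewrite !big_nil !rmorph1 mulr1 exp0n // expr0 scale1r.
rewrite !big_cons [evenval _]rmorphM /= ih; set B := \prod_(_ <- _) lin _.
rewrite [conjW (_ * _)]rmorphM -scalerAl -scalerAr scalerA -!mulrA [X in _ *:
  (_ * X)]mulrA.
have pB : has_parity (odd (size s)) B.
  by rewrite -[size s]addn0; exact/has_bidegree_parity/has_bidegree_prod_lin.
rewrite (wedgeC (has_bidegree_parity (@has_bidegree_conj_lin a)) pB) andTb.
rewrite -scalerAl -scalerAr scalerA -!mulrA; congr (_ *: _).
rewrite signr_odd -sqrCi -exprM -exprD -exprS; congr (_ ^+ _).
by rewrite -[(size s).+1]addn1 sqrnD; lia.
Qed.

Definition basis_form S : W := [ffun T : {set 'I_(n + n)} => (T == S)%:R].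

Lemma basis_formM A B : [disjoint A & B] -> inversions A B = 0%N ->
  basis_form A * basis_form B = basis_form (A :|: B).
Proof.
move=> dAB iAB; apply/ffunP => S; rewrite !ffunE.
have [->|SAB] := eqVneq S (A :|: B); last first.
  rewrite big1 // => T TS; rewrite !ffunE.
  have [eTA|] := eqVneq T A; last by rewrite mulr0 mul0r.
  have [eB|] := eqVneq (S :\: T) B; last by rewrite mulr0.
  by move: SAB; rewrite -eB -eTA setU_setD // eqxx.
rewrite (bigD1 A) ?finset.subsetUl //= big1 => [|T /andP[_ TA]]; last first.
  by rewrite !ffunE (negPf TA) mulr0 mul0r.
have -> : (A :|: B) :\: A = B.
  apply/finset.setP => x; rewrite !inE; case: (boolP (x \in A)) => //=.
  by move/(disjointFr dAB) => ->.
by rewrite iAB !ffunE !eqxx !mulr1 addr0.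
Qed.

Let lset (s : seq 'I_n) : {set 'I_(n + n)} := [set i | i \in [seq lshift n j |
  j <- s]]%SET.

Lemma prod_dz (s : seq 'I_n) : sorted (fun i j : 'I_n => i < j)%N s ->
  \prod_(j <- s) (dz R j : W) = basis_form (lset s).
Proof.
elim: s => [|j s ih] ss.
  rewrite big_nil; apply/ffunP => S; rewrite !ffunE.
  have -> : lset [::] = finset.set0 by apply/finset.setP => x; rewrite !inE.
  by case: eqP.
have js : all (fun k : 'I_n => (j < k)%N) s.
  by apply: order_path_min ss => ? ? ?; exact: ltn_trans.
rewrite big_cons ih ?(path_sorted ss) //.
rewrite [dz R j](_ : _ = basis_form [set lshift n j]%SET) //.
rewrite basis_formM; first by congr basis_form; apply/finset.setP => x;
  rewrite !inE.
- rewrite disjoints1 inE; apply/mapP => -[k ks /lshift_inj jk].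
  by move/allP/(_ _ ks): js; rewrite jk ltnn.
- apply: inversions_eq0 => x y; rewrite !inE => /eqP -> /mapP[k ks ->] /=.
  by rewrite ltnW //; move/allP/(_ _ ks): js.
Qed.

Definition top_hol : {set 'I_(n + n)} := [set i : 'I_(n + n) | (i < n)%N]%SET.

Lemma prod_dz_enum : \prod_(j < n) (dz R j : W) = basis_form top_hol.
Proof.
have -> : \prod_(j < n) (dz R j : W) = \prod_(j <- enum 'I_n) (dz R j : W) by
  rewrite enumT.
rewrite prod_dz; last first.
  have := iota_ltn_sorted 0 n.
  by rewrite -val_enum_ord sorted_map.
congr basis_form; apply/finset.setP => x; rewrite !inE;
  apply/mapP/idP => [[j _ ->]|xn] /=.
  exact: ltn_ord.
by exists (Ordinal xn); rewrite ?mem_enum //; apply: val_inj.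
Qed.

Lemma top_hol_degree S : hol_degree S = n -> antihol_degree S = 0%N ->
  S = top_hol.
Proof.
rewrite hol_degreeE antihol_degreeE => hS aS.
apply/finset.setP => x; rewrite inE -(splitK x);
  case: (fintype.split x) => j /=.
  rewrite ltn_ord; apply/negPn/negP => jS.
  move: hS; rewrite (bigD1 j) //= (negPf jS) add0n => /eqP.
  rewrite -[X in _ == X](card_ord n) -[#|_|]sum1_card [in X in _ == X](bigD1 j)
    //=.
  rewrite eqn_leq => /andP[_]; rewrite leqNgt add1n ltnS => /negP; apply.
  by apply: leq_sum => i _; case: (_ \in _).
rewrite ltnNge leq_addr /=; apply/negP => jS.
by move: aS; rewrite (bigD1 j) //= jS.
Qed.

Lemma has_bidegree_top_hol (u : W) : has_bidegree n 0 u ->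
  u = u top_hol *: basis_form top_hol.
Proof.
move=> hu; apply/ffunP => S; rewrite !ffunE /GRing.scale /=.
have [->|nS] := eqVneq S top_hol; first by rewrite mulr1.
rewrite mulr0; apply: contra_neq_eq nS => /hu[]; exact: top_hol_degree.
Qed.

Definition unit_volume : K := \prod_(j < n) cross (delta_mx 0 j) (delta_mx 0 j).

Lemma lin_delta j : lin (delta_mx 0 j) = dz R j.
Proof.
rewrite /lin (bigD1 j) //= mxE !eqxx scale1r big1 ?addr0 // => k /negPf kj.
by rewrite mxE eqxx kj scale0r.
Qed.

Lemma unit_volumeE :
  evenval unit_volume = wedge_seq (fun j : 'I_n =>
    'i *: wedge (dz R j) (dzbar R j)).
Proof.
rewrite /unit_volume rmorph_prod; apply: eq_bigr => j _ /=.
by rewrite lin_delta [conjW _]conj_dz.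
Qed.

(** The product of n forms of type (1, 0) is c dz_1 /\ .. /\ dz_n, with c the determinant of their
    coordinates; the product of the [cross a a] is then |c|^2 times the unit volume. *)
Lemma prod_cross_volume (s : seq 'rV[C R]_n) : size s = n ->
  exists2 c : C R, 0 <= c & \prod_(a <- s) cross a a = c *: unit_volume.
Proof.
move=> sn; have := @has_bidegree_prod_lin s; rewrite sn =>
  /has_bidegree_top_hol.
set u := \prod_(a <- s) lin a; set c := u _ => uE.
exists (c * Num.conj c); first exact: mul_conjC_ge0.
apply: evenval_inj; rewrite prod_cross linearZ /= -/u uE.
have dzE : \prod_(j < n) lin (delta_mx 0 j) = basis_form top_hol.
  by rewrite -prod_dz_enum; apply: eq_bigr => j _; exact: lin_delta.
have -> : evenval unit_volume = 'i ^+ (n ^ 2) *: (basis_form top_hol * conjW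
  (basis_form top_hol)).
  have := prod_cross [seq delta_mx 0 j | j <- enum 'I_n].
  rewrite !big_map size_map size_enum_ord => e; rewrite [LHS]e.
  by rewrite -dzE.
by rewrite conj_formZ -scalerAl -scalerAr !scalerA sn; congr (_ *: _); ring.
Qed.

End Volume.

(** * Nonnegative Hermitian matrices *)

Section Psd.
Local Open Scope sesquilinear_scope.
Variable F : numClosedFieldType.
Implicit Types (a b z w : F).

(** Hermitian symmetry is part of the conclusion: it follows from the reality of the values at (1,
    1) and (1, i). *)
Lemma psd2 a z z' b :
  (forall x y, 0 <= x * x^* * a + x * y^* * z + y * x^* * z' + y * y^* * b) ->
  [/\ 0 <= a, 0 <= b, z' = z^* & z * z^* <= a * b].
Proof.
move=> h.
have a0 : 0 <= a by have := h 1 0; rewrite rmorph1 rmorph0 !(mulr0, mul0r,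
  addr0, mul1r).
have b0 : 0 <= b by have := h 0 1; rewrite rmorph1 rmorph0 !(mulr0, mul0r,
  add0r, mul1r).
have ra : a^* = a by apply/CrealP/ger0_real.
have rb : b^* = b by apply/CrealP/ger0_real.
have ez : z' = z^*.
  have ii : 'i * 'i = -1 :> F by rewrite -expr2 sqrCi.
  have e3 : z^* + z'^* = z + z'.
    have /ger0_real/CrealP := h 1 1.
    rewrite rmorph1 !mul1r !rmorphD /= ra rb => /(congr1 (fun t =>
      t - a - b)) e.
    by transitivity (a + z^* + z'^* + b - a - b); [ring|rewrite e; ring].
  have e4 : z^* - z'^* = z' - z.
    have /ger0_real/CrealP := h 1 'i.
    rewrite rmorph1 conjCi !mul1r mulr1 mulrN ii opprK !(rmorphD, rmorphM,
      rmorphN) /=.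
    rewrite conjCi ra rb opprK rmorph1 => /(congr1 (fun t => t - a - b)) e.
    apply: (mulfI (neq0Ci F)).
    by transitivity (a + 'i * z^* + - 'i * z'^* + 1 * b - a - b);
      [ring|rewrite e; ring].
  have : z' *+ 2 = z^* *+ 2.
    have -> : z' *+ 2 = (z + z') + (z' - z) by ring.
    by rewrite -e3 -e4; ring.
  by move/eqP; rewrite -subr_eq0 -mulrnBl mulrn_eq0 /= subr_eq0 => /eqP.
split=> //; rewrite {}ez in h.
(* At (- conj z, a) the form has the value a (a b - |z|^2), and at (b, - z) the value b (a b -
   |z|^2). If a = b = 0, its value at (- conj z, 1) is -2 |z|^2. *)
have := a0; rewrite le0r => /orP[/eqP a00|a_gt0]; last first.
  have := h (- z^*) a; rewrite rmorphN /= conjCK ra.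
  have -> : - z^* * - z * a + - z^* * a * z + a * - z * z^* + a * a * b = a *
    (a * b - z * z^*) by ring.
  by rewrite pmulr_rge0 // subr_ge0.
have := b0; rewrite le0r => /orP[/eqP b00|b_gt0]; last first.
  have := h b (- z); rewrite rmorphN /= rb.
  have -> : b * b * a + b * - z^* * z + - z * b * z^* + - z * - z^* * b = b *
    (a * b - z * z^*) by ring.
  by rewrite pmulr_rge0 // subr_ge0.
have := h (- z^*) 1; rewrite a00 b00 rmorphN /= conjCK rmorph1.
have -> : - z^* * - z * 0 + - z^* * 1 * z + 1 * - z * z^* + 1 * 1 * 0 = - ((z *
  z^*) *+ 2) by ring.
by rewrite oppr_ge0 pmulrn_lle0 // mul0r.
Qed.

(* AM-GM *)
Lemma addC_conj_le w p q : 0 <= p -> 0 <= q -> w * w^* <= p * q ->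
  w + w^* <= p + q.
Proof.
move=> p0 q0 wpq.
have rw : w + w^* \is Num.real.
  by apply/CrealP; rewrite rmorphD /= conjCK addrC.
apply: le_trans (real_ler_norm rw) _.
rewrite -(@ler_pXn2r _ 2) ?nnegrE ?addr_ge0 // -normrX.
have r2 : (w + w^*) ^+ 2 \is Num.real by rewrite realX.
rewrite ger0_norm ?real_exprn_even_ge0 //.
have w2 : (w - w^*) ^+ 2 <= 0.
  have -> : (w - w^*) ^+ 2 = - ((w - w^*) * (w - w^*)^*).
    by rewrite rmorphB /= conjCK; ring.
  by rewrite oppr_le0 mul_conjC_ge0.
have pq2 : 0 <= (p - q) ^+ 2.
  by rewrite real_exprn_even_ge0 // rpredB // ger0_real.
have -> : (w + w^*) ^+ 2 = (w - w^*) ^+ 2 + (w * w^*) *+ 4 by ring.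
have -> : (p + q) ^+ 2 = (p - q) ^+ 2 + (p * q) *+ 4 by ring.
by apply: lerD; [exact: le_trans w2 pq2|rewrite lerMn2r wpq orbT].
Qed.

Definition psd n (N : 'M[F]_n) := forall t : 'rV_n, 0 <= (t *m N *m t ^t*) 0 0.

Lemma quadE n (N : 'M[F]_n) (s t : 'rV[F]_n) :
  (s *m N *m t ^t*) 0 0 = \sum_j \sum_k s 0 j * (t 0 k)^* * N j k.
Proof.
rewrite mxE exchange_big; apply: eq_bigr => k _; rewrite !mxE mulr_suml.
by apply: eq_bigr => j _; rewrite mulrAC.
Qed.

Lemma quad_delta n (N : 'M[F]_n) j k :
  ((delta_mx 0 j : 'rV_n) *m N *m (delta_mx 0 k : 'rV_n) ^t*) 0 0 = N j k.
Proof.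
rewrite quadE (bigD1 j) //= (bigD1 k) //= !big1 => [|i ij|i ik].
- by rewrite !mxE !eqxx andbT mulr1n conjC1 !mul1r !addr0.
- by rewrite big1 // => l _; rewrite !mxE (negPf ij) andbF !mul0r.
- by rewrite !mxE (negPf ik) andbF rmorph0 mulr0 mul0r.
Qed.

Lemma quad2E n (N : 'M[F]_n) (s t : 'rV[F]_n) x y :
  ((x *: s + y *: t) *m N *m (x *: s + y *: t) ^t*) 0 0 =
  x * x^* * (s *m N *m s ^t*) 0 0 + x * y^* * (s *m N *m t ^t*) 0 0
  + y * x^* * (t *m N *m s ^t*) 0 0 + y * y^* * (t *m N *m t ^t*) 0 0.
Proof.
rewrite !quadE !mulr_sumr -!big_split; apply: eq_bigr => j _ /=.
rewrite !mulr_sumr -!big_split; apply: eq_bigr => k _ /=.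
by rewrite !mxE rmorphD !rmorphM /=; ring.
Qed.

Lemma psd_pair n (N : 'M[F]_n) (s t : 'rV[F]_n) : psd N ->
  [/\ 0 <= (s *m N *m s ^t*) 0 0, 0 <= (t *m N *m t ^t*) 0 0,
     (t *m N *m s ^t*) 0 0 = ((s *m N *m t ^t*) 0 0)^* &
     (s *m N *m t ^t*) 0 0 * ((s *m N *m t ^t*) 0 0)^* <=
     (s *m N *m s ^t*) 0 0 * (t *m N *m t ^t*) 0 0].
Proof. by move=> h; apply: psd2 => x y; rewrite -quad2E. Qed.

Lemma psd_herm n (N : 'M[F]_n) : psd N -> N ^t* = N.
Proof.
move=> h; apply/matrixP => j k; rewrite !mxE.
by have [_ _ + _] := psd_pair (delta_mx 0 k) (delta_mx 0 j) h;
  rewrite !quad_delta.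
Qed.

(** A form with zero values is nonnegative, so that the Cauchy-Schwarz bound of [psd_pair] kills
    every entry. *)
Lemma quad_eq0 n (N : 'M[F]_n) :
  (forall t : 'rV_n, (t *m N *m t ^t*) 0 0 = 0) -> N = 0.
Proof.
move=> h; have pN : psd N by move=> t; rewrite h.
apply/matrixP => j k; rewrite mxE.
have [_ _ _] := psd_pair (delta_mx 0 j) (delta_mx 0 k) pN.
rewrite h mul0r quad_delta -normCK => n0.
by apply/eqP; rewrite -normr_eq0 -sqrf_eq0 eq_le n0 exprn_ge0.
Qed.

(** By the spectral theorem N = P^-1 D P with P unitary and D diagonal and nonnegative; Q is P^-1
    times the square root of D. *)
Lemma psd_factor n (N : 'M[F]_n) : psd N -> exists Q : 'M[F]_n,
  N = Q *m (Q ^t*).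
Proof.
move=> h; have hN : N \is hermsymmx.
  by apply/is_hermitianmxP; rewrite expr0 scale1r psd_herm.
have /orthomx_spectralP := hermitian_normalmx hN.
set P := spectralmx N; set sp := spectral_diag N => eN.
have uP : P \is unitarymx by exact: spectral_unitarymx.
rewrite invmx_unitary // in eN.
have sp0 j : 0 <= sp 0 j.
  have eD : P *m N *m P ^t* = diag_mx sp.
    rewrite eN !mulmxA (unitarymxP uP) mul1mx -mulmxA (unitarymxP uP).
    by rewrite mulmx1.
  have := h (delta_mx 0 j *m P).
  have -> : delta_mx 0 j *m P *m N *m (delta_mx 0 j *m P) ^t* =
            (delta_mx 0 j : 'rV_n) *m diag_mx sp *m (delta_mx 0 j : 'rV_n) ^t*.
    by rewrite trmx_mul map_mxM -eD !mulmxA.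
  by rewrite quad_delta mxE eqxx mulr1n.
exists (P ^t* *m diag_mx (map_mx sqrtC sp)).
rewrite trmx_mul map_mxM /= trmxCK tr_diag_mx map_diag_mx !mulmxA.
rewrite -[_ *m diag_mx _ *m diag_mx _]mulmxA {1}eN; congr (_ *m _ *m _).
rewrite mulmx_diag; congr diag_mx; apply/rowP => j; rewrite !mxE.
rewrite /=; have -> : Num.conj (sqrtC (sp 0 j)) = sqrtC (sp 0 j).
  by apply/CrealP; rewrite ger0_real // sqrtC_ge0.
by rewrite -expr2 sqrtCK.
Qed.

End Psd.

Section Disc2.
Local Open Scope sesquilinear_scope.
Variable F : numClosedFieldType.

(* Twice the mixed discriminant of the restrictions of N and N' to the span of s and t. *)
Definition polar_det n (N N' : 'M[F]_n) (s t : 'rV[F]_n) :=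
  let q (X : 'M[F]_n) (x y : 'rV[F]_n) := (x *m X *m y ^t*) 0 0 in
  q N s s * q N' t t + q N t t * q N' s s - q N s t * q N' t s - q N t s * q N'
    s t.

(** A change of basis multiplies a mixed discriminant by the squared modulus of its determinant,
    which is 1 for a shear. *)
Lemma polar_det_shear n (N N' : 'M[F]_n) (s t : 'rV[F]_n) c :
  polar_det N N' s (t + c *: s) = polar_det N N' s t.
Proof.
have es (X : 'M[F]_n) : (s *m X *m (t + c *: s) ^t*) 0 0 =
    (s *m X *m t ^t*) 0 0 + c^* * (s *m X *m s ^t*) 0 0.
  have := quad2E X s t 0 1; rewrite !quadE !mulr_sumr -!big_split => _.
  apply: eq_bigr => j _; rewrite !mulr_sumr -big_split;
    apply: eq_bigr => k _ /=.
  by rewrite !mxE rmorphD rmorphM /=; ring.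
have et (X : 'M[F]_n) : ((t + c *: s) *m X *m s ^t*) 0 0 =
    (t *m X *m s ^t*) 0 0 + c * (s *m X *m s ^t*) 0 0.
  rewrite !quadE !mulr_sumr -!big_split.
  apply: eq_bigr => j _; rewrite !mulr_sumr -big_split;
    apply: eq_bigr => k _ /=.
  by rewrite !mxE; ring.
have ett (X : 'M[F]_n) : ((t + c *: s) *m X *m (t + c *: s) ^t*) 0 0 =
    (t *m X *m t ^t*) 0 0 + c * (s *m X *m t ^t*) 0 0
    + c^* * (t *m X *m s ^t*) 0 0 + c * c^* * (s *m X *m s ^t*) 0 0.
  by have := quad2E X t s 1 c; rewrite !scale1r rmorph1 => ->; ring.
by rewrite /polar_det /= !es !et !ett; ring.
Qed.

(** A, Z, Z', B stand for Theta(v, v), Theta(v, w), Theta(w, v), Theta(w, w). The condition is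
    Griffiths semipositivity on the plane of v and w: nonnegativity on decomposable tensors only. *)
Definition griffiths_pair n (A Z Z' B : 'M[F]_n) :=
  forall x y, psd (x * x^* *: A + x * y^* *: Z + y * x^* *: Z' + y * y^* *: B).

Lemma griffiths_pairP n (A Z Z' B : 'M[F]_n) (t : 'rV[F]_n) :
  griffiths_pair A Z Z' B ->
  let q (X : 'M[F]_n) := (t *m X *m t ^t*) 0 0 in
  [/\ 0 <= q A, 0 <= q B, q Z' = (q Z)^* & q Z * (q Z)^* <= q A * q B].
Proof.
move=> h q; apply: psd2 => x y; have := h x y t; rewrite quadE.
congr (0 <= _); rewrite /q !quadE !mulr_sumr -!big_split;
  apply: eq_bigr => j _ /=.
rewrite !mulr_sumr -!big_split; apply: eq_bigr => k _ /=.
by rewrite !mxE; ring.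
Qed.

Lemma griffiths_pair_herm n (A Z Z' B : 'M[F]_n) :
  griffiths_pair A Z Z' B -> Z' = Z ^t*.
Proof.
move=> h; apply/eqP; rewrite -subr_eq0; apply/eqP/quad_eq0 => t.
have [_ _ e _] := griffiths_pairP t h.
rewrite mulmxBr mulmxBl mxE [X in _ + X]mxE e.
suff -> : (t *m Z ^t* *m t ^t*) 0 0 = ((t *m Z *m t ^t*) 0 0)^* by rewrite
  subrr.
rewrite !quadE exchange_big rmorph_sum; apply: eq_bigr => j _.
rewrite rmorph_sum; apply: eq_bigr => k _ /=.
by rewrite !rmorphM !mxE /= conjCK; ring.
Qed.

(** With A diagonal, the discriminant of A and B is A_ss B_tt + A_tt B_ss. Multiplying |Z_ss|^2 <=
    A_ss B_ss by |Z_tt|^2 <= A_tt B_tt and applying [addC_conj_le] bounds 2 Re (Z_ss conj Z_tt) by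
    this sum; the remaining terms |Z_st|^2 + |Z_ts|^2 enter with a plus sign. *)
Lemma polar_det_ge0_diag n (A Z Z' B : 'M[F]_n) (s t : 'rV[F]_n) :
  griffiths_pair A Z Z' B ->
  (s *m A *m t ^t*) 0 0 = 0 -> (t *m A *m s ^t*) 0 0 = 0 ->
  0 <= polar_det A B s t - polar_det Z Z' s t.
Proof.
move=> h; rewrite /polar_det /= => -> ->.
have [as0 bs0 ezs zs] := griffiths_pairP s h.
have [at0 bt0 ezt zt] := griffiths_pairP t h.
have ez := griffiths_pair_herm h.
have q_conj (x y : 'rV[F]_n) : (x *m Z' *m y ^t*) 0 0 = ((y *m Z *m x ^t*) 0
  0)^*.
  rewrite ez !quadE exchange_big rmorph_sum; apply: eq_bigr => j _.
  rewrite rmorph_sum; apply: eq_bigr => k _ /=.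
  by rewrite !rmorphM !mxE /= conjCK; ring.
rewrite !q_conj; move: as0 bs0 zs at0 bt0 zt {ezs ezt}.
move: ((s *m A *m _) 0 0) ((s *m B *m _) 0 0) ((t *m A *m _) 0 0) ((t *m B *m
  _) 0 0).
move: ((s *m Z *m s ^t*) 0 0) ((t *m Z *m t ^t*) 0 0) ((s *m Z *m t ^t*) 0 0)
  ((t *m Z *m s ^t*) 0 0).
move=> zss ztt zst zts a b a' b' a0 b0 zs a'0 b'0 zt.
have := @addC_conj_le _ (zss * ztt^*) (a * b') (a' * b).
rewrite rmorphM /= conjCK => /(_ (mulr_ge0 a0 b'0) (mulr_ge0 a'0 b0)) le.
have : zss * zss^* * (ztt * ztt^*) <= a * b * (a' * b').
  by apply: ler_pM => //; exact: mul_conjC_ge0.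
have -> : zss * zss^* * (ztt * ztt^*) = zss * ztt^* * (zss^* * ztt) by ring.
have -> : a * b * (a' * b') = a * b' * (a' * b) by ring.
move/le; rewrite -subr_ge0 => {}le.
have -> : a * b' + a' * b - 0 * (t *m B *m s ^t*) 0 0 - 0 * (s *m B *m t ^t*) 0
  0 -
  (zss * ztt^* + ztt * zss^* - zst * zst^* - zts * zts^*) =
  (a * b' + a' * b - (zss * ztt^* + zss^* * ztt)) + (zst * zst^* + zts * zts^*)
    by ring.
apply: addr_ge0; first by []. by apply: addr_ge0; exact: mul_conjC_ge0.
Qed.

(* Shearing makes A diagonal on the span of s and t. *)
Lemma polar_det_ge0 n (A Z Z' B : 'M[F]_n) (s t : 'rV[F]_n) :
  griffiths_pair A Z Z' B ->
  0 <= polar_det A B s t - polar_det Z Z' s t.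
Proof.
move=> h.
have pA : psd A.
  move=> x; have := h 1 0 x; rewrite rmorph1 rmorph0 !(mulr0, mul0r, scale0r,
    addr0).
  by rewrite mulr1 scale1r.
have [a0 _ ats nst] := psd_pair s t pA.
(* The shear divides by A_ss. If A_ss = 0, Cauchy-Schwarz gives A_st = 0 and A is diagonal
   already. *)
have [as0|as0] := eqVneq ((s *m A *m s ^t*) 0 0) 0.
  have st0 : (s *m A *m t ^t*) 0 0 = 0.
    apply/eqP; rewrite -normr_eq0 -sqrf_eq0 eq_le exprn_ge0 // andbT normCK.
    by apply: le_trans nst _; rewrite as0 mul0r.
  by apply: polar_det_ge0_diag => //; rewrite ats st0 rmorph0.
set c := - (t *m A *m s ^t*) 0 0 / (s *m A *m s ^t*) 0 0.
rewrite -(polar_det_shear A B s t c) -(polar_det_shear Z Z' s t c).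
have e : ((t + c *: s) *m A *m s ^t*) 0 0 = 0.
  rewrite mulmxDl mulmxDl mxE -!scalemxAl [X in _ + X]mxE /c mulfVK //.
  by rewrite subrr.
apply: polar_det_ge0_diag => //.
by have [_ _ -> _] := psd_pair (t + c *: s) s pA; rewrite e rmorph0.
Qed.

End Disc2.

(** * Forms of bidegree (1, 1) *)

Lemma anticomm_swap (F : nzRingType) (A : algType F) (x : F) (a b c d : A) :
  b * c = - (c * b) -> b * d = - (d * b) -> c * d = - (d * c) ->
  (x *: (a * b)) * (x *: (c * d)) = - ((x *: (a * d)) * (x *: (c * b))).
Proof.
move=> bc bd cd; rewrite -!scalerAl -!scalerAr -!scalerN; congr (_ *: (_ *: _)).
rewrite -!mulrA -mulrN; congr (_ * _).
by rewrite mulrA bc mulNr -mulrA bd mulrN opprK mulrA cd mulNr mulrA.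
Qed.

(** The rules are those of c_jk = i e_j /\ conj e_k on a complex surface, where the surviving
    products are c_00 c_11 and c_01 c_10 = - c_00 c_11. The coefficient is the polarized
    determinant. *)
Lemma det2_expand (F : comNzRingType) (A : comAlgType F) (c00 c01 c10 c11 : A)
    (x00 x01 x10 x11 y00 y01 y10 y11 : F) :
  c00 * c00 = 0 -> c01 * c01 = 0 -> c10 * c10 = 0 -> c11 * c11 = 0 ->
  c00 * c01 = 0 -> c00 * c10 = 0 -> c01 * c11 = 0 -> c10 * c11 = 0 ->
  c01 * c10 = - (c00 * c11) ->
  (x00 *: c00 + x01 *: c01 + (x10 *: c10 + x11 *: c11)) *
  (y00 *: c00 + y01 *: c01 + (y10 *: c10 + y11 *: c11)) =
  (x00 * y11 + x11 * y00 - x01 * y10 - x10 * y01) *: (c00 * c11).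
Proof.
move=> e0 e1 e2 e3 e4 e5 e6 e7 e8.
rewrite !(mulrDl, mulrDr) -!scalerAl -!scalerAr !scalerA.
rewrite (mulrC c01 c00) (mulrC c10 c00) (mulrC c11 c00) (mulrC c10 c01) (mulrC
  c11 c01) (mulrC c11 c10).
rewrite e0 e1 e2 e3 e4 e5 e6 e7 e8 !scaler0 !addr0 !add0r !scalerN.
by rewrite !scalerBl scalerDl; rewrite -!addrA; congr (_ + _);
  rewrite addrC -!addrA [LHS]addrC -!addrA;
 rewrite addrCA.
Qed.

Section OneOneForms.
Local Open Scope sesquilinear_scope.
Variables (R : realType) (n : nat).
Local Notation W := (exterior R n).
Local Notation K := (evenform R n).
Implicit Types (a b c d : 'rV[C R]_n) (N : 'M[C R]_n) (x : C R).

Lemma econj_cross a b : econj (cross a b) = cross b a.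
Proof.
apply: evenval_inj; rewrite econjE !evenval_cross conj_formZ conjCi.
rewrite rmorphM /= [conjW (conjW _)](_ : _ = lin b); last first.
  apply/ffunP => S; rewrite !ffunE -/(swap_set S) -/(swap_set _) swap_setK.
  rewrite hol_degree_swap antihol_degree_swap rmorphM rmorphXn rmorphN1 /=
    conjCK mulrA.
  by rewrite -exprD mulnC addnn -signr_odd odd_double expr0 mul1r.
rewrite (wedgeC (has_bidegree_parity (@has_bidegree_conj_lin _ _ a))
  (has_bidegree_parity (@has_bidegree_lin _ _ b))) /=.
by rewrite expr1 !scaleNr scale1r scalerN opprK.
Qed.

Lemma crossDl a b c : cross (a + b) c = cross a c + cross b c.
Proof.
by apply: evenval_inj; rewrite [RHS]rmorphD /= linearD mulrDl scalerDr.
Qed.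

Lemma crossZl x a c : cross (x *: a) c = x *: cross a c.
Proof.
by apply: evenval_inj; rewrite [RHS]linearZ /= linearZ -scalerAl !scalerA mulrC.
Qed.

Lemma cross0l c : cross 0 c = 0.
Proof. by have := crossZl 0 0 c; rewrite !scale0r. Qed.

Lemma cross_suml (I : finType) (f : I -> C R) (e : I -> 'rV[C R]_n) c :
  cross (\sum_i f i *: e i) c = \sum_i f i *: cross (e i) c.
Proof.
elim/big_rec2 : _ => [|i u v _ <-]; first exact: cross0l.
by rewrite crossDl crossZl.
Qed.

Lemma cross_sumr (I : finType) (f : I -> C R) (e : I -> 'rV[C R]_n) c :
  cross c (\sum_i f i *: e i) = \sum_i Num.conj (f i) *: cross c (e i).
Proof.
rewrite -econj_cross cross_suml rmorph_sum; apply: eq_bigr => i _ /=.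
by rewrite econjZ econj_cross.
Qed.

(** Exchanging the two (0, 1)-factors reverses the sign. A repeated factor of either type therefore
    gives 0, as [cross_mulr0] and [cross_mull0] record. *)
Lemma cross_swap a b c d : cross a b * cross c d = - (cross a d * cross c b).
Proof.
apply: evenval_inj; rewrite rmorphN !rmorphM.
have anti (u v : W) : has_parity true u -> has_parity true v ->
  u * v = - (v * u).
  by move=> hu hv; rewrite (wedgeC hu hv) /= expr1 scaleN1r.
have h a' : has_parity true (lin a' : W) by exact: (has_bidegree_parity
  (@has_bidegree_lin _ _ a')).
have h' a' : has_parity true (conjW (lin a') : W).
  exact: (has_bidegree_parity (@has_bidegree_conj_lin _ _ a')).
exact: (anticomm_swap 'i (lin a) (anti _ _ (h' b) (h c)) (anti _ _ (h' b) (h'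
  d)) (anti _ _ (h c) (h' d))).
Qed.

Lemma eq_oppr (u : K) : u = - u -> u = 0.
Proof.
move=> e; have : 2 *: u = 0 by rewrite scaler_nat mulr2n {2}e subrr.
by move/eqP; rewrite scaler_eq0 pnatr_eq0 /= => /eqP.
Qed.

Lemma cross_mulr0 a c b : cross a b * cross c b = 0.
Proof. by apply: eq_oppr; rewrite {1}cross_swap. Qed.

Lemma cross_mull0 a b d : cross a b * cross a d = 0.
Proof. by apply: eq_oppr; rewrite {1}cross_swap mulrC. Qed.

Definition form11 N : K := \sum_j \sum_k N j k *: cross (delta_mx 0 j)
  (delta_mx 0 k).

Lemma form11_is_linear : linear form11.
Proof.
move=> x N N'; rewrite /form11 scaler_sumr -big_split; apply: eq_bigr => j _ /=.
rewrite scaler_sumr -big_split; apply: eq_bigr => k _ /=.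
by rewrite !mxE scalerDl scalerA.
Qed.
HB.instance Definition _ := GRing.isLinear.Build (C R) 'M[C R]_n K *:%R form11
  form11_is_linear.

Lemma row_sum_deltaE m (U : 'M[C R]_(m, n)) j : row j U = \sum_l U j l *:
  delta_mx 0 l.
Proof. by rewrite [LHS]row_sum_delta; apply: eq_bigr => l _; rewrite mxE. Qed.

Lemma sum_cross_rows m (U : 'M[C R]_(m, n)) (N : 'M[C R]_m) :
  \sum_j \sum_k N j k *: cross (row j U) (row k U) =
  form11 (U^T *m N *m map_mx Num.conj U).
Proof.
under eq_bigr => j _ do under eq_bigr => k _ do
  rewrite !row_sum_deltaE cross_suml scaler_sumr.
under eq_bigr => j _ do rewrite exchange_big /=.
rewrite exchange_big; apply: eq_bigr => l _ /=.
under eq_bigr => j _ do under eq_bigr => k _ do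
  rewrite cross_sumr !scaler_sumr.
under eq_bigr => j _ do rewrite exchange_big /=.
rewrite exchange_big; apply: eq_bigr => m' _ /=.
rewrite mxE exchange_big scaler_suml; apply: eq_bigr => k _ /=.
rewrite !mxE mulr_suml scaler_suml; apply: eq_bigr => j _.
by rewrite !scalerA !mxE; congr (_ *: _); ring.
Qed.

Lemma econj_form11 N : econj (form11 N) = form11 (N ^t*).
Proof.
rewrite rmorph_sum /=.
under eq_bigr => j _ do rewrite rmorph_sum /=.
rewrite exchange_big; apply: eq_bigr => j _ /=; apply: eq_bigr => k _ /=.
by rewrite econjZ econj_cross !mxE.
Qed.

(** Factoring N as Q times its adjoint exhibits the form as a sum over the columns a of Q. *)
Lemma form11_psd N : psd N -> exists s : seq 'rV[C R]_n,
  form11 N = \sum_(a <- s) cross a a.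
Proof.
move=> /psd_factor[Q eN]; exists [seq row j Q^T | j <- enum 'I_n].
have := sum_cross_rows Q^T 1%:M; rewrite trmxK mulmx1 -eN => <-.
rewrite big_map big_enum; apply: eq_bigr => j _ /=.
rewrite (bigD1 j) //= mxE eqxx scale1r big1 ?addr0 // => k /negPf kj.
by rewrite mxE eq_sym kj scale0r.
Qed.

(** As V U^T = 1, the rows of V are the vectors dual to the covectors in the rows of U; the new
    coefficients are the values of N on them. *)
Lemma form11_dual_basis (U : 'M[C R]_n) N : U \in unitmx ->
  let V := invmx U^T in
  form11 N = \sum_j \sum_k (row j V *m N *m (row k V) ^t*) 0 0 *: cross (row j
    U) (row k U).
Proof.
move=> uU V.
have eN : N = U^T *m (V *m N *m V ^t*) *m map_mx Num.conj U.
  rewrite !mulmxA mulmxV ?unitmx_tr // mul1mx -mulmxA.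
  have -> : V ^t* *m map_mx Num.conj U = 1%:M.
    by rewrite -map_mxM /V trmx_inv trmxK mulVmx // map_mx1.
  by rewrite mulmx1.
rewrite {1}eN -sum_cross_rows.
apply: eq_bigr => j _; apply: eq_bigr => k _; congr (_ *: _).
by rewrite -row_mul [LHS]mxE [RHS]mxE; apply: eq_bigr => l _;
  rewrite [row _ _ _ _]mxE !mxE.
Qed.

Definition positive_multiple (u : K) := exists2 c : C R,
  0 <= c & u = c *: unit_volume R n.

Lemma positive_multiple0 : positive_multiple 0.
Proof. by exists 0; rewrite ?scale0r. Qed.

Lemma positive_multipleD (u v : K) :
  positive_multiple u -> positive_multiple v -> positive_multiple (u + v).
Proof. by move=> [c c0 ->] [d d0 ->]; exists (c + d);
  rewrite ?addr_ge0 ?scalerDl. Qed.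

Lemma positive_multipleZ x (u : K) :
  0 <= x -> positive_multiple u -> positive_multiple (x *: u).
Proof. by move=> x0 [c c0 ->]; exists (x * c); rewrite ?mulr_ge0 ?scalerA. Qed.

Lemma positive_multiple_sum (I : Type) (r : seq I) (P : pred I) (F : I -> K) :
  (forall i, P i -> positive_multiple (F i)) ->
  positive_multiple (\sum_(i <- r | P i) F i).
Proof.
by move=> h; elim/big_ind : _ => //;
  [exact: positive_multiple0|exact: positive_multipleD].
Qed.

(** By [prod_cross], this is the test form i^(q^2) beta /\ conj beta for beta the product of the
    rows of B. *)
Definition cross_rows q (B : 'M[C R]_(q, n)) : K :=
  \prod_i cross (row i B) (row i B).

Lemma cross_rows_row q (B : 'M[C R]_(q, n)) i b : cross (row i B) b *
  cross_rows B = 0.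
Proof. by rewrite /cross_rows (bigD1 i) //= mulrA cross_mull0 mul0r. Qed.

Lemma cross_rows_submx q (B : 'M[C R]_(q, n)) a b : (a <= B)%MS ->
  cross a b * cross_rows B = 0.
Proof.
move=> /submxP[D ->]; rewrite mulmx_sum_row cross_suml mulr_suml big1 // => i _.
by rewrite -scalerAl cross_rows_row scaler0.
Qed.

(** A linear relation expresses one row through the others, and a repeated row gives 0. *)
Lemma cross_rows_free q (B : 'M[C R]_(q, n)) : ~~ row_free B ->
  cross_rows B = 0.
Proof.
rewrite -kermx_eq0 => /rowV0Pn[v /sub_kermxP vB /rV0Pn[i vi]].
rewrite /cross_rows (bigD1 i) //=.
have e : row i B = \sum_j (if j == i then 0 else - v 0 j / v 0 i) *: row j B.
  rewrite (bigD1 i) //= eqxx scale0r add0r.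
  apply: (scalerI vi); rewrite scaler_sumr.
  move: vB; rewrite mulmx_sum_row (bigD1 i) //= => /eqP.
  rewrite addr_eq0 => /eqP ->; rewrite -sumrN; apply: eq_bigr => j /negPf ->.
  by rewrite scalerA mulrC mulfVK // scaleNr.
rewrite {1}e cross_suml mulr_suml big1 // => j _.
case: (eqVneq j i) => [_|ji]; first by rewrite scale0r mul0r.
by rewrite (bigD1 j) //= -scalerAl mulrA cross_mull0 mul0r scaler0.
Qed.

End OneOneForms.

Lemma sum_ord2 (V : nmodType) (F : 'I_2 -> V) : \sum_(i < 2) F i = F ord0 + F
  ord_max.
Proof. by rewrite !big_ord_recl big_ord0 addr0; congr (_ + F _);
  apply: val_inj. Qed.

Lemma det2_sum (F : comNzRingType) (A : comAlgType F) (c : 'I_2 -> 'I_2 -> A)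
    (x y : 'I_2 -> 'I_2 -> F) :
  (forall i j k, c i j * c i k = 0) -> (forall i j k, c i j * c k j = 0) ->
  c ord0 ord_max * c ord_max ord0 = - (c ord0 ord0 * c ord_max ord_max) ->
  (\sum_(i < 2) \sum_(j < 2) x i j *: c i j) * (\sum_(i < 2) \sum_(j < 2) y i j
    *: c i j) =
  (x ord0 ord0 * y ord_max ord_max + x ord_max ord_max * y ord0 ord0
   - x ord0 ord_max * y ord_max ord0 - x ord_max ord0 * y ord0 ord_max)
  *: (c ord0 ord0 * c ord_max ord_max).
Proof. by move=> h h' h''; rewrite !sum_ord2; apply: det2_expand. Qed.

Section Pair.
Local Open Scope sesquilinear_scope.
Variables (R : realType) (q : nat).
Local Notation n := (q + 2)%N.
Local Notation K := (evenform R n).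
Implicit Types (N : 'M[C R]_n).

(** Multiplication by [cross_rows B] kills every covector in the span of B, so that only two
    complementary covectors e, f contribute. The vectors s, t dual to e, f span the plane on which
    the rows of B vanish, and there (1, 1)-forms multiply through their mixed discriminant. *)
Lemma form11_pair_det (N N' M M' : 'M[C R]_n) (B : 'M[C R]_(q, n)) :
  row_free B -> exists s t e f : 'rV[C R]_n,
  (form11 N * form11 N' - form11 M * form11 M') * cross_rows B =
  (polar_det N N' s t - polar_det M M' s t) *: (cross e e * cross f f *
    cross_rows B).
Proof.
move=> fB; set U := row_ebase B; have uU : U \in unitmx by exact:
  row_ebase_unit.
have uL : col_ebase B \in unitmx by exact: col_ebase_unit.
set V := invmx U^T.
have rB : \rank B = q by apply/eqP.
(* As B has rank q, the first q rows of the completed basis [row_ebase B] lie in its row space. *)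
have sub (j : 'I_q) : (row (lshift 2 j) U <= B)%MS.
  apply/submxP; exists (row j (invmx (col_ebase B))).
  rewrite -row_mul -{2}(mulmx_ebase B) rB -mulmxA mulKmx //.
  by rewrite pid_mx_row -[row_ebase B]vsubmxK mul_row_col mul1mx mul0mx addr0
    row_usubmx.
pose e (i : 'I_2) := row (rshift q i) U; pose tau (i : 'I_2) :=
  row (rshift q i) V.
pose co (X : 'M[C R]_n) i j := (tau i *m X *m (tau j) ^t*) 0 0.
have red (X : 'M[C R]_n) : form11 X * cross_rows B =
    (\sum_(i < 2) \sum_(j < 2) co X i j *: cross (e i) (e j)) * cross_rows B.
  rewrite (form11_dual_basis _ uU) !mulr_suml big_split_ord /= big1 ?add0r;
    last first.
    move=> j _; rewrite mulr_suml big1 // => k _.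
    by rewrite -scalerAl cross_rows_submx ?scaler0.
  apply: eq_bigr => i _; rewrite !mulr_suml big_split_ord /= big1 ?add0r // =>
    k _.
  rewrite -scalerAl.
  (* Conjugation reduces a (0, 1)-factor from the span of B to the case of a (1, 0)-factor. *)
  have -> : cross (row (rshift q i) U) (row (lshift 2 k) U) * cross_rows B =
     econj (cross (row (lshift 2 k) U) (row (rshift q i) U) * cross_rows B).
    rewrite rmorphM /= econj_cross; congr (_ * _).
    by rewrite rmorph_prod; apply: eq_bigr => l _ /=; rewrite econj_cross.
  by rewrite cross_rows_submx // rmorph0 scaler0.
have redM (X Y : 'M[C R]_n) : form11 X * form11 Y * cross_rows B =
    polar_det X Y (tau ord0) (tau ord_max) *:
    (cross (e ord0) (e ord0) * cross (e ord_max) (e ord_max) * cross_rows B).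
  rewrite -mulrA red mulrCA red mulrA scalerAl.
  congr (_ * _); rewrite mulrC; apply: det2_sum => [i j k|i j k|].
  - exact: cross_mull0.
  - exact: cross_mulr0.
  - exact: cross_swap.
exists (tau ord0), (tau ord_max), (e ord0), (e ord_max).
by rewrite mulrBl !redM -scalerBl.
Qed.


End Pair.

(** * Chern polynomials of a 3 x 3 matrix *)

Section ChernIdentities.
Local Open Scope sesquilinear_scope.
Variables (F : numClosedFieldType) (A : comAlgType F).
Implicit Types (z : F) (v w : 'rV[F]_3).

(* The twelve lines spanned by e_i + z e_j with z^4 = 1 and i < j form a complex
   projective 2-design in C^3. *)
Definition fourth_roots : seq F := [:: 1; -1; 'i; - 'i].

Definition pairing (a : 'M[A]_3) v w : A :=
  \sum_p \sum_q (v 0 p * (w 0 q)^*) *: a p q.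

Definition pair_vec (i j : 'I_3) z : 'rV[F]_3 :=
  delta_mx 0 i + z *: delta_mx 0 j.

Lemma pairingDl a v v' w : pairing a (v + v') w = pairing a v w + pairing a v'
  w.
Proof.
rewrite -big_split; apply: eq_bigr => p _; rewrite -big_split;
  apply: eq_bigr => q _ /=.
by rewrite mxE mulrDl scalerDl.
Qed.

Lemma pairingZl a z v w : pairing a (z *: v) w = z *: pairing a v w.
Proof.
rewrite scaler_sumr; apply: eq_bigr => p _; rewrite scaler_sumr;
  apply: eq_bigr => q _ /=.
by rewrite mxE scalerA mulrA.
Qed.

Lemma pairingDr a v w w' : pairing a v (w + w') = pairing a v w + pairing a v
  w'.
Proof.
rewrite -big_split; apply: eq_bigr => p _; rewrite -big_split;
  apply: eq_bigr => q _ /=.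
by rewrite mxE rmorphD mulrDr scalerDl.
Qed.

Lemma pairingZr a z v w : pairing a v (z *: w) = z^* *: pairing a v w.
Proof.
rewrite scaler_sumr; apply: eq_bigr => p _; rewrite scaler_sumr;
  apply: eq_bigr => q _ /=.
by rewrite mxE rmorphM scalerA mulrCA.
Qed.

Lemma pairing_delta a i j : pairing a (delta_mx 0 i) (delta_mx 0 j) = a i j.
Proof.
rewrite /pairing (bigD1 i) //= (bigD1 j) //= !big1 =>
  [|p /negPf pi|q /negPf qj].
- by rewrite !mxE !eqxx conjC1 mul1r scale1r !addr0.
- by rewrite big1 // => q _; rewrite !mxE pi mul0r scale0r.
- by rewrite !mxE qj rmorph0 mulr0 scale0r.
Qed.

Definition chern1 (a : 'M[A]_3) : A := a ord0 ord0 + a (inord 1) (inord 1) + a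
  ord_max ord_max.
Definition minor2 (a : 'M[A]_3) i j : A := a i i * a j j - a i j * a j i.
Definition chern2 (a : 'M[A]_3) : A :=
  minor2 a ord0 (inord 1) + minor2 a ord0 ord_max + minor2 a (inord 1) ord_max.
Definition chern3 (a : 'M[A]_3) : A :=
  a ord0 ord0 * minor2 a (inord 1) ord_max
  - a ord0 (inord 1) * (a (inord 1) ord0 * a ord_max ord_max - a (inord 1)
    ord_max * a ord_max ord0)
  + a ord0 ord_max * (a (inord 1) ord0 * a ord_max (inord 1) - a (inord 1)
    (inord 1) * a ord_max ord0).

(** The scalar i is replaced by an element of the algebra with square -1, so that [ring] can handle
    the sums over the fourth roots of unity. *)
Lemma fourth_roots_alg : exists2 r : A, r * r = -1 &
  [/\ (forall x : A, 'i *: x = r * x), (forall x : A, 'i^* *: x = - (r * x)),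
      (forall x : A, - 'i *: x = - (r * x)) & (forall x : A,
        (- 'i)^* *: x = r * x)].
Proof.
exists 'i%:A; first by rewrite -scalerAl mul1r scalerA -expr2 sqrCi scaleN1r.
by split=> x; rewrite -scalerAl mul1r ?rmorphN /= ?conjCi ?opprK ?scaleNr.
Qed.

Definition square_sum (a : 'M[A]_3) i j : A :=
  \sum_(z <- fourth_roots)
    pairing a (pair_vec i j z) (pair_vec i j z) * pairing a (pair_vec i j z)
      (pair_vec i j z).

(** The pairing is a_ii + a_jj + conj z a_ij + z a_ji. The sums of z and of z^2 over the fourth
    roots vanish, so that only the terms of its square free of z survive. *)
Lemma square_sumE a i j :
  square_sum a i j = 4 * ((a i i + a j j) * (a i i + a j j) + 2 * (a i j * a j
    i)).
Proof.
rewrite /square_sum !big_cons big_nil /pair_vec.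
rewrite !(pairingDl, pairingDr, pairingZl, pairingZr, pairing_delta).
have [z zz [e1 e2 e3 e4]] := fourth_roots_alg.
have e5 x : (1 : F)^* *: x = x :> A by rewrite rmorph1 scale1r.
have e6 x : (-1 : F)^* *: x = - x :> A by rewrite rmorphN rmorph1 scaleN1r.
rewrite !e1 !e2 !e3 !e4 !e5 !e6 !scale1r !scaleN1r.
have k1 x y : z * (x - z * y) = z * x + y by rewrite mulrBr mulrA zz mulN1r
  opprK.
have k2 x y : z * (x + z * y) = z * x - y by rewrite mulrDr mulrA zz mulN1r.
rewrite !k1 !k2.
set p := a i i; set q := a j j; set x := a i j; set y := a j i.
transitivity (2 * (p + q) * (p + q) + 2 * (x + y) * (x + y) + 2 * (p + q) * (p
  + q) + 2 * (z * z) * ((y - x) * (y - x))).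
  by ring.
by rewrite zz; ring.
Qed.

Definition cyclic_pairs : seq ('I_3 * 'I_3) :=
  [:: (ord0, inord 1); (inord 1, ord_max); (ord_max, ord0)].

(** In the eigenvalues, c_1^2 - c_2 is the complete homogeneous polynomial of degree 2. Eight times
    it is the sum of Theta(v, v)^2 over the twelve vectors of the design, and c_1 is the sum of the
    a_pp. *)
Lemma chern_segre a :
  8 * (chern1 a * (chern1 a * chern1 a) - chern1 a * chern2 a) =
  \sum_(p <- [:: ord0; inord 1; ord_max]) \sum_(ij <- cyclic_pairs)
    a p p * square_sum a ij.1 ij.2.
Proof.
rewrite /cyclic_pairs !big_cons !big_nil /= !square_sumE /chern1 /chern2
  /minor2; ring.
Qed.

(* For W spanned by the orthogonal vectors e_k and f = e_i + z e_j, of norms 1 and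
   sqrt 2, the two factors are 2 c_1 and 2 c_2 of the compression to W. *)
Definition schur_sum (a : 'M[A]_3) k i j : A :=
  let e : 'rV[F]_3 := delta_mx 0 k in
  \sum_(z <- fourth_roots)
    let f := pair_vec i j z in
    (2 * pairing a e e + pairing a f f) *
    (pairing a e e * pairing a f f - pairing a e f * pairing a f e).

Lemma schur_sumE a k i j :
  schur_sum a k i j =
  let s := a i i + a j j in
  4 * ((2 * a k k + s) * (a k k * s - a k i * a i k - a k j * a j k)
       + 2 * a k k * a i j * a j i - a i j * a k i * a j k - a j i * a k j * a
         i k).
Proof.
rewrite /schur_sum !big_cons big_nil /pair_vec.
rewrite !(pairingDl, pairingDr, pairingZl, pairingZr, pairing_delta).
have [z zz [e1 e2 e3 e4]] := fourth_roots_alg.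
have e5 x : (1 : F)^* *: x = x :> A by rewrite rmorph1 scale1r.
have e6 x : (-1 : F)^* *: x = - x :> A by rewrite rmorphN rmorph1 scaleN1r.
rewrite !e1 !e2 !e3 !e4 !e5 !e6 !scale1r !scaleN1r.
have k1 x y : z * (x - z * y) = z * x + y by rewrite mulrBr mulrA zz mulN1r
  opprK.
have k2 x y : z * (x + z * y) = z * x - y by rewrite mulrDr mulrA zz mulN1r.
rewrite !k1 !k2.
set P := a k k; set p := a i i; set q := a j j; set x := a i j; set y := a j i.
set u := a k i; set v := a k j; set u' := a i k; set v' := a j k.
(* For the two imaginary roots, written z and - z, the factors of the summand are A0 + z D and B +
   z^2 v v' + z E, up to the sign of z. Their products add up to 2 A0 (B + z^2 v v') + 2 z^2 D E. *)
pose A0 := 2 * P + p + q; pose D := y - x; pose B := P * (p + q) - u * u'.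
pose E := P * (y - x) - (u * v' - v * u').
transitivity
 ((2 * P + (p + q + x + y)) * (P * (p + q + x + y) - (u + v) * (u' + v')) +
  (2 * P + (p + q - x - y)) * (P * (p + q - x - y) - (u - v) * (u' - v')) +
  2 * A0 * B + 2 * (z * z) * (A0 * (v * v') + D * E)).
  by rewrite /A0 /B /D /E; ring.
by rewrite zz /A0 /B /D /E; ring.
Qed.

(** In the eigenvalues, c_1 c_2 - c_3 is s_(2,1) = (x + y)(y + z)(z + x). The plane spanned by e_k
    and e_i + z e_j has the normal e_i - z e_j, again a vector of the design. *)
Lemma chern_schur21 a :
  12 * (chern1 a * chern2 a - chern3 a) =
  \sum_(kij <- [:: (ord0, (inord 1, ord_max)); (inord 1, (ord_max, ord0));
                  (ord_max, (ord0, inord 1))]) schur_sum a kij.1 kij.2.1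
                    kij.2.2.
Proof.
by rewrite !big_cons !big_nil /= !schur_sumE /chern1 /chern2 /chern3 /minor2;
  ring.
Qed.

End ChernIdentities.

(** * Weak positivity of the Chern combinations in an orthonormal frame *)

Section WeakPositivity.
Local Open Scope sesquilinear_scope.
Variables (R : realType) (n : nat).
Local Notation K := (evenform R n).
Implicit Types (N : 'M[C R]_n).

Lemma cross_rows_seq q (B : 'M[C R]_(q, n)) :
  cross_rows B = \prod_(a <- [seq row i B | i <- enum 'I_q]) cross a a.
Proof. by rewrite big_map big_enum. Qed.

Lemma prod_cross_rows_positive q (s : seq 'rV[C R]_n) (B : 'M[C R]_(q, n)) :
  (size s + q)%N = n -> positive_multiple ((\prod_(a <- s) cross a a) *
    cross_rows B).
Proof.
move=> sq; rewrite cross_rows_seq -big_cat; apply: prod_cross_volume.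
by rewrite size_cat size_map size_enum_ord.
Qed.

(** Independent rows of M cut out a complex surface, where [polar_det_ge0] gives the sign of the
    coefficient; dependent rows give 0. *)
Lemma pair_positive q (A Z Z' B : 'M[C R]_n) (M : 'M[C R]_(q, n)) :
  (q + 2)%N = n -> griffiths_pair A Z Z' B ->
  positive_multiple ((form11 A * form11 B - form11 Z * form11 Z') * cross_rows
    M).
Proof.
move=> qn h; have [fM|/cross_rows_free ->] := boolP (row_free M); last first.
  by rewrite mulr0; exact: positive_multiple0.
have [s [t [e [f eq]]]] : exists s t e f : 'rV[C R]_n,
  (form11 A * form11 B - form11 Z * form11 Z') * cross_rows M =
  (polar_det A B s t - polar_det Z Z' s t) *: (cross e e * cross f f *
    cross_rows M).
  by move: A Z Z' B M fM {h}; case: n / qn => A Z Z' B M fM;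
    exact: form11_pair_det.
rewrite eq; apply: positive_multipleZ; first exact: polar_det_ge0.
have -> : cross e e * cross f f = \prod_(a <- [:: e; f]) cross a a.
  by rewrite !big_cons big_nil mulr1.
by apply: prod_cross_rows_positive; rewrite addnC.
Qed.

(** Positivity in bidegree (3, 3), apart from bidegree and reality. The equation for q avoids the
    truncated difference n - 3 and makes the condition void for n < 3. *)
Definition weakly_positive (u : K) := forall q (B : 'M[C R]_(q, n)),
  (q + 3)%N = n -> positive_multiple (u * cross_rows B).

Lemma weakly_positiveD (u v : K) :
  weakly_positive u -> weakly_positive v -> weakly_positive (u + v).
Proof.
by move=> hu hv q B qn; rewrite mulrDl; apply: positive_multipleD;
  [exact: hu|exact: hv].
Qed.

Lemma weakly_positiveZ (c : C R) (u : K) : 0 <= c -> weakly_positive u ->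
  weakly_positive (c *: u).
Proof.
by move=> c0 hu q B qn; rewrite -scalerAl; apply: positive_multipleZ c0 (hu _ _
  qn).
Qed.

Lemma weakly_positive_sum (I : Type) (r : seq I) (P : pred I) (F : I -> K) :
  (forall i, P i -> weakly_positive (F i)) -> weakly_positive (\sum_(i <- r | P
    i) F i).
Proof.
move=> h; elim/big_ind : _ => //; last exact: weakly_positiveD.
by move=> q B _; rewrite mul0r; exact: positive_multiple0.
Qed.

Lemma natr_scale k (u : K) : k%:R * u = (k%:R : C R) *: u.
Proof. by rewrite scaler_nat mulr_natl. Qed.

Lemma weakly_positive_cancel k (u : K) :
  weakly_positive (k.+1%:R * u) -> weakly_positive u.
Proof.
move=> h; have -> : u = (k.+1%:R : C R)^-1 *: (k.+1%:R * u).
  by rewrite natr_scale scalerA mulVf ?pnatr_eq0 // scale1r.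
by apply: weakly_positiveZ h; rewrite invr_ge0 ler0n.
Qed.

(** Each factor is a sum of forms [cross a a], so that against a test form every term is a product
    of n of them. *)
Lemma psd3_weakly_positive N1 N2 N3 : psd N1 -> psd N2 -> psd N3 ->
  weakly_positive (form11 N1 * (form11 N2 * form11 N3)).
Proof.
move=> /form11_psd[s1 ->] /form11_psd[s2 ->] /form11_psd[s3 ->] q B qn.
rewrite !mulr_suml; apply: positive_multiple_sum => a _.
rewrite mulr_sumr mulr_suml; apply: positive_multiple_sum => b _.
rewrite !mulr_sumr mulr_suml; apply: positive_multiple_sum => c _.
have -> : cross a a * (cross b b * cross c c) = \prod_(a <- [:: a; b;
  c]) cross a a.
  by rewrite !big_cons big_nil mulr1.
by apply: prod_cross_rows_positive; rewrite addnC.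
Qed.

(** Each summand [cross a a] of the first factor is absorbed into the test form as one more row,
    which leaves the case of a surface, [pair_positive]. *)
Lemma psd_pair_weakly_positive N (A Z Z' B : 'M[C R]_n) : psd N ->
  griffiths_pair A Z Z' B ->
  weakly_positive (form11 N * (form11 A * form11 B - form11 Z * form11 Z')).
Proof.
move=> /form11_psd[s ->] h q M qn.
have hD (a : 'rV_n) : positive_multiple
    ((form11 A * form11 B - form11 Z * form11 Z') * cross_rows (col_mx a M)).
  by apply: pair_positive h; move: qn; lia.
move: (form11 A * form11 B - form11 Z * form11 Z') hD => D hD.
rewrite !mulr_suml; apply: positive_multiple_sum => a _.
have -> : cross a a * D * cross_rows M = D * cross_rows (col_mx a M);
  last exact: hD.
rewrite [cross_rows (col_mx _ _)]/cross_rows big_split_ord big_ord1 /= rowKu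
  row_id.
rewrite mulrCA mulrA; congr (_ * _ * _).
by apply: eq_bigr => i _; rewrite rowKd.
Qed.

Section Core.
Local Open Scope sesquilinear_scope.
Variable N : 'I_3 -> 'I_3 -> 'M[C R]_n.
(** With N the curvature in an orthonormal frame, this is the coefficient matrix of Theta(v, w), and
    the hypothesis that follows is Griffiths semipositivity. *)
Let T (v w : 'rV[C R]_3) : 'M[C R]_n := \sum_p \sum_q (v 0 p * (w 0 q)^*) *: N
  p q.
Hypothesis N_ge0 : forall v, psd (T v v).
Let a : 'M[K]_3 := \matrix_(p, q) form11 (N p q).

Let pairingE v w : pairing a v w = form11 (T v w).
Proof.
rewrite linear_sum; apply: eq_bigr => p _; rewrite linear_sum;
  apply: eq_bigr => q _ /=.
by rewrite linearZ /= mxE.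
Qed.

Let T_griffiths v w : griffiths_pair (T v v) (T v w) (T w v) (T w w).
Proof.
move=> x y; have := N_ge0 (x *: v + y *: w); congr psd.
rewrite /T !scaler_sumr -!big_split; apply: eq_bigr => p _ /=.
rewrite !scaler_sumr -!big_split; apply: eq_bigr => q _ /=.
rewrite !scalerA -!scalerDl !mxE rmorphD !rmorphM /=; congr (_ *: _); ring.
Qed.

Lemma griffiths_tensor_herm p q : N q p = N p q ^t*.
Proof.
have T_delta i j : T (delta_mx 0 i) (delta_mx 0 j) = N i j.
  rewrite /T (bigD1 i) //= (bigD1 j) //= !big1 ?addr0 =>
    [|k /negPf ki|k /negPf kj].
  - by rewrite !mxE !eqxx conjC1 mul1r scale1r.
  - by rewrite big1 // => l _; rewrite !mxE ki mul0r scale0r.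
  - by rewrite !mxE kj rmorph0 mulr0 scale0r.
by have := griffiths_pair_herm (T_griffiths (delta_mx 0 p) (delta_mx 0 q));
  rewrite !T_delta.
Qed.

Let diag_psd p : exists2 M, psd M & a p p = form11 M.
Proof.
exists (T (delta_mx 0 p) (delta_mx 0 p)); first exact: N_ge0.
by rewrite -pairingE pairing_delta.
Qed.

Lemma chern1_cube_weakly_positive :
  weakly_positive (chern1 a * (chern1 a * chern1 a) - chern1 a * chern2 a).
Proof.
(* The factor cancelled is the successor 8 of 7, the constant of [chern_segre]. *)
apply: (@weakly_positive_cancel 7); rewrite chern_segre.
have sq i j p : weakly_positive (a p p * square_sum a i j).
  have [M pM ->] := diag_psd p.
  rewrite mulr_sumr; apply: weakly_positive_sum => z _.
  rewrite (pairingE (pair_vec i j z) (pair_vec i j z)).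
  exact: (psd3_weakly_positive pM (N_ge0 _) (N_ge0 _)).
by apply: weakly_positive_sum => p _; apply: weakly_positive_sum => ij _;
  exact: sq.
Qed.

Lemma chern12_weakly_positive : weakly_positive (chern1 a * chern2 a - chern3
  a).
Proof.
(* The factor cancelled is 12, the constant of [chern_schur21]. *)
apply: (@weakly_positive_cancel 11); rewrite chern_schur21.
have sc k i j : weakly_positive (schur_sum a k i j).
  (* The factor 2 Theta(e, e) + Theta(f, f) splits into two nonnegative (1, 1)-forms, treated
     separately. *)
  apply: weakly_positive_sum => z _; cbv zeta; rewrite mulrDl.
  rewrite (pairingE (delta_mx 0 k) (delta_mx 0 k)) (pairingE (pair_vec i j z)
    (pair_vec i j z)).
  rewrite (pairingE (delta_mx 0 k) (pair_vec i j z)) (pairingE (pair_vec i j z)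
    (delta_mx 0 k)).
  have gp := T_griffiths (delta_mx 0 k) (pair_vec i j z).
  apply: weakly_positiveD; last exact: (psd_pair_weakly_positive (N_ge0 _) gp).
  rewrite -mulrA natr_scale.
  by apply: weakly_positiveZ; [exact: ler0n|exact: (psd_pair_weakly_positive
    (N_ge0 _) gp)].
by apply: weakly_positive_sum => kij _; exact: sc.
Qed.

End Core.
End WeakPositivity.

Lemma ge0_Cof (R : realType) (c : C R) : 0 <= c -> exists2 t : R,
  0 <= t & c = Cof t.
Proof.
by case: c => x y; rewrite lecE /= => /andP[/eqP -> x0]; exists x.
Qed.

Section PositiveForm.
Variables (R : realType) (n : nat).
Local Notation K := (evenform R n).
Implicit Types (u : K).

Lemma hol_degree_leq (S : {set 'I_(n + n)}) : (hol_degree S <= n)%N.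
Proof.
rewrite hol_degreeE -[X in (_ <= X)%N]card_ord -sum1_card leq_sum // => j _.
by case: (_ \in _).
Qed.

Lemma has_bidegree_gt p q (v : extform R n) : (n < p)%N ->
  has_bidegree p q v -> v = 0.
Proof.
move=> np hv; apply/ffunP => S; rewrite ffunE; apply/eqP;
  apply: contraT => /hv[hp _].
by move: np; rewrite -hp ltnNge hol_degree_leq.
Qed.

Lemma positive_multiple_volume u : positive_multiple u ->
  positive_volume (evenval u).
Proof.
move=> [c /ge0_Cof[t t0 ->] ->]; exists t => //.
by rewrite linearZ /= unit_volumeE.
Qed.

Lemma evenval_cross_rows q (b : 'M[C R]_(q, n)) :
  let beta := wedge_seq (fun j => \sum_l b j l *: dz R l) in
  'i ^+ (q ^ 2)%N *: wedge beta (conj_form beta) = evenval (cross_rows b).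
Proof.
move=> beta; rewrite cross_rows_seq prod_cross size_map size_enum_ord big_map.
suff <- : beta = \prod_(j <- enum 'I_q) lin (row j b) by [].
rewrite enumT; apply: eq_bigr => j _.
by apply: eq_bigr => l _; rewrite mxE.
Qed.

Lemma weakly_positive_form u :
  has_bidegree 3 3 (evenval u) -> econj u = u -> weakly_positive u ->
  positive_form 3 (evenval u).
Proof.
move=> bu ru pu; split=> [//||b beta]; first by rewrite /real_form -[in RHS]ru.
rewrite /beta evenval_cross_rows.
have -> : wedge (evenval u) (evenval (cross_rows b)) = evenval (u * cross_rows
  b).
  by rewrite rmorphM.
(* For n < 3 the difference n - 3 truncates to 0 and [weakly_positive] is void, but then a (3,
   3)-form is 0. *)
apply: positive_multiple_volume; case: (leqP 3 n) => n3; last first.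
  have -> : u = 0 by apply: evenval_inj; rewrite rmorph0;
    exact: has_bidegree_gt bu.
  by rewrite mul0r; exact: positive_multiple0.
by apply: pu; rewrite subnK.
Qed.

End PositiveForm.

(** * Degree, reality and similarity invariance of the Chern polynomials *)

Section ChernBidegree.
Variables (R : realType) (n : nat).
Local Notation K := (evenform R n).

Definition has_degree k (u : K) := has_bidegree k k (evenval u).

Lemma has_degreeD k u v : has_degree k u -> has_degree k v ->
  has_degree k (u + v).
Proof. by rewrite /has_degree rmorphD; exact: has_bidegreeD. Qed.

Lemma has_degreeB k u v : has_degree k u -> has_degree k v ->
  has_degree k (u - v).
Proof.
by rewrite /has_degree rmorphB => hu hv; apply: has_bidegreeD hu (has_bidegreeN
  hv).
Qed.

Lemma has_degreeM k l u v : has_degree k u -> has_degree l v ->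
  has_degree (k + l) (u * v).
Proof. by rewrite /has_degree rmorphM => hu hv;
  exact: (has_bidegreeM hu hv). Qed.

Variable a : 'M[K]_3.
Hypothesis a_degree : forall p q, has_degree 1 (a p q).

Lemma has_degree_chern1 : has_degree 1 (chern1 a).
Proof. exact: has_degreeD (has_degreeD _ _) _. Qed.

Lemma has_degree_minor i j k l : has_degree 2 (a i j * a k l).
Proof. exact: (@has_degreeM 1 1). Qed.

Lemma has_degree_chern2 : has_degree 2 (chern2 a).
Proof.
have h i j : has_degree 2 (minor2 a i j) by apply: has_degreeB;
  exact: has_degree_minor.
exact: has_degreeD (has_degreeD _ _) _.
Qed.

Lemma has_degree_chern3 : has_degree 3 (chern3 a).
Proof.
have h i j k l p q r s t v :
    has_degree 3 (a i j * (a k l * a p q - a r s * a t v)).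
  apply: (@has_degreeM 1 2) => //.
  by apply: has_degreeB; exact: has_degree_minor.
by apply: has_degreeD; [apply: has_degreeB|]; exact: h.
Qed.

End ChernBidegree.

Section ChernConj.
Variables (F : numClosedFieldType) (A : comAlgType F) (g : {rmorphism A ->
  A}) (a : 'M[A]_3).
Hypothesis g_a : forall p q, g (a p q) = a q p.

(** Conjugation transposes a Hermitian matrix of forms, and the Chern polynomials are invariant
    under transposition; this is why they are real. *)
Lemma chern1_conj : g (chern1 a) = chern1 a.
Proof. by rewrite /chern1 !rmorphD /= !g_a. Qed.

Lemma chern2_conj : g (chern2 a) = chern2 a.
Proof. by rewrite /chern2 /minor2 !(rmorphD, rmorphN, rmorphM) /= !g_a;
  ring. Qed.

Lemma chern3_conj : g (chern3 a) = chern3 a.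
Proof. by rewrite /chern3 /minor2 !(rmorphD, rmorphN, rmorphM) /= !g_a;
  ring. Qed.

End ChernConj.

Section ChernInvariance.
Variables (F : numClosedFieldType) (A : comAlgType F).
Implicit Types (a : 'M[A]_3).

Lemma sum_ord3 (V : nmodType) (f : 'I_3 -> V) :
  \sum_(i < 3) f i = f ord0 + f (inord 1) + f ord_max.
Proof.
rewrite !big_ord_recl big_ord0 addr0 addrA; congr (_ + f _ + f _);
  apply: val_inj => //=.
by rewrite inordK.
Qed.

Lemma chern1E a : chern1 a = \tr a.
Proof. by rewrite /mxtrace sum_ord3. Qed.

(** Newton's identity reduces the similarity invariance of c_2 to that of traces. *)
Lemma chern2E a : 2 * chern2 a = \tr a * \tr a - \tr (a *m a).
Proof.
by rewrite /mxtrace !sum_ord3 !mxE !sum_ord3 /chern2 /minor2; ring.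
Qed.

Lemma det_mx22E (b : 'M[A]_2) : \det b = b ord0 ord0 * b ord_max ord_max - b
  ord0 ord_max * b ord_max ord0.
Proof.
rewrite (expand_det_row _ ord0) sum_ord2 /cofactor !det_mx11 !mxE /= expr0
  expr1 mul1r.
rewrite mulN1r mulrN; congr (_ * b _ _ - _ * b _ _); apply: val_inj => //.
Qed.

Lemma chern3E a : chern3 a = \det a.
Proof.
rewrite (expand_det_row _ ord0) sum_ord3 /cofactor !det_mx22E !mxE.
have -> : lift ord0 ord0 = inord 1 :> 'I_3 by apply: val_inj; rewrite /= inordK.
have -> : lift ord0 ord_max = ord_max :> 'I_3 by apply: val_inj.
have -> : lift (inord 1) ord0 = ord0 :> 'I_3 by apply: val_inj;
  rewrite /= inordK.
have -> : lift (inord 1) ord_max = ord_max :> 'I_3 by apply: val_inj;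
  rewrite /= inordK.
have -> : lift ord_max ord0 = ord0 :> 'I_3 by apply: val_inj.
have -> : lift ord_max ord_max = inord 1 :> 'I_3 by apply: val_inj;
  rewrite /= inordK.
by rewrite /chern3 /minor2 inordK //= !addn0 !add0n expr0 expr1 sqrrN expr1n;
  ring.
Qed.

Variables (P P' : 'M[A]_3).
Hypothesis PP' : P *m P' = 1%:M.

Lemma chern1_similar a : chern1 (P' *m a *m P) = chern1 a.
Proof. by rewrite !chern1E mxtrace_mulC mulmxA PP' mul1mx. Qed.

Lemma chern2_similar a : chern2 (P' *m a *m P) = chern2 a.
Proof.
have /(congr1 (fun x => (2%:R^-1 : F) *: x)) : 2 * chern2 (P' *m a *m P) = 2 *
  chern2 a.
  have e : P' *m a *m P *m (P' *m a *m P) = P' *m (a *m a) *m P.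
    by rewrite !mulmxA -(mulmxA _ P P') PP' mulmx1.
  by rewrite !chern2E e -!chern1E !chern1_similar.
have nat2 (x : A) : 2 * x = (2%:R : F) *: x by rewrite scaler_nat mulr_natl.
by rewrite !nat2 !scalerA mulVf ?pnatr_eq0 // !scale1r.
Qed.

Lemma chern3_similar a : chern3 (P' *m a *m P) = chern3 a.
Proof. by rewrite !chern3E !det_mulmx mulrAC -det_mulmx (mulmx1C PP') det1
  mul1r. Qed.

End ChernInvariance.

Section PrincipalMinors.
Variables (F : numClosedFieldType) (A : comAlgType F) (a : 'M[A]_3).

Definition principal_minors k : A :=
  \sum_(I in increasing_maps 3 k) \det (\matrix_(s, t) a (I s) (I t)).

Lemma increasing_mapsP r k (I : {ffun 'I_k -> 'I_r}) :
  reflect (forall s t : 'I_k, (s < t)%N -> (I s < I t)%N) (I \in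
    increasing_maps r k).
Proof.
rewrite inE; apply: (iffP forallP) => h s; first by move=> t;
  exact: (implyP (forallP (h s) t)).
by apply/forallP => t; apply/implyP; exact: h.
Qed.

Lemma principal_minors1 : principal_minors 1 = chern1 a.
Proof.
rewrite /principal_minors (reindex (fun i : 'I_3 => [ffun _ : 'I_1 => i])) /=;
  last first.
  exists (fun I => I ord0) => [i _|I _]; first by rewrite ffunE.
  by apply/ffunP => s; rewrite ffunE [s]ord1; congr (I _); apply: val_inj.
rewrite chern1E; apply: eq_big => [i|i _]; last by rewrite det_mx11 !mxE !ffunE.
by apply/increasing_mapsP => s t; rewrite !ord1.
Qed.

Lemma principal_minors2 : principal_minors 2 = chern2 a.
Proof.
rewrite /principal_minors.
pose f (ij : 'I_3 * 'I_3) := [ffun s : 'I_2 =>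
  if s == ord0 then ij.1 else ij.2].
rewrite (reindex f) /=; last first.
  exists (fun I => (I ord0, I ord_max)) => [[i j] _|I _];
    first by rewrite !ffunE.
  apply/ffunP => s; rewrite ffunE; case: eqP => [->//|/eqP s0] /=; congr (I _).
  by apply: val_inj; case: s s0 => -[|[|]].
under eq_big => [ij|ij _].
  have -> : (f ij \in increasing_maps 3 2) = (ij.1 < ij.2)%N.
    apply/increasing_mapsP/idP => [/(_ ord0 ord_max isT)|lt s t];
      rewrite !ffunE //.
    by case: s t => -[|[|//]] ? [] [|[|//]] ?.
  over.
  rewrite det_mx22E !mxE !ffunE /= -/(minor2 a ij.1 ij.2); over.
rewrite -(pair_big_dep xpredT (fun i j : 'I_3 => (i < j)%N) (minor2 a)) /=.
under eq_bigr => i _ do rewrite big_mkcond sum_ord3.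
by rewrite sum_ord3 !inordK //= !addr0 !add0r.
Qed.

Lemma principal_minors3 : principal_minors 3 = chern3 a.
Proof.
have e : [set [ffun s : 'I_3 => s]]%SET = increasing_maps 3 3.
  apply/finset.setP => I; rewrite inE; apply/eqP/increasing_mapsP => [-> s t|h].
    by rewrite !ffunE.
  have h1 := h ord0 (inord 1); have h2 := h (inord 1) ord_max.
  rewrite !inordK // in h1 h2; move: (h1 isT) (h2 isT) => {h h1 h2} h1 h2.
  apply/ffunP.
  have [] : [/\ I ord0 = 0%N :> nat, I (inord 1) = 1%N :> nat & I ord_max = 2%N
    :> nat].
    by move: h1 h2; case: (I ord0) (I (inord 1)) (I ord_max) =>
      [u ?] [v ?] [w ?] /=; split; lia.
  move=> e0 e1 e2 s; rewrite ffunE; apply: val_inj.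
  case: s => -[|[|[|//]]] ls /=.
  - by rewrite -[RHS]e0; congr (nat_of_ord (I _)); apply: val_inj.
  - by rewrite -[RHS]e1; congr (nat_of_ord (I _)); apply: val_inj;
    rewrite /= inordK.
  - by rewrite -[RHS]e2; congr (nat_of_ord (I _)); apply: val_inj.
rewrite /principal_minors -e big_set1 chern3E; congr (\det _).
by apply/matrixP => s t; rewrite !mxE !ffunE.
Qed.

End PrincipalMinors.

(** A diagonal entry of the exterior power is the Leibniz expansion of a principal minor. *)
Lemma trace_ext_power (R : realType) (n k : nat) (a : 'M[evenform R n]_3) :
  \tr (ext_power k (map_mx (fun u : evenform R n =>
    evenval u : extform R n) a)) =
  evenval (principal_minors a k).
Proof.
rewrite /mxtrace rmorph_sum [RHS]big_enum_val; apply: eq_bigr => p _ /=.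
rewrite mxE rmorph_sum; apply: eq_bigr => sigma _ /=.
have e : evenval (\prod_(i < k) (\matrix_(s, t) a (enum_val p s) (enum_val p
  t)) i (sigma i)) =
  wedge_seq (fun s : 'I_k => map_mx (fun u : evenform R n =>
    evenval u : extform R n) a
     ((enum_val p : {ffun 'I_k -> 'I_3}) s) ((enum_val p : {ffun 'I_k ->
       'I_3}) (sigma s))).
  by rewrite rmorph_prod; apply: eq_bigr => s _; rewrite !mxE.
rewrite -e; case: (odd_perm sigma); rewrite ?expr1 ?expr0.
  by rewrite scaleN1r mulN1r.
by rewrite scale1r mul1r.
Qed.

(** * The curvature in local coordinates *)

Lemma sum_delta2 (V : nzRingType) n (f : 'I_n -> 'I_n -> V) p q :
  \sum_i \sum_j f i j * ((i == p) && (j == q))%:R = f p q.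
Proof.
rewrite (bigD1 p) //= (bigD1 q) //= !big1 ?addr0 => [|i /negPf ip|j /negPf jq].
- by rewrite !eqxx mulr1.
- by rewrite big1 // => j _; rewrite ip mulr0.
- by rewrite jq andbF mulr0.
Qed.

Section Bidegree.
Local Open Scope sesquilinear_scope.
Variables (R : realType) (n : nat).
Implicit Types (u : 'rV[C R]_n -> extform R n) (z v : 'rV[C R]_n).

Lemma rderive0 v z : rderive (fun=> 0 : C R) v z = 0.
Proof.
by rewrite /rderive; congr Complex; rewrite -(derive1_cst (0 : R) 0).
Qed.

Lemma dz_deriv0 j z : dz_deriv j (fun=> 0 : C R) z = 0.
Proof. by rewrite /dz_deriv !rderive0 mulr0 subr0 mulr0. Qed.

Lemma dzbar_deriv0 j z : dzbar_deriv j (fun=> 0 : C R) z = 0.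
Proof. by rewrite /dzbar_deriv !rderive0 mulr0 addr0 mulr0. Qed.

Lemma has_bidegree_del p q u z :
  (forall w, has_bidegree p q (u w)) -> has_bidegree p.+1 q (del u z).
Proof.
move=> hu; apply: (@has_bidegree_sum R n) => j _.
apply: (@has_bidegreeM R n 1 0 p q (dz R j)); first exact: has_bidegree_dz.
move=> S; rewrite ffunE => h; apply: contrapT => nS; case/eqP: h.
rewrite -[RHS](dz_deriv0 j z); congr (dz_deriv _ _ z); apply/funext => w.
by apply/eqP; apply: contraT => /hu.
Qed.

Lemma has_bidegree_delbar p q u z :
  (forall w, has_bidegree p q (u w)) -> has_bidegree p q.+1 (delbar u z).
Proof.
move=> hu; apply: (@has_bidegree_sum R n) => j _.
apply: (@has_bidegreeM R n 0 1 p q (dzbar R j)).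
  by rewrite -conj_dz; apply: (has_bidegree_conj (@has_bidegree_dz R n j)).
move=> S; rewrite ffunE => h; apply: contrapT => nS; case/eqP: h.
rewrite -[RHS](dzbar_deriv0 j z); congr (dzbar_deriv _ _ z); apply/funext => w.
by apply/eqP; apply: contraT => /hu.
Qed.

Lemma has_bidegree_scalar (c : C R) : has_bidegree 0 0 (scalar_form n c).
Proof.
move=> S; rewrite ffunE; case: ifP => [/eqP -> _|_ /eqP //].
by rewrite hol_degreeE antihol_degreeE !big1 // => j _; rewrite inE.
Qed.

Definition pair_set (p q : 'I_n) : {set 'I_(n + n)} := [set lshift n p;
  rshift n q]%SET.

Lemma mem_pair_setl p q j : (lshift n j \in pair_set p q) = (j == p).
Proof. by rewrite !inE eq_lrshift orbF (inj_eq (@lshift_inj _ _)). Qed.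

Lemma mem_pair_setr p q j : (rshift n j \in pair_set p q) = (j == q).
Proof. by rewrite !inE eq_rlshift (inj_eq (@rshift_inj _ _)). Qed.

Lemma pair_set_inj p q p' q' : (pair_set p q == pair_set p' q') = (p == p') &&
  (q == q').
Proof.
apply/eqP/andP => [e|[/eqP -> /eqP -> //]].
by rewrite -(mem_pair_setl p' q') -e mem_pair_setl eqxx -(mem_pair_setr p' q')
  -e mem_pair_setr eqxx.
Qed.

Lemma dz_dzbar p q : (dz R p : exterior R n) * dzbar R q = basis_form R
  (pair_set p q).
Proof.
rewrite -[pair_set p q]/([set lshift n p]%SET :|: [set rshift n q]%SET)
  -basis_formM //.
  by rewrite disjoints1 inE eq_lrshift.
apply: inversions_eq0 => x y; rewrite !inE => /eqP -> /eqP -> /=.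
by rewrite ltnW // (leq_trans (ltn_ord p)) // leq_addr.
Qed.

Lemma bidegree11_pair_set (S : {set 'I_(n + n)}) :
  hol_degree S = 1%N -> antihol_degree S = 1%N -> exists p q, S = pair_set p q.
Proof.
move=> /eqP/cards1P[p hp] /eqP/cards1P[q hq]; exists p, q.
apply/finset.setP => x; rewrite -(splitK x); case: (fintype.split x) => j /=.
  by rewrite mem_pair_setl; move/finset.setP/(_ j): hp; rewrite !inE.
by rewrite mem_pair_setr; move/finset.setP/(_ j): hq; rewrite !inE.
Qed.

Definition coef11 (u : extform R n) : 'M[C R]_n := \matrix_(p,
  q) u (pair_set p q).

Lemma evenval_form11 (N : 'M[C R]_n) :
  evenval (form11 N) = 'i *: (\sum_p \sum_q N p q *: (basis_form R (pair_set p
    q))).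
Proof.
rewrite rmorph_sum scaler_sumr; apply: eq_bigr => p _ /=.
rewrite rmorph_sum scaler_sumr; apply: eq_bigr => q _ /=.
rewrite linearZ /= !lin_delta [conjW _]conj_dz -dz_dzbar scalerA mulrC -scalerA.
by [].
Qed.

(** [form11] already contains the factor i, so that c = 1 / (2 pi) produces the normalization i / (2
    pi) of the Chern forms. *)
Lemma coef11P (u : extform R n) (c : C R) : has_bidegree 1 1 u ->
  evenval (form11 (c *: coef11 u)) = ('i * c) *: u :> extform R n.
Proof.
move=> hu; rewrite evenval_form11 -scalerA; congr (_ *: _).
apply/ffunP => S; rewrite sum_ffunE [RHS]ffunE.
under eq_bigr => p _ do rewrite sum_ffunE.
have [u0|uS] := eqVneq (u S) 0.
  rewrite u0 scaler0 big1 // => p _; rewrite big1 // => q _.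
  rewrite !ffunE !mxE; case: eqP => [<-|_]; last by rewrite scaler0.
  by rewrite u0 mulr0 scale0r.
have [p [q eS]] := bidegree11_pair_set (hu S uS).1 (hu S uS).2.
transitivity (\sum_p' \sum_q' (c * u (pair_set p' q')) * ((p' == p) && (q' ==
  q))%:R : C R).
  apply: eq_bigr => p' _; apply: eq_bigr => q' _.
  by rewrite !ffunE !mxE eS pair_set_inj [p == _]eq_sym [q == _]eq_sym.
by rewrite sum_delta2 eS.
Qed.

(** Only the pairs of some dz_p with some dzbar_q contribute, because one argument is of type (1, 0)
    and the other of type (0, 1). *)
Lemma eval_conjE (u : extform R n) (tau : 'rV[C R]_n) :
  eval_conj u tau = (tau *m coef11 u *m tau ^t*) 0 0.
Proof.
rewrite quadE /eval_conj /eval2 big_split_ord /= [X in _ + X]big1 ?addr0.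
  apply: eq_bigr => p _; rewrite big_mkcond big_split_ord /= big1 ?add0r.
    apply: eq_bigr => q _; rewrite (leq_trans (ltn_ord p)) ?leq_addr //.
    by rewrite !row_mxEl !row_mxEr !mxE mul0r subr0 mulrC.
  by move=> q _; case: ifP => // _; rewrite !row_mxEl !mxE !mulr0 subr0 mulr0.
move=> p _; rewrite big_mkcond big_split_ord /= !big1 ?addr0 // => q _.
  by case: ifP => // _; rewrite !row_mxEr !mxE !mul0r subr0 mulr0.
by rewrite ltnNge ltnW //= (leq_trans (ltn_ord q)) // leq_addr.
Qed.

End Bidegree.

Section Orthonormalize.
Local Open Scope sesquilinear_scope.
Variables (R : realType) (n : nat).

(** The rows of Q^-1 are the coordinates of an orthonormal frame, in which the curvature matrix is
    Q^-1 T Q. A vector with coordinates w there has the coordinates v = w Q^-1 in the old frame. *)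
Lemma psd_orthonormal (H Q : 'M[C R]_3) (T : 'I_3 -> 'I_3 -> 'M[C R]_n) :
  H = Q *m (Q ^t*) -> Q \in unitmx ->
  (forall (v : 'rV[C R]_3) (tau : 'rV[C R]_n),
    0 <= \sum_j \sum_l (v 0 j * (\sum_k H l k * (v 0 k)^*)) *
           (tau *m T j l *m tau ^t*) 0 0) ->
  let N p q := \sum_j \sum_l (invmx Q p j * Q l q) *: T j l in
  forall w : 'rV[C R]_3, psd (\sum_p \sum_q (w 0 p * (w 0 q)^*) *: N p q).
Proof.
move=> HQ uQ h N w tau; have := h (w *m invmx Q) tau; congr (0 <= _).
have hv l : \sum_k H l k * ((w *m invmx Q) 0 k)^* = \sum_q Q l q * (w 0 q)^*.
  transitivity ((H *m (w *m invmx Q) ^t*) l 0).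
    by rewrite mxE; apply: eq_bigr => k _; rewrite !mxE.
  rewrite HQ trmx_mul map_mxM !mulmxA -(mulmxA Q) -map_mxM -trmx_mul mulVmx //.
  rewrite trmx1 map_mx1 mulmx1 mxE; apply: eq_bigr => k _; by rewrite !mxE.
pose q4 p q j l := w 0 p * (w 0 q)^* * (invmx Q p j * Q l q) * (tau *m T j l *m
  tau ^t*) 0 0.
transitivity (\sum_p \sum_q \sum_j \sum_l q4 p q j l).
  under eq_bigr => j _ do under eq_bigr => l _ do rewrite hv mxE.
  under [RHS]eq_bigr => p _ do under eq_bigr => q _ do rewrite exchange_big /=.
  under [RHS]eq_bigr => p _ do rewrite exchange_big /=.
  rewrite [RHS]exchange_big /=.
  rewrite [LHS]exchange_big /=; apply: eq_bigr => l _.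
  under [RHS]eq_bigr => p _ do rewrite exchange_big /=.
  rewrite [RHS]exchange_big /=; apply: eq_bigr => j _.
  rewrite !mulr_suml; apply: eq_bigr => p _.
  rewrite mulr_sumr mulr_suml; apply: eq_bigr => q _; rewrite /q4; ring.
have lin4 (I : finType) (f : I -> 'M[C R]_n) :
    (tau *m (\sum_i f i) *m tau ^t*) 0 0 = \sum_i (tau *m f i *m tau ^t*) 0 0.
  by rewrite mulmx_sumr mulmx_suml summxE.
have linZ c (f : 'M[C R]_n) : (tau *m (c *: f) *m tau ^t*) 0 0 = c * (tau *m f
  *m tau ^t*) 0 0.
  by rewrite -scalemxAr -scalemxAl mxE.
rewrite lin4; apply: eq_bigr => p _; rewrite lin4; apply: eq_bigr => q _.
rewrite linZ /N lin4 mulr_sumr; apply: eq_bigr => j _.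
rewrite lin4 mulr_sumr; apply: eq_bigr => l _; rewrite linZ /q4; ring.
Qed.

End Orthonormalize.

Lemma has_degree_form11 (R : realType) (n : nat) (N : 'M[C R]_n) : has_degree 1
  (form11 N).
Proof.
rewrite /has_degree rmorph_sum; apply: has_bidegree_sum => p _ /=.
rewrite rmorph_sum; apply: has_bidegree_sum => q _ /=.
apply: (@has_bidegreeZ R n 1 1 (N p q) (evenval (cross (delta_mx 0 p) (delta_mx
  0 q)))).
exact: has_bidegree_cross.
Qed.

(** * The pointwise inequalities *)

Section Pointwise.
Local Open Scope sesquilinear_scope.
Variables (R : realType) (n : nat) (X : complex_manifold R n).
Variables (E : hol_bundle X 3) (h : hermitian_metric E).
Variables (i : cm_index X) (a : frame_index E) (x : X).
Hypothesis x_dom : local_dom i a x.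
Local Notation K := (evenform R n).

Let H := gram h i a (chart_map (cm_chart i) x).
Let e (j : 'I_3) : E x := tnth (frame a x) j.
Let vec (t : 'rV[C R]_3) : E x := \sum_j t 0 j *: e j.

Let gramE j k : H j k = h x (e j) (e k).
Proof. by rewrite mxE chart_mapK //; case: x_dom. Qed.

Let coord_vec t j : coord (frame a x) j (vec t) = t 0 j.
Proof.
have fr : free (frame a x) by apply: (basis_free (frame_basis _)); case: x_dom.
rewrite /vec -(coord_sum_free (fun j => t 0 j) j fr); congr coord.
by apply: eq_bigr => l _; rewrite /e (tnth_nth 0).
Qed.

Let herm_vec j t : h x (e j) (vec t) = \sum_k H j k * (t 0 k)^*.
Proof.
by rewrite /vec linear_sumr; apply: eq_bigr => k _;
  rewrite linearZr_LR gramE mulrC.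
Qed.

Let gram_quad t : (t *m H *m t ^t*) 0 0 = h x (vec t) (vec t).
Proof.
rewrite quadE {1}/vec linear_sumlz; apply: eq_bigr => j _.
rewrite linearZl_LR /= herm_vec mulr_sumr; apply: eq_bigr => k _; ring.
Qed.

Let gram_psd : psd H.
Proof.
move=> t; rewrite gram_quad; have [->|v0] := eqVneq (vec t) 0;
  first by rewrite linear0l.
exact/ltW/neq0_dnorm_gt0.
Qed.

(** A kernel vector of the Gram matrix would give a vector of norm 0, and the metric is definite. *)
Lemma gram_unit : gram h i a (chart_map (cm_chart i) x) \in unitmx.
Proof.
rewrite -/H -row_free_unit -kermx_eq0; apply: contraT =>
  /rowV0Pn[t /sub_kermxP tH].
have : h x (vec t) (vec t) = 0 by rewrite -gram_quad tH mul0mx mxE.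
move=> hv; have v0 : vec t = 0.
  by apply/eqP; apply: contraT => /(neq0_dnorm_gt0 (s := h x)); rewrite hv ltxx.
suff -> : t = 0 by rewrite eqxx.
by apply/rowP => j; rewrite -coord_vec v0 linear0 mxE.
Qed.

Let c : C R := (Cof (2 * pi))^-1.

Let c_ge0 : 0 <= c.
Proof. by rewrite invr_ge0 lecE /= eqxx mulr_ge0 // pi_ge0. Qed.

Let T (j l : 'I_3) : 'M[C R]_n := c *: coef11 (curvature h i a x j l).

Definition curvature_form : 'M[K]_3 :=
  \matrix_(j, l) form11 ((Cof (2 * pi))^-1 *: coef11 (curvature h i a x j l)).

Lemma has_bidegree_curvature j l : has_bidegree 1 1 (curvature h i a x j l).
Proof.
rewrite mxE; apply: has_bidegree_delbar => w; apply: (@has_bidegree_sum R n) =>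
  m _.
apply: (@has_bidegreeZ R n); apply: has_bidegree_del => y.
exact: has_bidegree_scalar.
Qed.

Lemma chern_formE k :
  chern_form h k i a x = evenval (principal_minors curvature_form k).
Proof.
rewrite /chern_form -trace_ext_power; congr (\tr (ext_power k _)).
apply/matrixP => j l; rewrite mxE [RHS]mxE [curvature_form j l]mxE.
by rewrite coef11P //; exact: has_bidegree_curvature.
Qed.

Hypothesis hE : griffiths_semipositive h.

Let griffiths_coef (v : 'rV[C R]_3) (tau : 'rV[C R]_n) :
  0 <= \sum_j \sum_l (v 0 j * (\sum_k H l k * (v 0 k)^*)) *
    (tau *m T j l *m tau ^t*) 0 0.
Proof.
have := hE x_dom (vec v) tau; rewrite eval_conjE => /(mulr_ge0 c_ge0).
congr (0 <= _).
have linZ b (f : 'M[C R]_n) : (tau *m (b *: f) *m tau ^t*) 0 0 = b * (tau *m f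
  *m tau ^t*) 0 0.
  by rewrite -scalemxAr -scalemxAl mxE.
have lin4 (I : finType) (f : I -> 'M[C R]_n) :
    (tau *m (\sum_i f i) *m tau ^t*) 0 0 = \sum_i (tau *m f i *m tau ^t*) 0 0.
  by rewrite mulmx_sumr mulmx_suml summxE.
have -> : coef11 (curvature_pairing h i a (vec v)) = \sum_j \sum_l
    (v 0 j * (\sum_k H l k * (v 0 k)^*)) *: coef11 (curvature h i a x j l).
  apply/matrixP => p q; rewrite mxE summxE /curvature_pairing sum_ffunE.
  apply: eq_bigr => j _; rewrite summxE sum_ffunE; apply: eq_bigr => l _.
  by rewrite !ffunE !mxE coord_vec herm_vec.
rewrite lin4 mulr_sumr; apply: eq_bigr => j _; rewrite lin4 mulr_sumr.
by apply: eq_bigr => l _; rewrite linZ /T linZ; exact: mulrCA.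
Qed.

(** Factoring the Gram matrix as Q times its adjoint gives an orthonormal frame. The curvature
    matrix is conjugated by Q, which leaves the Chern polynomials unchanged. *)
Lemma chern_orthonormal : exists N : 'I_3 -> 'I_3 -> 'M[C R]_n,
  (forall w : 'rV[C R]_3, psd (\sum_p \sum_q (w 0 p * (w 0 q)^*) *: N p q)) /\
  let b : 'M[K]_3 := \matrix_(p, q) form11 (N p q) in
  [/\ chern1 curvature_form = chern1 b, chern2 curvature_form = chern2 b
    & chern3 curvature_form = chern3 b].
Proof.
have [Q HQ] := psd_factor gram_psd.
have uQ : Q \in unitmx.
  by move: gram_unit; rewrite -/H HQ unitmx_mul => /andP[].
have pN := psd_orthonormal HQ uQ griffiths_coef.
eexists; split; first exact: pN.
set b := (X in let b := X in _).
pose Qa := map_mx (in_alg K) Q; pose Qi := map_mx (in_alg K) (invmx Q).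
have QQ : Qa *m Qi = 1%:M by rewrite -map_mxM mulmxV // map_mx1.
have -> : b = Qi *m curvature_form *m Qa.
  apply/matrixP => p q; rewrite mxE linear_sum /=.
  under eq_bigr => j _ do rewrite linear_sum /=.
  rewrite exchange_big [RHS]mxE /=; apply: eq_bigr => l _.
  rewrite mxE mulr_suml; apply: eq_bigr => j _.
  rewrite linearZ ![in RHS]mxE /= -scalerAl mul1r -scalerAr mulr1 scalerA mulrC.
  by rewrite /T [curvature _ _ _ _ _ _]mxE.
cbv zeta; split; [exact/esym/(chern1_similar QQ)|exact/esym/(chern2_similar
  QQ)|exact/esym/(chern3_similar QQ)].
Qed.

Lemma chern_form_positive :
  let c k := chern_form h k i a x in
  positive_form 3 (wedge (c 1%N) (wedge (c 1%N) (c 1%N)) - wedge (c 1%N) (c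
    2%N)) /\
  positive_form 3 (wedge (c 1%N) (c 2%N) - c 3%N).
Proof.
have [N [pN /= [e1 e2 e3]]] := chern_orthonormal.
cbv zeta; rewrite !chern_formE principal_minors1 principal_minors2
  principal_minors3.
rewrite e1 e2 e3; set b : 'M[K]_3 := \matrix_(p, q) _.
have -> : wedge (evenval (chern1 b)) (wedge (evenval (chern1 b)) (evenval
  (chern1 b))) -
  wedge (evenval (chern1 b)) (evenval (chern2 b)) =
  evenval (chern1 b * (chern1 b * chern1 b) - chern1 b * chern2 b) :> extform R
    n.
  by rewrite rmorphB !rmorphM.
have -> : wedge (evenval (chern1 b)) (evenval (chern2 b)) - evenval (chern3 b) =
  evenval (chern1 b * chern2 b - chern3 b) :> extform R n.
  by rewrite rmorphB !rmorphM.
have b11 p q : has_degree 1 (b p q).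
  rewrite mxE; exact: has_degree_form11.
have bconj p q : econj (b p q) = b q p.
  by rewrite !mxE econj_form11 -(griffiths_tensor_herm pN).
split; apply: weakly_positive_form.
- apply: has_degreeB.
    apply: (@has_degreeM _ _ 1 2); first exact: has_degree_chern1.
    by apply: (@has_degreeM _ _ 1 1); exact: has_degree_chern1.
  by apply: (@has_degreeM _ _ 1 2); [exact: has_degree_chern1|exact:
    has_degree_chern2].
- by rewrite rmorphB !rmorphM /= (chern1_conj bconj) (chern2_conj bconj).
- exact: chern1_cube_weakly_positive.
- apply: has_degreeB; last exact: has_degree_chern3.
  by apply: (@has_degreeM _ _ 1 2); [exact: has_degree_chern1|exact:
    has_degree_chern2].
- by rewrite rmorphB !rmorphM /= (chern1_conj bconj) (chern2_conj bconj)
  (chern3_conj bconj).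
- exact: chern12_weakly_positive.
Qed.

End Pointwise.

(** * Iterated integrals *)

Section UnmeasurableIntegral.
Variable R : realType.
Local Notation mu := (@lebesgue_measure R).
Implicit Types (f g : R -> R) (M : R).

Local Open Scope ereal_scope.

(* The inner integrals need not be known to be measurable: the integral of a
   nonnegative function is a supremum over simple functions. *)
Lemma ge0_integral_monotone (u v : R -> \bar R) :
  (forall x, 0 <= u x) -> (forall x, u x <= v x) ->
  \int[mu]_x u x <= \int[mu]_x v x.
Proof.
move=> u0 uv; have v0 x : 0 <= v x by exact: le_trans (u0 x) (uv x).
rewrite !ge0_integralTE //; apply: ereal_sup_le => _ [s su <-].
by exists s => //= x; apply: le_trans (su x) (uv x).
Qed.

(** A single constant bounds the values and the support, which makes the integrals of both parts
    finite. *)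
Definition boxed1 M f := (forall x, `|f x| <= M)%R /\ (forall x,
  (M < `|x|)%R -> f x = 0%R).

Lemma boxed1_ge0 M f : boxed1 M f -> (0 <= M)%R.
Proof. by move=> [h _]; exact: le_trans (normr_ge0 _) (h 0%R). Qed.

Lemma boxed_integral_le M (u : R -> \bar R) : (0 <= M)%R ->
  (forall x, 0 <= u x <= M%:E) -> (forall x, (M < `|x|)%R -> u x = 0) ->
  0 <= \int[mu]_x u x <= (M * (M + M))%:E.
Proof.
move=> M0 uM u0; rewrite integral_ge0 /=; last by move=> x _; case/andP: (uM x).
have D : \int[mu]_(x in `[(- M)%R, M]) (cst M%:E) x <= (M * (M + M))%:E.
  rewrite integral_cst //= lebesgue_measure_itv /= lte_fin.
  case: ifP => _; last by rewrite mule0 lee_fin mulr_ge0 // addr_ge0.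
  by rewrite -EFinB -EFinM opprK.
apply: (le_trans _ D); rewrite [leRHS]integral_mkcond.
apply: ge0_integral_monotone => x; first by case/andP: (uM x).
rewrite patchE; case: ifP => [_|]; first by case/andP: (uM x).
move/negbT; rewrite notin_setE /= in_itv /= => /negP.
by rewrite -ler_norml -ltNge => /u0 ->.
Qed.

Lemma boxed_parts M f : boxed1 M f ->
  (0 <= \int[mu]_x ((EFin \o f)^\+ x) <= (M * (M + M))%:E) /\
  (0 <= \int[mu]_x ((EFin \o f)^\- x) <= (M * (M + M))%:E).
Proof.
move=> bf; have M0 := boxed1_ge0 bf; case: bf => fM f0.
split; apply: boxed_integral_le => // x.
- rewrite funepos_ge0 /= funeposE /= ge_max !lee_fin M0 andbT.
  by apply: le_trans (fM x); exact: ler_norm.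
- by move=> /f0 e; rewrite funeposE /= e maxxx.
- rewrite funeneg_ge0 /= funenegE /= ge_max !lee_fin M0 andbT.
  by apply: le_trans (fM x); rewrite -normrN; exact: ler_norm.
- by move=> /f0 e; rewrite funenegE /= e oppr0 maxxx.
Qed.

(** As both parts have finite integrals, [fine] discards nothing, and monotonicity can be checked on
    each part. *)
Lemma Rintegral_parts M f : boxed1 M f ->
  exists p q : R, [/\ (0 <= p <= M * (M + M))%R, (0 <= q <= M * (M + M))%R,
    \int[mu]_x ((EFin \o f)^\+ x) = p%:E, \int[mu]_x ((EFin \o f)^\- x) = q%:E &
    Rintegral mu setT f = (p - q)%R].
Proof.
move=> /boxed_parts[/andP[p0 pM] /andP[q0 qM]].
have fp : \int[mu]_x ((EFin \o f)^\+ x) \is a fin_num.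
  by rewrite ge0_fin_numE // (le_lt_trans pM) ?ltry.
have fq : \int[mu]_x ((EFin \o f)^\- x) \is a fin_num.
  by rewrite ge0_fin_numE // (le_lt_trans qM) ?ltry.
exists (fine (\int[mu]_x ((EFin \o f)^\+ x))),
  (fine (\int[mu]_x ((EFin \o f)^\- x))).
split; rewrite -?lee_fin ?fineK ?p0 ?q0 //.
by rewrite /Rintegral integralE fineB.
Qed.

Local Close Scope ereal_scope.

Lemma Rintegral_bound M f : boxed1 M f -> `|Rintegral mu setT f| <= M * (M + M).
Proof.
move=> /Rintegral_parts[p [q [/andP[p0 pM] /andP[q0 qM] _ _ ->]]].
rewrite ler_norml; lra.
Qed.

Lemma Rintegral_monotone M f g : boxed1 M f -> boxed1 M g -> (forall x,
  f x <= g x) ->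
  Rintegral mu setT f <= Rintegral mu setT g.
Proof.
move=> bf bg fg.
have [p [q [_ _ ep eq ->]]] := Rintegral_parts bf.
have [p' [q' [_ _ ep' eq' ->]]] := Rintegral_parts bg.
apply: lerB; rewrite -lee_fin.
  rewrite -ep -ep'; apply: ge0_integral_monotone => x; first exact: funepos_ge0.
  by apply: (@funepos_le _ _ setT) => [y _|]; rewrite ?in_setT //= lee_fin.
rewrite -eq -eq'; apply: ge0_integral_monotone => x; first exact: funeneg_ge0.
by apply: (@funeneg_le _ _ setT) => [y _|]; rewrite ?in_setT //= lee_fin.
Qed.

End UnmeasurableIntegral.

Section RealIntegral.
Variable R : realType.

Definition boxed n M (f : 'rV[C R]_n -> R) :=
  (forall z, `|f z| <= M) /\
  (forall z, f z != 0 -> forall j, `|complex.Re (z 0 j)| <= M /\ `|complex.Im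
    (z 0 j)| <= M).

Lemma real_integral0 n : real_integral (fun _ : 'rV[C R]_n => 0) = 0 :> R.
Proof.
elim: n => [//|n ih] /=; rewrite ih.
have Rint0 : Rintegral (@lebesgue_measure R) setT (fun=> 0) = 0 :> R.
  by rewrite /Rintegral integral0.
by rewrite !Rint0.
Qed.

Lemma boxed_slice n M (f : 'rV[C R]_n.+1 -> R) x y : boxed M f ->
  boxed M (fun w : 'rV[C R]_n => f (row_mx (const_mx (Complex x y : C R)) w :
    'rV[C R]_(1 + n))).
Proof.
move=> [fM f0]; split=> [z|z /f0 h j]; first exact: fM.
by rewrite -(row_mxEr (const_mx (Complex x y : C R) : 'rV_1) z 0 j); exact: h.
Qed.

Lemma boxed_slice0 n M (f : 'rV[C R]_n.+1 -> R) x y : boxed M f ->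
  (M < `|x|) || (M < `|y|) ->
  (fun w : 'rV[C R]_n => f (row_mx (const_mx (Complex x y : C R)) w : 'rV[C
    R]_(1 + n))) = fun=> 0.
Proof.
move=> [fM f0] h; apply/funext => w; apply/eqP;
  apply: contraT => /f0/(_ (lshift n (ord0 : 'I_1))).
set z := row_mx _ _; have -> : z 0 (lshift n (ord0 : 'I_1)) = Complex x y.
  by rewrite row_mxEl mxE.
by rewrite /= !leNgt => -[nx ny]; case/orP: h => h; [move: nx|move: ny];
  rewrite h.
Qed.

(** The bound is uniform in f, so that it applies to all slices at once; M <= M' lets M' bound their
    supports as well. *)
Lemma real_integral_bound n M : 0 <= M -> exists2 M', M <= M' &
  forall f : 'rV[C R]_n -> R, boxed M f -> `|real_integral f| <= M'.
Proof.
move=> M0; elim: n => [|n [M1 MM1 h1]]; first by exists M => // f [h _];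
  exact: h.
have M10 : 0 <= M1 by exact: le_trans MM1.
(* M1 * (M1 + M1) bounds the integral over y, and the summand M1 keeps M2 above M, hence valid for
   the support. *)
pose M2 := M1 + M1 * (M1 + M1).
have q1 : 0 <= M1 * (M1 + M1) by rewrite mulr_ge0 // addr_ge0.
have M20 : 0 <= M2 by rewrite addr_ge0.
have q2 : 0 <= M2 * (M2 + M2) by rewrite mulr_ge0 // addr_ge0.
exists (M + M2 * (M2 + M2)); first by rewrite lerDl.
move=> f bf /=; apply: le_trans (_ : M2 * (M2 + M2) <= _);
  last by rewrite lerDr.
apply: Rintegral_bound; split=> [x|x Mx].
  apply: le_trans (_ : M1 * (M1 + M1) <= _); last by rewrite lerDr.
  apply: Rintegral_bound; split=> [y|y My]; first exact/h1/boxed_slice.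
  by rewrite (boxed_slice0 bf) ?real_integral0 // (le_lt_trans MM1 My) orbT.
have Mx' : M < `|x| by apply: le_lt_trans Mx; apply: le_trans MM1 _;
  rewrite lerDl.
rewrite [X in Rintegral _ _ X](_ : _ = fun=> 0).
  by rewrite /Rintegral integral0.
by apply/funext => y; rewrite (boxed_slice0 bf) ?real_integral0 // Mx'.
Qed.

Lemma real_integral_monotone n M (f g : 'rV[C R]_n -> R) :
  boxed M f -> boxed M g -> (forall z, f z <= g z) ->
    real_integral f <= real_integral g.
Proof.
elim: n => [|n ih] in f g *; first by move=> _ _; exact.
move=> bf bg fg /=.
have M0 : 0 <= M by case: bf => h _; exact: le_trans (normr_ge0 _) (h 0).
have [M1 MM1 h1] := real_integral_bound n M0.
have M10 : 0 <= M1 by exact: le_trans MM1.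
pose M2 := M1 + M1 * (M1 + M1).
have q1 : 0 <= M1 * (M1 + M1) by rewrite mulr_ge0 // addr_ge0.
have in1 k x : boxed M k -> boxed1 M1 (fun y =>
  real_integral (fun w : 'rV[C R]_n =>
    k (row_mx (const_mx (Complex x y : C R)) w : 'rV[C R]_(1 + n)))).
  move=> bk; split=> [y|y My]; first exact/h1/boxed_slice.
  by rewrite (boxed_slice0 bk) ?real_integral0 // (le_lt_trans MM1 My) orbT.
have in2 k : boxed M k -> boxed1 M2 (fun x => Rintegral lebesgue_measure setT
  (fun y => real_integral (fun w : 'rV[C R]_n =>
    k (row_mx (const_mx (Complex x y : C R)) w : 'rV[C R]_(1 + n))))).
  move=> bk; split=> [x|x Mx].
    apply: le_trans (_ : M1 * (M1 + M1) <= _); last by rewrite lerDr.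
    exact/Rintegral_bound/in1.
  have Mx' : M < `|x| by apply: le_lt_trans Mx; apply: le_trans MM1 _;
    rewrite lerDl.
  rewrite [X in Rintegral _ _ X](_ : _ = fun=> 0).
    by rewrite /Rintegral integral0.
  by apply/funext => y; rewrite (boxed_slice0 bk) ?real_integral0 // Mx'.
apply: Rintegral_monotone (in2 f bf) (in2 g bg) _ => x.
apply: Rintegral_monotone (in1 f x bf) (in1 g x bg) _ => y.
by apply: ih => *; [exact: boxed_slice|exact: boxed_slice|exact: fg].
Qed.

End RealIntegral.

(** * Regularity of the curvature *)

Local Open Scope classical_set_scope.

Section C1.
Variables (R : realType) (n : nat) (U : set 'rV[C R]_n).
Hypothesis U_open : open U.
Implicit Types (f g : 'rV[C R]_n -> C R) (v z : 'rV[C R]_n).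

Definition continuous_on f := forall z, U z -> f @ z --> f z.

Lemma continuous_on_eq f g : (forall z, U z -> f z = g z) -> continuous_on f ->
  continuous_on g.
Proof.
move=> fg cf z Uz; rewrite -(fg z Uz); apply: cvg_trans (cf z Uz).
apply: (@near_eq_cvg _ _ (nbhs z) (nbhs_filter z));
  have hU : nbhs z U by exact: open_nbhs_nbhs.
exact: (filterS (fun w Uw => fg w Uw) hU).
Qed.

Lemma continuous_onD f g : continuous_on f -> continuous_on g ->
  continuous_on (fun z => f z + g z).
Proof. by move=> cf cg z Uz; exact: (cvgD (cf z Uz) (cg z Uz)). Qed.

Lemma continuous_onM f g : continuous_on f -> continuous_on g ->
  continuous_on (fun z => f z * g z).
Proof. by move=> cf cg z Uz; exact: (cvgM (cf z Uz) (cg z Uz)). Qed.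

Lemma continuous_onV f : (forall z, U z -> f z != 0) -> continuous_on f ->
  continuous_on (fun z => (f z)^-1).
Proof. by move=> f0 cf z Uz; exact: (cvgV (f0 z Uz) (cf z Uz)). Qed.

Lemma continuous_on_cst (c : C R) : continuous_on (fun=> c).
Proof. by move=> z _; exact: cst_continuous. Qed.

Lemma continuous_on_sum (I : Type) (r : seq I) (P : pred I) (F : I ->
  'rV[C R]_n -> C R) :
  (forall i, P i -> continuous_on (F i)) -> continuous_on (fun z =>
    \sum_(i <- r | P i) F i z).
Proof.
move=> h; elim: r => [|i r ih].
  have -> : (fun z => \sum_(i <- [::] | P i) F i z) = fun=>
    0 by apply/funext => z; rewrite big_nil.
  exact: continuous_on_cst.
have [Pi|nPi] := boolP (P i).
  have -> : (fun z => \sum_(j <- i :: r | P j) F j z) = fun z =>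
    F i z + \sum_(j <- r | P j) F j z.
    by apply/funext => z; rewrite big_cons Pi.
  exact: (continuous_onD (h i Pi) ih).
have -> // : (fun z => \sum_(j <- i :: r | P j) F j z) = fun z =>
  \sum_(j <- r | P j) F j z.
by apply/funext => z; rewrite big_cons (negPf nPi).
Qed.

Definition has_rderiv f v z (d : C R) :=
  is_derive (0 : R) (1 : R) (re_line f z v) (complex.Re d) /\
  is_derive (0 : R) (1 : R) (im_line f z v) (complex.Im d).

Lemma has_rderivP f v z : rderivable f v z -> has_rderiv f v z (rderive f v z).
Proof.
move=> [h1 h2]; rewrite /rderive !derive1E; split; exact: derivableP.
Qed.

Lemma has_rderiv_val f v z d : has_rderiv f v z d -> rderive f v z = d.
Proof.
case: d => x y [h1 h2]; rewrite /rderive !derive1E.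
by congr Complex; exact: derive_val.
Qed.

Lemma near_line z v : U z -> \forall t \near (0 : R), U (z + Cof t *: v).
Proof.
move=> Uz; have : nbhs z U by exact: open_nbhs_nbhs.
move=> /nbhs_ballP[e /= e0 zeU].
(* The radius and the norm are elements of [C R]; as they are nonnegative, they come from real
   numbers. *)
have [e' e'0 ee'] : exists2 e' : R, 0 < e' & e = Cof e'.
  case: e e0 {zeU} => x y; rewrite ltcE /= => /andP[/eqP -> x0]; by exists x.
have [r r0 rv] : exists2 r : R, 0 <= r & `|v| = Cof r.
  have : 0 <= `|v| by []. 
  case: `|v| => x y; rewrite lecE /= => /andP[/eqP -> x0]; by exists x.
apply/nbhs_ballP; exists (e' / (r + 1)); first by rewrite /= divr_gt0 //
  ltr_wpDl.
move=> t; rewrite /ball /= sub0r normrN => te; apply: zeU.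
rewrite -ball_normE /= opprD addrA subrr add0r normrN normrZ rv ee'.
have -> : `|Cof t| = Cof `|t| :> C R by rewrite normc_def /= expr0n /= addr0
  sqrtr_sqr.
rewrite /Cof -rmorphM /= ltcR.
move: te; rewrite ltr_pdivlMr ?ltr_wpDl //; apply: le_lt_trans.
by rewrite ler_wpM2l // lerDl.
Qed.

Lemma has_rderiv_eq f g v z d : U z -> (forall w, U w -> f w = g w) ->
  has_rderiv f v z d -> has_rderiv g v z d.
Proof.
move=> Uz fg [h1 h2]; have nU := near_line v Uz.
split; [apply: near_eq_is_derive h1|apply: near_eq_is_derive h2].
  by move: nU; apply: filterS => t Ut; rewrite /re_line fg.
by move: nU; apply: filterS => t Ut; rewrite /im_line fg.
Qed.

Let line0 f z v : f (z + Cof 0 *: v) = f z.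
Proof. by rewrite /Cof rmorph0 scale0r addr0. Qed.

Lemma has_rderivD f g v z d d' : has_rderiv f v z d -> has_rderiv g v z d' ->
  has_rderiv (fun w => f w + g w) v z (d + d').
Proof.
move=> [f1 f2] [g1 g2]; split.
  have -> : re_line (fun w => f w + g w) z v = re_line f z v + re_line g z v.
    by apply/funext => t; rewrite /re_line raddfD.
  by rewrite raddfD; exact: is_deriveD.
have -> : im_line (fun w => f w + g w) z v = im_line f z v + im_line g z v.
  by apply/funext => t; rewrite /im_line raddfD.
by rewrite raddfD; exact: is_deriveD.
Qed.

Lemma has_rderiv_cst (c : C R) v z : has_rderiv (fun=> c) v z 0.
Proof. by split; exact: is_derive_cst. Qed.

Lemma has_rderivM f g v z d d' : has_rderiv f v z d -> has_rderiv g v z d' ->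
  has_rderiv (fun w => f w * g w) v z (f z * d' + g z * d).
Proof.
move=> [f1 f2] [g1 g2].
have ReD (x y : C R) : complex.Re (x + y) = complex.Re x + complex.Re y by
  case: x y => ? ? [].
have ImD (x y : C R) : complex.Im (x + y) = complex.Im x + complex.Im y by
  case: x y => ? ? [].
have ReM (x y : C R) : complex.Re (x * y) = complex.Re x * complex.Re y -
  complex.Im x * complex.Im y.
  by case: x y => ? ? [].
have ImM (x y : C R) : complex.Im (x * y) = complex.Re x * complex.Im y +
  complex.Im x * complex.Re y.
  by case: x y => ? ? [].
split.
  have -> : re_line (fun w => f w * g w) z v =
      re_line f z v * re_line g z v - im_line f z v * im_line g z v.
    by apply/funext => t; rewrite /re_line ReM.
  apply: is_derive_eq (is_deriveB (is_deriveM f1 g1) (is_deriveM f2 g2)) _.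
  rewrite /re_line /im_line !line0 ReD !ReM opprD addrACA.
  by [].
have -> : im_line (fun w => f w * g w) z v =
    re_line f z v * im_line g z v + im_line f z v * re_line g z v.
  by apply/funext => t; rewrite /im_line ImM.
apply: is_derive_eq (is_deriveD (is_deriveM f1 g2) (is_deriveM f2 g1)) _.
rewrite /re_line /im_line !line0 ImD !ImM addrACA; congr (_ + _).
exact: addrC.
Qed.

(* The derivative exists by the formulas for the parts of the inverse; its value
   comes from the product rule applied to f * f^-1 = 1. *)
Lemma has_rderivV f v z d : U z -> (forall w, U w -> f w != 0) ->
  has_rderiv f v z d ->
  has_rderiv (fun w => (f w)^-1) v z (- (f z)^-1 * (f z)^-1 * d).
Proof.
move=> Uz f0 hf; have [[df1 _] [df2 _]] := hf.
pose N : R -> R := re_line f z v * re_line f z v + im_line f z v * im_line f z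
  v.
have N0 : N 0 != 0.
  rewrite /N /= /GRing.add_fun /= /re_line /im_line;
    change ((complex.Re (f (z + Cof 0 *: v)) * complex.Re (f (z + Cof 0 *: v)) +
    complex.Im (f (z + Cof 0 *: v)) * complex.Im (f (z + Cof 0 *: v))) != 0).
  rewrite line0; have := f0 z Uz; case: (f z) => x y /=.
  rewrite eq_complex /= -!expr2 paddr_eq0 ?sqr_ge0 // !sqrf_eq0.
  by [].
have ReV (w : C R) : complex.Re w^-1 =
    complex.Re w * (complex.Re w * complex.Re w + complex.Im w * complex.Im
      w)^-1.
  by case: w => x y /=; rewrite !expr2.
have ImV (w : C R) : complex.Im w^-1 =
    - (complex.Im w * (complex.Re w * complex.Re w + complex.Im w * complex.Im
      w)^-1).
  by case: w => x y /=; rewrite !expr2.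
have dN : derivable N 0 1 := derivableD (derivableM df1 df1) (derivableM df2
  df2).
have dV : derivable (fun t => (N t)^-1) 0 1 by exact: derivableV.
have h : rderivable (fun w => (f w)^-1) v z.
  split.
    have -> : re_line (fun w => (f w)^-1) z v = re_line f z v * (fun t =>
      (N t)^-1).
      by apply/funext => t; rewrite /re_line ReV.
    exact: (derivableM df1 dV).
  have -> : im_line (fun w => (f w)^-1) z v = - (im_line f z v * (fun t =>
    (N t)^-1)).
    by apply/funext => t; rewrite /im_line ImV.
  exact: (derivableN (derivableM df2 dV)).
have hV := has_rderivP h; set d' := rderive _ v z in hV.
have e1 := has_rderivM hf hV.
have e2 := has_rderiv_eq Uz (_ : forall w, U w ->
  1 = f w * (f w)^-1) (has_rderiv_cst 1 v z).
have {}e2 := e2 (fun w Uw => esym (mulfV (f0 w Uw))).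
have := has_rderiv_val e1; rewrite (has_rderiv_val e2) => e3.
suff -> : - (f z)^-1 * (f z)^-1 * d = d' by [].
apply: (mulfI (f0 z Uz)); apply/eqP; rewrite -subr_eq0 -oppr_eq0 opprB;
  apply/eqP.
rewrite [RHS]e3; congr (_ + _); rewrite !mulNr mulrN opprK !mulrA mulfV ?mul1r
  //.
exact: f0.
Qed.

(** This class is stable under sums, products and inverses. It is the regularity needed of the
    connection for its [delbar], the curvature, to be continuous. *)
Definition C1_on f := continuous_on f /\
  exists D : 'rV[C R]_n -> 'rV[C R]_n -> C R,
    (forall v z, U z -> has_rderiv f v z (D v z)) /\ forall v,
      continuous_on (D v).

Lemma Ck1_C1_on f : Ck 1 U f -> C1_on f.
Proof.
move=> [cf df]; split=> //; exists (rderive f); split=> v;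
  first by move=> z Uz; apply: has_rderivP; case: (df v) => h _; exact: h.
by case: (df v) => _ [].
Qed.

Lemma C1_on_rderive f v : C1_on f -> continuous_on (rderive f v).
Proof.
move=> [_ [D [hD cD]]]; apply: continuous_on_eq (cD v) => z Uz.
by rewrite (has_rderiv_val (hD v z Uz)).
Qed.

Lemma C1_on_eq f g : (forall z, U z -> f z = g z) -> C1_on f -> C1_on g.
Proof.
move=> fg [cf [D [hD cD]]]; split; first exact: continuous_on_eq cf.
by exists D; split=> // v z Uz; exact: (has_rderiv_eq Uz fg (hD v z Uz)).
Qed.

Lemma C1_on_cst (c : C R) : C1_on (fun=> c).
Proof.
split; first exact: continuous_on_cst.
exists (fun _ _ => 0); split=> v; [by move=> z _;
  exact: has_rderiv_cst|exact: continuous_on_cst].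
Qed.

Lemma C1_onD f g : C1_on f -> C1_on g -> C1_on (fun z => f z + g z).
Proof.
move=> [cf [D [hD cD]]] [cg [D' [hD' cD']]]; split;
  first exact: (continuous_onD cf cg).
exists (fun v z => D v z + D' v z); split=> v.
  by move=> z Uz; exact: (has_rderivD (hD v z Uz) (hD' v z Uz)).
exact: (continuous_onD (cD v) (cD' v)).
Qed.

Lemma C1_onM f g : C1_on f -> C1_on g -> C1_on (fun z => f z * g z).
Proof.
move=> [cf [D [hD cD]]] [cg [D' [hD' cD']]]; split;
  first exact: (continuous_onM cf cg).
exists (fun v z => f z * D' v z + g z * D v z); split=> v.
  by move=> z Uz; exact: (has_rderivM (hD v z Uz) (hD' v z Uz)).
exact: (continuous_onD (continuous_onM cf (cD' v)) (continuous_onM cg (cD v))).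
Qed.

Lemma C1_onV f : (forall z, U z -> f z != 0) -> C1_on f -> C1_on (fun z =>
  (f z)^-1).
Proof.
move=> f0 [cf [D [hD cD]]]; split; first exact: (continuous_onV f0 cf).
have cV := continuous_onV f0 cf.
have cVN : continuous_on (fun z => - (f z)^-1) by move=> z Uz;
  exact: (cvgN (cV z Uz)).
exists (fun v z => - (f z)^-1 * (f z)^-1 * D v z); split=> v.
  by move=> z Uz; exact: (has_rderivV Uz f0 (hD v z Uz)).
exact: (continuous_onM (continuous_onM cVN cV) (cD v)).
Qed.

Lemma C1_on_sum (I : Type) (r : seq I) (P : pred I) (F : I -> 'rV[C R]_n ->
  C R) :
  (forall i, P i -> C1_on (F i)) -> C1_on (fun z => \sum_(i <- r | P i) F i z).
Proof.
move=> h; elim: r => [|i r ih].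
  have -> : (fun z => \sum_(i <- [::] | P i) F i z) = fun=>
    0 by apply/funext => z; rewrite big_nil.
  exact: C1_on_cst.
have [Pi|nPi] := boolP (P i).
  have -> : (fun z => \sum_(j <- i :: r | P j) F j z) = fun z =>
    F i z + \sum_(j <- r | P j) F j z.
    by apply/funext => z; rewrite big_cons Pi.
  exact: (C1_onD (h i Pi) ih).
have -> // : (fun z => \sum_(j <- i :: r | P j) F j z) = fun z =>
  \sum_(j <- r | P j) F j z.
by apply/funext => z; rewrite big_cons (negPf nPi).
Qed.

Lemma C1_on_prod (I : Type) (r : seq I) (P : pred I) (F : I -> 'rV[C R]_n ->
  C R) :
  (forall i, P i -> C1_on (F i)) -> C1_on (fun z => \prod_(i <- r | P i) F i z).
Proof.
move=> h; elim: r => [|i r ih].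
  have -> : (fun z => \prod_(i <- [::] | P i) F i z) = fun=>
    1 by apply/funext => z; rewrite big_nil.
  exact: C1_on_cst.
have [Pi|nPi] := boolP (P i).
  have -> : (fun z => \prod_(j <- i :: r | P j) F j z) = fun z =>
    F i z * \prod_(j <- r | P j) F j z.
    by apply/funext => z; rewrite big_cons Pi.
  exact: (C1_onM (h i Pi) ih).
have -> // : (fun z => \prod_(j <- i :: r | P j) F j z) = fun z =>
  \prod_(j <- r | P j) F j z.
by apply/funext => z; rewrite big_cons (negPf nPi).
Qed.

Lemma C1_on_det m (A : 'rV[C R]_n -> 'M[C R]_m) :
  (forall i j, C1_on (fun z => A z i j)) -> C1_on (fun z => \det (A z)).
Proof.
move=> h; apply: (@C1_on_sum _ _ _ (fun (s : 'S_m) z =>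
  (-1) ^+ s * \prod_i A z i (s i))) => s _.
apply: (C1_onM (C1_on_cst _)).
by apply: (@C1_on_prod _ _ _ (fun i z => A z i (s i))) => i _; exact: h.
Qed.

(** By Cramer's rule, the entries are cofactors divided by the determinant. *)
Lemma C1_on_invmx m (A : 'rV[C R]_n -> 'M[C R]_m) :
  (forall z, U z -> A z \in unitmx) ->
  (forall i j, C1_on (fun z => A z i j)) ->
  forall i j, C1_on (fun z => invmx (A z) i j).
Proof.
move=> uA h i j.
have d0 z : U z -> \det (A z) != 0 by move=> Uz; have := uA z Uz;
  rewrite unitmxE unitfE.
have ca : C1_on (fun z => \adj (A z) i j).
  apply: (@C1_on_eq (fun z => (-1) ^+ (j + i) * \det (row' j (col' i (A z))))).
    by move=> z _; rewrite mxE.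
  apply: (C1_onM (C1_on_cst _)); apply: C1_on_det => k l.
  apply: (@C1_on_eq (fun z => A z (lift j k) (lift i l))) => [z _|];
    last exact: h.
  by rewrite !mxE.
apply: (C1_on_eq _ (C1_onM (C1_onV d0 (C1_on_det h)) ca)) => z Uz.
by rewrite /invmx (uA z Uz) [RHS]mxE.
Qed.

Lemma C1_on_dz_deriv f j : smooth_on U f -> C1_on (dz_deriv j f).
Proof.
(* Two derivatives are taken from smoothness: [dz_deriv] consumes one, and the other gives the class
   C^1. *)
move=> sf; have /= [_ h] := sf 2.
have c1 v : C1_on (rderive f v) by apply: Ck1_C1_on; case: (h v).
have c2 := C1_onM (C1_on_cst (- 'i)) (c1 ('i *: basis_vec R j)).
apply: (C1_on_eq _ (C1_onM (C1_on_cst (2^-1)) (C1_onD (c1 (basis_vec R j))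
  c2))) => z Uz.
by rewrite /dz_deriv mulNr.
Qed.

Lemma continuous_on_dzbar_deriv f j : C1_on f ->
  continuous_on (dzbar_deriv j f).
Proof.
move=> cf; have c v := @C1_on_rderive f v cf.
have h := continuous_onM (@continuous_on_cst 2^-1) (continuous_onD (c
  (basis_vec R j)) (continuous_onM (@continuous_on_cst 'i) (c ('i *: basis_vec
  R j)))).
exact: (continuous_on_eq _ h).
Qed.

End C1.

Section FormContinuity.
Variables (R : realType) (n : nat) (U : set 'rV[C R]_n).
Hypothesis U_open : open U.
Implicit Types (u v : 'rV[C R]_n -> extform R n).

Definition form_continuous_on u := forall S, continuous_on U (fun z => u z S).

Lemma form_continuous_on_wedge u v : form_continuous_on u ->
  form_continuous_on v ->
  form_continuous_on (fun z => wedge (u z) (v z)).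
Proof.
move=> cu cv S; apply: (continuous_on_eq U_open (f := fun z =>
  \sum_(A : {set 'I_(n + n)} | A \subset S) (-1) ^+ inversions A (S :\: A)%SET
    * u z A * v z (S :\: A)%SET)).
  by move=> z _; rewrite ffunE.
apply: continuous_on_sum => A _.
exact: (continuous_onM (continuous_onM (@continuous_on_cst _ _ U _) (cu A)) (cv
  _)).
Qed.

Lemma form_continuous_on_cst (c : extform R n) : form_continuous_on (fun=> c).
Proof. by move=> S; exact: continuous_on_cst. Qed.

Lemma form_continuous_onZ (c : C R) u : form_continuous_on u ->
  form_continuous_on (fun z => c *: u z).
Proof.
move=> cu S; apply: (continuous_on_eq U_open (f := fun z => c * u z S)).
  by move=> z _; rewrite ffunE.
exact: (continuous_onM (@continuous_on_cst _ _ U _) (cu S)).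
Qed.

Lemma form_continuous_on_sum (I : Type) (r : seq I) (P : pred I) (F : I ->
  'rV[C R]_n -> extform R n) :
  (forall i, P i -> form_continuous_on (F i)) ->
  form_continuous_on (fun z => \sum_(i <- r | P i) F i z).
Proof.
move=> h S; apply: (continuous_on_eq U_open (f := fun z =>
  \sum_(i <- r | P i) F i z S)).
  by move=> z _; rewrite sum_ffunE.
by apply: continuous_on_sum => i Pi; exact: h.
Qed.

Lemma form_continuous_on_wedge_seq q (b : 'I_q -> 'rV[C R]_n -> extform R n) :
  (forall j, form_continuous_on (b j)) ->
  form_continuous_on (fun z => wedge_seq (fun j => b j z)).
Proof.
move=> h; rewrite /wedge_seq; elim: (index_enum _) => [|j r ih].
  rewrite (_ : (fun z => _) = (fun=> scalar_form n 1));
    first exact: form_continuous_on_cst.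
  by apply/funext => z; rewrite big_nil.
rewrite (_ : (fun z => _) =
  (fun z => wedge (b j z) (\big[@wedge R n/scalar_form n 1]_(i <- r) b i z))).
  exact: form_continuous_on_wedge (h j) ih.
by apply/funext => z; rewrite big_cons.
Qed.

Lemma form_continuous_on_delbar u :
  (forall S, C1_on U (fun z => u z S)) -> form_continuous_on (delbar u).
Proof.
move=> cu; apply: form_continuous_on_sum => j _.
apply: form_continuous_on_wedge; first exact: form_continuous_on_cst.
move=> S; apply: (continuous_on_eq U_open (f := dzbar_deriv j (fun w =>
  u w S))).
  by move=> z _; rewrite ffunE.
exact: continuous_on_dzbar_deriv.
Qed.

Lemma C1_on_del u :
  (forall j S, C1_on U (dz_deriv j (fun w => u w S))) ->
  forall S, C1_on U (fun z => del u z S).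
Proof.
move=> cu S; apply: (C1_on_eq U_open (f := fun z => \sum_j
  \sum_(A : {set 'I_(n + n)} | A \subset S)
    ((-1) ^+ inversions A (S :\: A)%SET * (dz R j A : C R) : C R) * dz_deriv j
      (fun w => u w (S :\: A)%SET) z)).
  move=> z _; rewrite sum_ffunE; apply: eq_bigr => j _; rewrite ffunE.
  by apply: eq_bigr => A _; congr (_ * _); rewrite ffunE.
apply: C1_on_sum => // j _; apply: C1_on_sum => // A _.
exact: (C1_onM (@C1_on_cst _ _ U _) (cu j (S :\: A)%SET)).
Qed.

End FormContinuity.

Section ChernContinuity.
Variables (R : realType) (n : nat) (X : complex_manifold R n).
Variables (r : nat) (E : hol_bundle X r) (h : hermitian_metric E).
Variables (i : cm_index X) (a : frame_index E).
Let U := chart_map (cm_chart i) @` local_dom i a.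

(** This is the part of the open image of the chart that [chart_inv], continuous there, sends into
    the open domain of the frame. *)
Lemma local_image_open : open U.
Proof.
rewrite openE => _ [x [xi xa] <-]; set z := chart_map (cm_chart i) x.
have zV : (chart_map (cm_chart i) @` chart_dom (cm_chart i)) z by exists x.
have oV : open (chart_map (cm_chart i) @` chart_dom (cm_chart i)) by exact:
  chart_cod_open.
have nV : nbhs z (chart_map (cm_chart i) @` chart_dom (cm_chart i)).
  by apply: open_nbhs_nbhs; split=> //; exact: chart_cod_open.
have cinv := chart_inv_continuous (c := cm_chart i).
rewrite (continuous_open_subspace _ oV) in cinv.
have /cinv cz : z \in chart_map (cm_chart i) @` chart_dom (cm_chart i) by
  rewrite inE.
have na : nbhs (chart_inv (cm_chart i) z) (frame_dom a).
  by rewrite chart_mapK //; apply: open_nbhs_nbhs; split=> //;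
    exact: frame_dom_open.
have := cz _ na; apply: filterS2 nV => _ [y yi <-] /=;
  rewrite chart_mapK // => ya.
by exists y.
Qed.

Lemma local_imageK z : U z -> local_dom i a (chart_inv (cm_chart i) z) /\
  chart_map (cm_chart i) (chart_inv (cm_chart i) z) = z.
Proof. by move=> [x xd <-]; rewrite chart_mapK //; case: xd. Qed.

Hypothesis gram_unit : forall z, U z -> gram h i a z \in unitmx.

Lemma C1_on_connection j l S : C1_on U (fun z => connection h i a j l z S).
Proof.
have oU := local_image_open.
apply: (C1_on_eq oU (f := fun z => \sum_m invmx (gram h i a z) m l *
   del (fun w => scalar_form n (gram h i a w j m)) z S)).
  by move=> z _; rewrite sum_ffunE; apply: eq_bigr => m _;
    rewrite [in RHS]ffunE.
have sg p q : smooth_on U (fun w => gram h i a w p q).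
  have := metric_smooth h a p q i; congr smooth_on.
  by apply/funext => z; rewrite mxE.
apply: C1_on_sum => // m _; apply: C1_onM => //.
  apply: C1_on_invmx => // p q.
  by apply: Ck1_C1_on; exact: sg.
(* A scalar form can have a nonzero coefficient at the empty set only. *)
apply: C1_on_del => // p T; case T0: (T == finset.set0).
  rewrite (_ : (fun w => _) = (fun w => gram h i a w j m)); last first.
    by apply/funext => w; rewrite ffunE T0.
  exact: C1_on_dz_deriv.
rewrite (_ : (fun w => _) = (fun w => 0)); last by apply/funext => w;
  rewrite ffunE T0.
rewrite (_ : dz_deriv p _ = (fun w => 0)); last by apply/funext => w;
  exact: dz_deriv0.
exact: C1_on_cst.
Qed.

(** The Chern form as a function of the coordinate, so that continuity makes sense on an open set of
    C^n; at the image of x it is convertible to [chern_form]. *)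
Definition chern_form_at k (z : 'rV[C R]_n) : extform R n :=
  \tr (ext_power k (map_mx (fun u : extform R n => ('i / Cof (2 * pi)) *: u)
    (\matrix_(j, l) delbar (connection h i a j l) z))).

Lemma form_continuous_on_chern k : form_continuous_on U (chern_form_at k).
Proof.
have oU := local_image_open.
have cd j l : form_continuous_on U (delbar (connection h i a j l)).
  by apply: form_continuous_on_delbar => // S; exact: C1_on_connection.
apply: form_continuous_on_sum => // p _.
rewrite (_ : (fun z => _) = (fun z => \sum_(sigma : 'S_k) (-1) ^+ sigma *:
    wedge_seq (fun s => ('i / Cof (2 * pi)) *: delbar (connection h i a
      ((enum_val p : {ffun 'I_k -> 'I_r}) s)
      ((enum_val p : {ffun 'I_k -> 'I_r}) (sigma s))) z))); last first.
  apply/funext => z; rewrite mxE; apply: eq_bigr => sigma _.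
  by congr (_ *: wedge_seq _); apply/funext => s; rewrite !mxE.
apply: form_continuous_on_sum => // sigma _.
apply: form_continuous_onZ => //; apply: form_continuous_on_wedge_seq => // s.
exact: form_continuous_onZ.
Qed.

End ChernContinuity.

(** * Bounds and comparison for the local integrals *)

Section CompactBound.
Variables (R : realType) (n : nat).

Lemma Re_Im_norm (w : C R) : Cof `|complex.Re w| <= `|w| /\ Cof `|complex.Im w|
  <= `|w|.
Proof.
case: w => x y; rewrite normc_def /Cof !lecR /=; split.
  by rewrite -sqrtr_sqr ler_wsqrtr // lerDl sqr_ge0.
by rewrite -sqrtr_sqr ler_wsqrtr // lerDr sqr_ge0.
Qed.

Lemma part_continuous (p : C R -> R) : (forall w t, p (w - t) = p w - p t) ->
  (forall w : C R, Cof `|p w| <= `|w|) -> continuous p.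
Proof.
move=> pB hp w B /nbhs_ballP[e /= e0 eB]; apply/nbhs_ballP.
exists (Cof e); first by rewrite /= ltcR.
move=> t wt; apply: eB; change (`|p w - p t| < e);
  have {}wt : `|w - t| < Cof e := wt.
by rewrite -pB -ltcR; exact: le_lt_trans (hp _) wt.
Qed.

Lemma Re_continuous : continuous (fun w : C R => complex.Re w).
Proof. by apply: part_continuous => [[? ?] [? ?]|w] //;
  case: (Re_Im_norm w). Qed.

Lemma Im_continuous : continuous (fun w : C R => complex.Im w).
Proof. by apply: part_continuous => [[? ?] [? ?]|w] //;
  case: (Re_Im_norm w). Qed.

Lemma compact_bound (A U : set 'rV[C R]_n) (f : 'rV[C R]_n -> R) :
  compact A -> A `<=` U -> (forall z, U z -> f @ z --> f z) ->
  exists M, forall z, A z -> `|f z| <= M.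
Proof.
move=> cA AU cf.
have /compact_bounded [M [_ hM]] : compact (f @` A).
  apply: continuous_compact cA; apply: continuous_in_subspaceT => z.
  by rewrite inE => /AU; exact: cf.
exists (M + 1) => z Az; apply: (hM (M + 1)); last by exists z.
by rewrite ltrDl.
Qed.

End CompactBound.

Section LocalIntegral.
Variables (R : realType) (n : nat) (X : complex_manifold R n).
Variables (r : nat) (E : hol_bundle X r) (P : partition_of_unity E) (s :
  'I_(pu_size P)).
Hypothesis X_compact : compact [set: X].

Let i := pu_chart s.
Let a := pu_frame s.
Let U := chart_map (cm_chart i) @` local_dom i a.

Definition local_integrand (u : local_forms E) : 'rV[C R]_n -> C R :=
  (fun z => let x := chart_inv (cm_chart i) z in Cof (pu_fun s x) * density (u
    i a x)) \_ U.

Let part_scale (p : R) (w : C R) :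
  complex.Re (Cof p * w) = p * complex.Re w /\ complex.Im (Cof p * w) = p *
    complex.Im w.
Proof. by case: w => x y /=; rewrite !mul0r subr0 addr0. Qed.

Let pu_le1 x : pu_fun s x <= 1.
Proof.
rewrite -(pu_sum P x) (bigD1 s) //= lerDl sumr_ge0 // => t _; exact: pu_ge0.
Qed.

(** The chart sends the closed support of the function of the partition, compact because X is, to a
    compact subset A of U. The density and the coordinates are bounded on A by continuity, and the
    integrand vanishes outside A. *)
Lemma local_integrand_boxed (u : local_forms E) (F : 'rV[C R]_n ->
  extform R n) :
  form_continuous_on U F ->
  (forall x, local_dom i a x -> u i a x = F (chart_map (cm_chart i) x)) ->
  exists M, boxed M (fun z => complex.Re (local_integrand u z)) /\
            boxed M (fun z => complex.Im (local_integrand u z)).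
Proof.
move=> cF uF.
pose A := chart_map (cm_chart i) @` closure [set x | pu_fun s x != 0].
have sub : closure [set x | pu_fun s x != 0] `<=` local_dom i a by exact:
  pu_support.
have cA : compact A.
  apply: continuous_compact.
    apply: continuous_subspaceW (chart_map_continuous (c := cm_chart i)) =>
      x /sub[].
    by [].
  exact: subclosed_compact (@closed_closure _ _) X_compact (@subsetT _ _).
have AU : A `<=` U by apply: image_subset.
pose f z := F z [set: 'I_(n + n)]%SET / wedge_seq (fun j : 'I_n =>
  ('i / 2) *: wedge (dz R j) (dzbar R j))
    [set: 'I_(n + n)]%SET.
have cf : continuous_on U f := continuous_onM (cF _) (@continuous_on_cst _ _ U
  _).
have [M1 h1] := compact_bound cA AU (fun z Uz =>
  continuous_comp (cf z Uz) (@Re_continuous R (f z))).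
have [M2 h2] := compact_bound cA AU (fun z Uz =>
  continuous_comp (cf z Uz) (@Im_continuous R (f z))).
have [Mr hr] := choice (fun j : 'I_n => compact_bound cA AU (fun z Uz =>
   continuous_comp (@coord_continuous _ 1 n 0 j z) (@Re_continuous R (z 0 j)))).
have [Mi hi] := choice (fun j : 'I_n => compact_bound cA AU (fun z Uz =>
   continuous_comp (@coord_continuous _ 1 n 0 j z) (@Im_continuous R (z 0 j)))).
(* The sum dominates the bounds of both parts of the density and of all coordinates on A. *)
pose M := `|M1| + `|M2| + \sum_j (`|Mr j| + `|Mi j|).
have S0 : 0 <= \sum_j (`|Mr j| + `|Mi j|) by apply: sumr_ge0 => j _;
  rewrite addr_ge0.
have leS j : `|Mr j| + `|Mi j| <= \sum_j (`|Mr j| + `|Mi j|).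
  rewrite [leRHS](bigD1 j) //= lerDl; apply: sumr_ge0 => k _;
    by rewrite addr_ge0.
have M0 : 0 <= M by rewrite !addr_ge0.
have zero z : ~ A z -> local_integrand u z = 0.
  move=> nA; rewrite /local_integrand patchE; case: ifP => // /set_mem Uz.
  have [xd xK] := local_imageK Uz.
  have [->|p0] := eqVneq (pu_fun s (chart_inv (cm_chart i) z)) 0.
    by rewrite /Cof rmorph0 mul0r.
  exfalso; apply: nA; exists (chart_inv (cm_chart i) z) => //.
  exact: subset_closure.
have val z : A z -> local_integrand u z = Cof (pu_fun s (chart_inv (cm_chart i)
  z)) * f z.
  move=> Az; rewrite /local_integrand patchE mem_set; last exact: AU.
  have [xd xK] := local_imageK (AU z Az).
  by rewrite /= /density uF // xK.
have coord z : A z -> forall j, `|complex.Re (z 0 j)| <= M /\ `|complex.Im (z 0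
  j)| <= M.
  move=> Az j; have := hr j z Az; have := hi j z Az; have := leS j.
  have := ler_norm (Mr j); have := ler_norm (Mi j).
  have := normr_ge0 M1; have := normr_ge0 M2.
  have := normr_ge0 (Mr j); have := normr_ge0 (Mi j).
  by rewrite /M /=; split; lra.
have pscale p (c B : R) : 0 <= p -> p <= 1 -> `|c| <= B -> B <= M ->
  `|p * c| <= M.
  move=> p0 p1 cB BM; rewrite normrM (ger0_norm p0).
  by apply: le_trans BM; apply: le_trans cB; rewrite ler_piMl.
have M1M : M1 <= M.
  by have := ler_norm M1; have := normr_ge0 M2; rewrite /M; lra.
have M2M : M2 <= M.
  by have := ler_norm M2; have := normr_ge0 M1; rewrite /M; lra.
exists M; split; split=> z.
- have [Az|/zero ->] := pselect (A z); last by rewrite normr0.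
  rewrite val // (part_scale _ _).1.
  by apply: pscale M1M; [exact: pu_ge0|exact: pu_le1|exact: h1].
- have [Az _|/zero ->] := pselect (A z); last by rewrite eqxx.
  exact: coord.
- have [Az|/zero ->] := pselect (A z); last by rewrite normr0.
  rewrite val // (part_scale _ _).2.
  by apply: pscale M2M; [exact: pu_ge0|exact: pu_le1|exact: h2].
- have [Az _|/zero ->] := pselect (A z); last by rewrite eqxx.
  exact: coord.
Qed.

(** The order of [C R] requires equal imaginary parts and compares real parts: the imaginary
    integrals coincide and the real ones are monotone. *)
Lemma local_integral_le (u v : local_forms E) (F G : 'rV[C R]_n ->
  extform R n) :
  form_continuous_on U F -> form_continuous_on U G ->
  (forall x, local_dom i a x -> u i a x = F (chart_map (cm_chart i) x)) ->
  (forall x, local_dom i a x -> v i a x = G (chart_map (cm_chart i) x)) ->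
  (forall x, local_dom i a x -> density (v i a x) <= density (u i a x)) ->
  complex_integral (local_integrand v) <= complex_integral (local_integrand u).
Proof.
move=> cF cG uF vG le.
have [M [rM iM]] := local_integrand_boxed cF uF.
have [N [rN iN]] := local_integrand_boxed cG vG.
have pw z : local_integrand v z <= local_integrand u z.
  rewrite /local_integrand !patchE; case: ifP => // /set_mem Uz.
  have [xd _] := local_imageK Uz.
  apply: ler_wpM2l; last exact: le.
  by rewrite lecE /= eqxx pu_ge0.
have pwE z : (complex.Im (local_integrand u z) == complex.Im (local_integrand v
  z)) &&
  (complex.Re (local_integrand v z) <= complex.Re (local_integrand u z)).
  by rewrite -lecE; exact: pw.
have boxed_le (B B' : R) (f : 'rV[C R]_n -> R) : B <= B' -> boxed B f ->
  boxed B' f.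
  move=> BB [f1 f2]; split=> [z|z /f2 h j]; first exact: le_trans (f1 z) BB.
  by have [h1 h2] := h j; split; apply: le_trans BB.
rewrite lecE /=; apply/andP; split.
  apply/eqP; congr real_integral; apply/funext => z.
  by case/andP: (pwE z) => /eqP.
apply: (@real_integral_monotone _ _ (Num.max M N)).
- by apply: boxed_le rN; rewrite le_max lexx orbT.
- by apply: boxed_le rM; rewrite le_max lexx.
- by move=> z; case/andP: (pwE z).
Qed.

End LocalIntegral.

(** * Densities of positive forms and the Chern numbers *)

Section DensityPositive.
Variables (R : realType).

Lemma prod_scale n (c : C R) (s : seq 'I_n) (f : 'I_n -> exterior R n) :
  \prod_(j <- s) (c *: f j) = c ^+ size s *: \prod_(j <- s) f j.
Proof.
elim: s => [|j s ih]; first by rewrite !big_nil expr0 scale1r.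
by rewrite !big_cons ih exprS -scalerAl -scalerAr scalerA.
Qed.

Lemma density_positive_volume n (u : extform R n) : positive_volume u ->
  0 <= density u.
Proof.
move=> [t t0 ->]; rewrite /density.
have -> : wedge_seq (fun j : 'I_n => ('i / 2) *: wedge (dz R j) (dzbar R j)) =
  (2^-1 : C R) ^+ n *: wedge_seq (fun j : 'I_n =>
    'i *: wedge (dz R j) (dzbar R j)).
  rewrite /wedge_seq.
  transitivity (\prod_(j <- index_enum 'I_n) ((2^-1 : C R) *: ('i *: ((dz R j :
    exterior R n) * dzbar R j)))).
    by apply: eq_bigr => j _; rewrite scalerA mulrC.
  by rewrite prod_scale [size _](_ : _ = n) // -[RHS]size_enum_ord enumT.
rewrite !ffunE; set V := wedge_seq _ _.
(* If the coefficient V were 0, the quotient would be 0 by the convention on division by 0;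
   otherwise V cancels and t 2^n remains. *)
have [->|V0] := eqVneq V 0; first by rewrite scaler0 mul0r.
rewrite /GRing.scale /= -mulf_div divff // mulr1.
by rewrite divr_ge0 ?exprn_ge0 ?invr_ge0 ?ler0n // lecE /= eqxx.
Qed.

Lemma densityB n (u v : extform R n) : density (u - v) = density u - density v.
Proof. by rewrite /density !ffunE mulrBl. Qed.

(** In top degree the test form has no factors and equals 1, so that positivity says that u - v
    itself is a positive volume form. *)
Lemma positive_form_density p (u v : extform R p) : positive_form p (u - v) ->
  density v <= density u.
Proof.
move=> [_ _ h]; rewrite -subr_ge0 -densityB; apply: density_positive_volume.
have := h 0; rewrite /= evenval_cross_rows.
have -> : cross_rows (0 : 'M[C R]_(p - p, p)) = 1.
  by rewrite /cross_rows big1 // => -[j jp]; move: (jp); rewrite subnn.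
have -> // : wedge (u - v) (evenval (1 : evenform R p)) = u - v.
exact: wedge1r (u - v).
Qed.

End DensityPositive.

Lemma chern_gram_unit (R : realType) (n : nat) (X : complex_manifold R n)
    (E : hol_bundle X 3) (h : hermitian_metric E) i a z :
  (chart_map (cm_chart i) @` local_dom i a) z -> gram h i a z \in unitmx.
Proof. by move=> [x xd <-]; exact: gram_unit. Qed.

Local Open Scope ring_scope.

Theorem corollary2p5 (R : realType) (n : nat) (X : complex_manifold R n)
    (E : hol_bundle X 3) (h : hermitian_metric E)
    (hE : griffiths_semipositive h) :
  let c := chern_form h in
  let c111 := wedge_forms (c 1%N) (wedge_forms (c 1%N) (c 1%N)) in
  let c12 := wedge_forms (c 1%N) (c 2%N) in
  let c3 := c 3%N in
  [/\ form_ge 3 c111 c12, form_ge 3 c12 c3 &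
      compact [set: X] -> n = 3%N ->
      forall P : partition_of_unity E,
        integral_form P c12 <= integral_form P c111 /\
        integral_form P c3 <= integral_form P c12].
Proof.
move=> c c111 c12 c3.
have ge1 : form_ge 3 c111 c12 by move=> i a x xd;
  case: (chern_form_positive xd hE).
have ge2 : form_ge 3 c12 c3 by move=> i a x xd;
  case: (chern_form_positive xd hE).
split=> // X_compact n3; subst n => P.
have cont i a k : form_continuous_on (chart_map (cm_chart i) @` @local_dom _ _
  X 3 E i a)
    (chern_form_at h i a k).
  by apply: form_continuous_on_chern => z; exact: chern_gram_unit.
have oU i a : open (chart_map (cm_chart i) @` @local_dom _ _ X 3 E i a) by
  exact: local_image_open.
have cw i a := form_continuous_on_wedge (oU i a).
have c12_cont i a := cw i a _ _ (cont i a 1%N) (cont i a 2%N).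
have c111_cont i a := cw i a _ _ (cont i a 1%N) (cw i a _ _ (cont i a 1%N)
  (cont i a 1%N)).
(* Both sides are sums over the same partition of unity, so that the comparison is made in each
   chart. *)
split; apply: ler_sum => s _.
  apply: (local_integral_le X_compact (c111_cont _ _) (c12_cont _ _)) =>
    // x xd.
  exact/positive_form_density/ge1.
apply: (local_integral_le X_compact (c12_cont _ _) (cont _ _ 3%N)) => // x xd.
exact/positive_form_density/ge2.
Qed.
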